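(* Let $a=\frac{i}{2}\begin{pmatrix}I_k&0\\0&-I_{n-k}\end{pmatrix}$, and $M$ the adjoint $U(n)$-orbit at $a$ in $u(n)$ (which is the Grassmannian $Gr(k,n)$). Then the GNLS flow $\gamma_t=[\gamma,\gamma_{xx}]$ on $C_a(\mathbb{R},M)$ corresponds to the MNLS flow $u_t=(Q_2)_x+[u,Q_2]$ on $\mathcal{S}(\mathbb{R},u(n)_a^\perp)$ under the development map $\Phi$. That is, if $\gamma(x,t)$ solves $\gamma_t=[\gamma,\gamma_{xx}]$ with $\gamma(\cdot,t)\in C_a(\mathbb{R},M)$, then $u(\cdot,t)=\Phi(\gamma(\cdot,t))$ solves $u_t=(Q_2)_x+[u,Q_2]$.
   Context: $u(n)$ carries the invariant inner product $\langle x,y\rangle=-\mathrm{tr}(xy)$. $u(n)_a=\{y\in u(n): [y,a]=0\}$ is the centralizer of $a$ (block-diagonal matrices $\mathrm{diag}(A_1,A_2)$, $A_1\in u(k)$, $A_2\in u(n-k)$), and $u(n)_a^\perp=\left\{\begin{pmatrix}0&q\\-q^*&0\end{pmatrix}: q\in \mathcal{M}_{k\times(n-k)}\right\}$ is its orthogonal complement. $\mathcal{S}(\mathbb{R},u(n)_a^\perp)$ denotes Schwartz-class maps $\mathbb{R}\to u(n)_a^\perp$. $C_a(\mathbb{R},M)$ is the space of smooth paths $\gamma:\mathbb{R}\to M$ with $\lim_{x\to-\infty}\gamma(x)=a$ and $\gamma_x$ in the Schwartz class. The development map $\Phi:C_a(\mathbb{R},M)\to \mathcal{S}(\mathbb{R},u(n)_a^\perp)$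 is defined by $\Phi(\gamma)=g^{-1}g_x$, where $g:\mathbb{R}\to U(n)$ is the unique map with $\gamma=gag^{-1}$, $g(-\infty)=I$ and $g^{-1}g_x\in u(n)_a^\perp$; $\Phi$ is a bijection. In the MNLS equation, $u=\begin{pmatrix}0&q\\-q^*&0\end{pmatrix}$ and $Q_2=\begin{pmatrix}-iqq^*& iq_x\\ iq^*_x& iq^*q\end{pmatrix}$; written in $q$ it is $q_t=i(q_{xx}+2qq^*q)$. The equation $\gamma_t=[\gamma,\gamma_{xx}]$ is the geometric nonlinear Schrödinger equation $J_\gamma\gamma_t=\nabla_{\gamma_x}\gamma_x$ for $Gr(k,n)$ embedded as this adjoint orbit. *)

(* Defs.v *)
From HB Require Import structures.
From mathcomp Require Import all_boot all_order all_algebra.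
From mathcomp Require Import all_classical all_reals all_analysis.
From mathcomp Require Import complex.
Set Implicit Arguments. Unset Strict Implicit. Unset Printing Implicit Defensive.
Import Order.TTheory GRing.Theory Num.Theory.
Import numFieldNormedType.Exports.
Local Open Scope classical_set_scope.
Local Open Scope ring_scope.

Section Defs.
Context {R : realType}.
Local Notation C := (R[i]).

Definition adj {p q : nat} (A : 'M[C]_(p, q)) : 'M[C]_(q, p) := (map_mx Num.conj A)^T.

Definition comm {n : nat} (A B : 'M[C]_n) : 'M[C]_n := A *m B - B *m A.

Definition unitary {n : nat} (g : 'M[C]_n) : Prop := g *m adj g = 1%:M.

Definition base_a (k m : nat) : 'M[C]_(k + m) :=
  block_mx (('i / 2%:R)%:M) 0 0 (- ('i / 2%:R)%:M).

Definition in_orbit (k m : nat) (A : 'M[C]_(k + m)) : Prop :=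
  exists g : 'M[C]_(k + m), unitary g /\ A = g *m base_a k m *m invmx g.

Definition in_perp (k m : nat) (A : 'M[C]_(k + m)) : Prop :=
  exists q : 'M[C]_(k, m), A = block_mx 0 q (- adj q) 0.

Definition reE {p q : nat} (f : R -> 'M[C]_(p, q)) i j : R -> R :=
  fun x => complex.Re (f x i j).
Definition imE {p q : nat} (f : R -> 'M[C]_(p, q)) i j : R -> R :=
  fun x => complex.Im (f x i j).

Definition mderivable {p q : nat} (f : R -> 'M[C]_(p, q)) (x : R) : Prop :=
  forall i j, derivable (reE f i j) x 1 /\ derivable (imE f i j) x 1.
Definition mderive {p q : nat} (f : R -> 'M[C]_(p, q)) : R -> 'M[C]_(p, q) :=
  fun x => \matrix_(i, j) (@complex.Complex R (derive1 (reE f i j) x)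
                                             (derive1 (imE f i j) x)).
Definition mderiven {p q : nat} (n : nat) (f : R -> 'M[C]_(p, q)) :=
  iter n (@mderive p q) f.

Definition msmooth {p q : nat} (f : R -> 'M[C]_(p, q)) : Prop :=
  forall n x, mderivable (mderiven n f) x.

Definition mschwartz {p q : nat} (f : R -> 'M[C]_(p, q)) : Prop :=
  msmooth f /\
  forall (r s : nat), exists B : R, forall x i j,
    `|x| ^+ r * `|reE (mderiven s f) i j x| <= B /\
    `|x| ^+ r * `|imE (mderiven s f) i j x| <= B.

Definition mlim_minf {p q : nat} (f : R -> 'M[C]_(p, q)) (l : 'M[C]_(p, q)) : Prop :=
  forall i j, (reE f i j x @[x --> -oo] --> complex.Re (l i j)) /\
              (imE f i j x @[x --> -oo] --> complex.Im (l i j)).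

Definition in_Ca (k m : nat) (g : R -> 'M[C]_(k + m)) : Prop :=
  (forall x, in_orbit (g x)) /\ msmooth g /\ mlim_minf g (base_a k m) /\
  mschwartz (mderive g).

Definition is_dev (k m : nat) (gam g : R -> 'M[C]_(k + m)) : Prop :=
  (forall x, unitary (g x)) /\
  (forall x, gam x = g x *m base_a k m *m invmx (g x)) /\
  mlim_minf g 1%:M /\
  (forall x, mderivable g x) /\
  (forall x, in_perp (invmx (g x) *m mderive g x)).

Definition Phi (k m : nat) (gam : R -> 'M[C]_(k + m)) : R -> 'M[C]_(k + m) :=
  match pselect (exists g, is_dev gam g) with
  | left H => let g := proj1_sig (cid H) in fun x => invmx (g x) *m mderive g x
  | right _ => fun _ => 0
  end.

(* Q_2 built from u = [[0, q], [-q^*, 0]] *)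
Definition Q2 (k m : nat) (u : R -> 'M[C]_(k + m)) : R -> 'M[C]_(k + m) :=
  fun x =>
    let q := fun y => ursubmx (u y) in
    let qs := fun y => adj (q y) in
    block_mx (- 'i *: (q x *m qs x)) ('i *: mderive q x)
             ('i *: mderive qs x) ('i *: (qs x *m q x)).

Definition pdn (p r : nat) (f : R -> R -> R) : R -> R -> R :=
  fun x t => derive1n p (fun y => derive1n r (fun s => f y s) t) x.

Definition smooth2 (f : R -> R -> R) : Prop :=
  forall p r,
    (forall x t, derivable (fun y => pdn p r f y t) x 1 /\
                 derivable (fun s => pdn p r f x s) t 1) /\
    continuous (fun z : R * R => pdn p r f z.1 z.2).

Definition msmooth2 {n : nat} (gam : R -> R -> 'M[C]_n) : Prop :=
  forall i j, smooth2 (fun x t => complex.Re (gam x t i j)) /\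
              smooth2 (fun x t => complex.Im (gam x t i j)).

End Defs.

(* Main.v *)
Require Import Defs.
From HB Require Import structures.
From mathcomp Require Import all_boot all_order all_algebra.
From mathcomp Require Import all_classical all_reals all_analysis.
From mathcomp Require Import complex.
From mathcomp Require Import ring lra.
Import Order.TTheory GRing.Theory Num.Theory.
Import numFieldNormedType.Exports.
Set Implicit Arguments. Unset Strict Implicit. Unset Printing Implicit Defensive.
Local Open Scope classical_set_scope.
Local Open Scope ring_scope.

(* With P = [gamma, gamma_x] and N the companion time component, the GNLS equation says that the
   connection (P, N) is flat, so there is a unitary frame G on the whole (x, t)-plane with G_x = P G,
   G_t = N G and gamma = G a G^*. Then G^* P G is off-diagonal and satisfies MNLS, by gauging the
   zero-curvature equation. It is Phi(gamma) once G is normalised at x = -oo, so everything rests on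
   the limit c(t) of G(x, t) as x -> -oo being independent of t.
   The decay of gamma_x is only given for each fixed t, with no uniformity in t. The mean of G over
   [-2L, -L] varies slowly in t for large L as soon as the L^2 norms of u and u_x are locally bounded
   in t. Let E be the closed set of times where this fails. By Baire the norms are bounded on a
   relatively open portion of E; across a complementary gap mass and energy are conserved (cut-off
   conservation laws, and a Gronwall argument for u_t), which bounds the norms on the gap by their
   values at its end points, so they are bounded near that portion: a contradiction. *)

(** Decay in x at each single t says nothing about the limit x -> -oo under a change of t: G_t = G
    Q, with Q of size |u_x| + |u|^2, may be large far to the left at nearby times. Bounded L^2 norms
    only make the integral of |u_x| over a window of length L of order o(L), hence the means. The
    equation is focusing: the energy |u_x|^2 - |u^2|^2 has no sign, and its quartic term is absorbed
    by a one-dimensional Sobolev inequality whose parameter is fixed by the mass. The energy flux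
    contains u_t, so discarding it at infinity needs a bound on u_t uniform in time; this costs a
    second use of Baire, inside an interval where u and u_x are already bounded. The bound across a
    gap must not depend on the qualitative bounds that make the fluxes vanish, so the estimates
    deliver a function [Fn] of the initial bound, quantified before the interval. The choice N = S
    (V + T^2), with S = 2 gamma, T = gamma_x, V = gamma_t, makes the conjugate of N by G equal to
    Q_2: S V gives the off-diagonal part, S T^2 the diagonal one. *)

Section RealCalculus.
Context {R : realType}.
Implicit Types (f g : R -> R) (a b x : R).

(** * One-variable calculus: linear approximation, comparison by derivatives, integrals of
    continuous functions *)

Lemma is_derive_approxP f x (d : R) :
  is_derive x 1 f d <->
  forall e, 0 < e -> exists2 del, 0 < del &
    forall h, `|h| < del -> `|f (x + h) - f x - h * d| <= e * `|h|.
Proof.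
split.
  move=> [fd <-] e e0.
  have /cvgrPdist_le/(_ e e0) := fd.
  rewrite /= near_withinE => /nbhs_ballP[del /= del0 H].
  exists del => // h hdel.
  have [->|h0] := eqVneq h 0; first by rewrite addr0 subrr mul0r subrr normr0 mulr0.
  have := H h; rewrite /ball/= sub0r normrN => /(_ hdel h0) /=.
  rewrite /GRing.scale/= mulr1.
  rewrite (_ : f (x + h) - f x - h * 'D_1 f x = - (('D_1 f x) - h^-1 * (f (h + x) - f x)) * h); last first.
    by rewrite (addrC h x); field.
  by rewrite normrM normrN => /ler_wpM2r; apply.
move=> H.
have L : (fun h : R => h^-1 *: (f (h *: 1 + x) - f x)) @ 0^' --> (d : R).
  apply/cvgrPdist_le => e e0; rewrite /= near_withinE.
  have [del del0 Hd] := H e e0.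
  apply/nbhs_ballP; exists del => //= h; rewrite /ball/= sub0r normrN => hdel h0.
  have := Hd h hdel; rewrite /GRing.scale/= mulr1.
  rewrite (_ : f (x + h) - f x - h * d = - (d - h^-1 * (f (h + x) - f x)) * h); last first.
    by rewrite (addrC h x); field.
  by rewrite normrM normrN ler_pM2r ?normr_gt0.
apply: DeriveDef; first by apply/cvg_ex; exists d.
exact/cvg_lim.
Qed.

Lemma is_derive_funC (k x : R) : is_derive x 1 (fun=> k) 0.
Proof. exact: is_derive_cst. Qed.

Lemma is_derive_funD f g x (d e : R) : is_derive x 1 f d -> is_derive x 1 g e ->
  is_derive x 1 (fun y => f y + g y) (d + e).
Proof. by move=> df dg; exact: is_deriveD. Qed.

Lemma is_derive_funN f x (d : R) : is_derive x 1 f d -> is_derive x 1 (fun y => - f y) (- d).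
Proof. by move=> df; exact: is_deriveN. Qed.

Lemma is_derive_funB f g x (d e : R) : is_derive x 1 f d -> is_derive x 1 g e ->
  is_derive x 1 (fun y => f y - g y) (d - e).
Proof. by move=> df dg; exact: is_deriveB. Qed.

Lemma is_derive_funM f g x (d e : R) : is_derive x 1 f d -> is_derive x 1 g e ->
  is_derive x 1 (fun y => f y * g y) (d * g x + f x * e).
Proof.
move=> df dg; apply: (@is_derive_eq _ _ _ _ _ _ _ _ (@is_deriveM _ _ f g x 1 d e df dg)).
by rewrite /GRing.scale/= addrC (mulrC d).
Qed.

Lemma is_derive_funZ (k : R) f x (d : R) : is_derive x 1 f d ->
  is_derive x 1 (fun y => k * f y) (k * d).
Proof. by move=> df; exact: is_deriveZ. Qed.

Lemma is_derive_linear (k x : R) : is_derive x 1 (fun y : R => k * y) k.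
Proof.
by have := is_derive_funZ k (is_derive_id x (1 : R)); rewrite mulr1.
Qed.

Lemma continuous_lin f g (k l : R) : continuous f -> continuous g ->
  continuous (fun x => k * f x + l * g x).
Proof.
move=> cf cg x; apply: (@continuousD _ _ _ (fun x => k * f x) (fun x => l * g x));
  apply: continuousM; by [exact: cst_continuous|exact: cf|exact: cg].
Qed.

Lemma is_derive_continuous f x (d : R) : is_derive x 1 f d -> {for x, continuous f}.
Proof.
by move=> [fd _]; apply: differentiable_continuous; apply/derivable1_diffP.
Qed.

(** Mean value theorem for g - f. The integral estimates below all rest on such comparisons of
    primitives, so Lebesgue measure appears only in the existence of primitives. *)
Lemma le_of_derive f g (f' g' : R -> R) a b : a <= b ->
  (forall x, a <= x <= b -> is_derive x 1 f (f' x)) ->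
  (forall x, a <= x <= b -> is_derive x 1 g (g' x)) ->
  (forall x, a <= x <= b -> f' x <= g' x) ->
  f b - f a <= g b - g a.
Proof.
move=> ab df dg fg.
have Ioo x : x \in `]a, b[ -> a <= x <= b.
  by rewrite in_itv/= => /andP[/ltW -> /ltW ->].
have dh x : a <= x <= b -> is_derive x 1 (g - f) (g' x - f' x).
  by move=> h; apply: is_deriveB; [exact: dg|exact: df].
have [|c cab] := @MVT_segment R (g - f) (fun x => g' x - f' x) a b ab (fun x h => dh x (Ioo x h)).
  apply/continuous_in_subspaceT => x /set_mem /=; rewrite in_itv/= => h.
  exact: (is_derive_continuous (dh x h)).
have := fg c; move: cab; rewrite in_itv/= => h /(_ h) le.
have : 0 <= (g' c - f' c) * (b - a) by rewrite mulr_ge0// subr_ge0.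
rewrite /= !fctE; lra.
Qed.

Lemma eq_of_derive f g (f' : R -> R) a b :
  (forall x, is_derive x 1 f (f' x)) ->
  (forall x, is_derive x 1 g (f' x)) ->
  f b - f a = g b - g a.
Proof.
move=> df dg.
wlog ab : a b / a <= b.
  move=> H; have [|ba] := leP a b; first exact: H.
  have := H b a (ltW ba); lra.
apply/le_anti/andP; split; apply: (@le_of_derive _ _ f' f') => //.
Qed.

Lemma primitive_exists f : continuous f -> exists F : R -> R, forall x, is_derive x 1 F (f x).
Proof.
move=> cf.
pose Fa a x := (\int[@lebesgue_measure R]_(t in [set` `[a, x]]) (f t))%R.
have dFa a x : a < x -> is_derive x 1 (Fa a) (f x).
  move=> ax.
  have [||] := @continuous_FTC1_closed R f a x (x + 1) _ _ ax (cf x).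
  - by rewrite ltrDl.
  - apply: continuous_compact_integrable; first exact: segment_compact.
    exact: continuous_subspaceT.
  - by move=> d1 d2; exact: (DeriveDef d1 (etrans (esym (derive1E _ _)) d2)).
have indep a1 a2 x y : a1 < x -> a1 < y -> a2 < x -> a2 < y -> Fa a1 x - Fa a1 y = Fa a2 x - Fa a2 y.
  wlog xy : x y / y <= x.
    move=> H; have [h|h] := leP y x; first by apply: H.
    move=> ? ? ? ?; have := H y x (ltW h); lra.
  move=> h1 h2 h3 h4.
  by apply/le_anti/andP; split; apply: (@le_of_derive _ _ f f) => // z /andP[z1 z2];
   apply: dFa; exact: lt_le_trans z1.
(* [Fa a] is controlled only to the right of a, so no single lower limit serves the whole line. The
   limit used here moves with [x], stays below both [x] and 0, and does not influence the value, by
   [indep]. *)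
exists (fun x => Fa (- `|x| - 1) x - Fa (- `|x| - 1) 0) => x.
have lo (y : R) : - `|y| - 1 < y by have := ler_norm (- y); rewrite normrN; lra.
have lo0 (y : R) : - `|y| - 1 < 0 :> R by have := normr_ge0 y; lra.
apply: (@near_eq_is_derive _ _ _ (fun y => Fa (- `|x| - 2) y - Fa (- `|x| - 2) 0)); last first.
  rewrite -[f x]subr0; apply: (is_derive_funB _ (is_derive_funC _ _)).
  by apply: dFa; have := lo x; lra.
near=> y.
have hy : - `|x| - 2 < y.
  have : `|x - y| < 1 by near: y; apply: (@cvgr_dist_lt _ _ _ _ _ id) => //; exact: cvg_id.
  by move=> /ltr_normlP[h1 h2]; have := lo x; lra.
apply: indep => //; have := normr_ge0 x; lra.
Unshelve. all: by end_near. Qed.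

Definition primitive f : R -> R :=
  if pselect (exists F : R -> R, forall x, is_derive x 1 F (f x)) is left H then sval (cid H) else 0.

Lemma is_derive_primitive f : continuous f -> forall x, is_derive x 1 (primitive f) (f x).
Proof.
move=> cf; rewrite /primitive; case: pselect => [H|H]; first by case: cid.
by case: H; exact: primitive_exists.
Qed.

(** Oriented integral, total in [f] and in the end points; additivity over intervals then holds
    without side conditions. *)
Definition intg a b f : R := primitive f b - primitive f a.

Lemma intgE F f a b : continuous f ->
  (forall x, is_derive x 1 F (f x)) -> intg a b f = F b - F a.
Proof.
by move=> cf dF; apply: (eq_of_derive _ _ _ dF); exact: is_derive_primitive.
Qed.

Lemma is_derive_intg f a x : continuous f -> is_derive x 1 (fun y => intg a y f) (f x).
Proof.
move=> cf; rewrite -[f x]subr0; apply: (is_derive_funB _ (is_derive_funC _ _)).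
exact: is_derive_primitive.
Qed.

Lemma intg_id f a : intg a a f = 0. Proof. exact: subrr. Qed.

Lemma intg_split f a b c : intg a b f + intg b c f = intg a c f.
Proof. rewrite /intg; ring. Qed.

Lemma intg_linear f g (k l : R) a b : continuous f -> continuous g ->
  intg a b (fun x => k * f x + l * g x) = k * intg a b f + l * intg a b g.
Proof.
move=> cf cg.
have dP x : is_derive x 1 (fun y => k * primitive f y + l * primitive g y) (k * f x + l * g x).
  by apply: is_derive_funD; apply: is_derive_funZ; exact: is_derive_primitive.
rewrite (intgE _ _ _ dP) /intg; [by ring|exact: continuous_lin].
Qed.

Lemma le_intg f g a b : a <= b -> continuous f -> continuous g ->
  (forall x, a <= x <= b -> f x <= g x) -> intg a b f <= intg a b g.
Proof.
move=> ab cf cg fg; apply: (@le_of_derive _ _ f g) => // x _; exact: is_derive_primitive.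
Qed.

Lemma intg_cst (k : R) a b : intg a b (fun=> k) = k * (b - a).
Proof.
by rewrite (intgE _ _ _ (is_derive_linear k)) ?mulrBr//; exact: cst_continuous.
Qed.

Lemma intg_ge0 f a b : a <= b -> continuous f ->
  (forall x, a <= x <= b -> 0 <= f x) -> 0 <= intg a b f.
Proof.
move=> ab cf f0; rewrite -(mul0r (b - a)) -intg_cst; apply: le_intg => //.
exact: cst_continuous.
Qed.

Lemma intg_norm_le f g a b : a <= b -> continuous f -> continuous g ->
  (forall x, a <= x <= b -> `|f x| <= g x) -> `|intg a b f| <= intg a b g.
Proof.
move=> ab cf cg fg; rewrite ler_norml; apply/andP; split; last first.
  by apply: le_intg => // x /fg /ler_normlP[].
have -> : - intg a b g = intg a b (fun x => (-1) * g x + 0 * g x).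
  by rewrite intg_linear//; ring.
apply: le_intg => //.
  exact: continuous_lin.
by move=> x /fg /ler_normlP[]; lra.
Qed.

Lemma le_intg_itv f a b c d : c <= a -> a <= b -> b <= d -> continuous f ->
  (forall x, c <= x <= d -> 0 <= f x) -> intg a b f <= intg c d f.
Proof.
move=> ca ab bd cf f0.
rewrite -(intg_split f c a d) -(intg_split f a b d).
have h1 : 0 <= intg c a f by apply: intg_ge0 => // x /andP[h1 h2]; apply: f0; lra.
have h2 : 0 <= intg b d f by apply: intg_ge0 => // x /andP[h3 h4]; apply: f0; lra.
lra.
Qed.

Lemma intg_parts (F G f g : R -> R) a b : continuous f -> continuous g ->
  (forall x, is_derive x 1 F (f x)) -> (forall x, is_derive x 1 G (g x)) ->
  intg a b (fun x => F x * g x) = F b * G b - F a * G a - intg a b (fun x => G x * f x).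
Proof.
move=> cf cg dF dG.
have cF : continuous F by move=> x; exact: (is_derive_continuous (dF x)).
have cG : continuous G by move=> x; exact: (is_derive_continuous (dG x)).
have c1 : continuous (fun x => F x * g x) by move=> x; apply: continuousM; [exact: cF|exact: cg].
have c2 : continuous (fun x => G x * f x) by move=> x; apply: continuousM; [exact: cG|exact: cf].
have dP x : is_derive x 1 (fun y => F y * G y) (1 * (F x * g x) + 1 * (G x * f x)).
  by rewrite !mul1r addrC (mulrC (G x)); exact: is_derive_funM.
have := intg_linear 1 1 a b c1 c2; rewrite (intgE _ _ _ dP); first by lra.
exact: continuous_lin.
Qed.

End RealCalculus.

(** * Functions of (x, t): joint continuity, differentiation under the integral, mixed
    derivatives *)

Section TwoVariables.
Context {R : realType}.
Implicit Types (f g : R -> R -> R) (a b x t : R).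

Lemma le_of_eq (x y : R) : x = y -> x <= y. Proof. by move=> ->. Qed.

Definition jcontinuous f := continuous (fun z : R * R => f z.1 z.2).

Lemma jcontinuous_eps f x t e : jcontinuous f -> 0 < e ->
  exists2 del, 0 < del &
    forall x' t', `|x' - x| < del -> `|t' - t| < del -> `|f x' t' - f x t| < e.
Proof.
move=> cf e0; have /cvgrPdist_lt/(_ e e0) := cf (x, t).
move=> /nbhs_ballP[del /= del0 H]; exists del => // x' t' hx ht.
by rewrite distrC; apply: (H (x', t')); split; rewrite /ball/= distrC.
Qed.

Lemma eps_jcontinuous f :
  (forall x t e, 0 < e -> exists2 del, 0 < del &
    forall x' t', `|x' - x| < del -> `|t' - t| < del -> `|f x' t' - f x t| <= e) ->
  jcontinuous f.
Proof.
move=> H [x t]; apply/cvgrPdist_le => e e0; have [del del0 Hd] := H x t e e0.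
exists (ball x del, ball t del) => /=; first by split; exact: nbhsx_ballx.
by move=> [x' t'] [/= hx ht]; rewrite distrC; apply: Hd; rewrite distrC.
Qed.

Lemma jcontinuous_x f t : jcontinuous f -> continuous (fun x => f x t).
Proof.
move=> cf x; apply/cvgrPdist_lt => e e0; have [del del0 H] := jcontinuous_eps x t cf e0.
apply/nbhs_ballP; exists del => //= x' hx; rewrite distrC; apply: H; first by rewrite distrC.
by rewrite subrr normr0.
Qed.

Lemma jcontinuous_t f x : jcontinuous f -> continuous (f x).
Proof.
move=> cf t; apply/cvgrPdist_lt => e e0; have [del del0 H] := jcontinuous_eps x t cf e0.
apply/nbhs_ballP; exists del => //= x' hx; rewrite distrC; apply: H; last by rewrite distrC.
by rewrite subrr normr0.
Qed.

Lemma jcontinuous_shift f h : jcontinuous f -> jcontinuous (fun x t => f x (t + h)).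
Proof.
move=> cf; apply: eps_jcontinuous => x t e e0.
have [del del0 H] := jcontinuous_eps x (t + h) cf e0.
exists del => // x' t' hx ht; apply/ltW/H => //.
by rewrite (_ : t' + h - (t + h) = t' - t)//; ring.
Qed.

Lemma jcontinuousD f g : jcontinuous f -> jcontinuous g -> jcontinuous (fun x t => f x t + g x t).
Proof. by move=> cf cg z; apply: continuousD; [exact: cf|exact: cg]. Qed.

Lemma jcontinuousN f : jcontinuous f -> jcontinuous (fun x t => - f x t).
Proof. by move=> cf z; apply: continuousN; exact: cf. Qed.

Lemma jcontinuousB f g : jcontinuous f -> jcontinuous g -> jcontinuous (fun x t => f x t - g x t).
Proof. by move=> cf cg; apply: jcontinuousD => //; exact: jcontinuousN. Qed.

Lemma jcontinuousM f g : jcontinuous f -> jcontinuous g -> jcontinuous (fun x t => f x t * g x t).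
Proof. by move=> cf cg z; apply: continuousM; [exact: cf|exact: cg]. Qed.

Lemma jcontinuous_cst (k : R) : jcontinuous (fun _ _ => k).
Proof. by move=> z; exact: cst_continuous. Qed.

Lemma jcontinuous_of_x (h : R -> R) : continuous h -> jcontinuous (fun x _ => h x).
Proof. by move=> ch z; apply: (@continuous_comp _ _ _ fst h); [exact: cvg_fst|exact: ch]. Qed.

Lemma jcontinuous_sum (I : Type) (r : seq I) (F : I -> R -> R -> R) :
  (forall i, jcontinuous (F i)) -> jcontinuous (fun x t => \sum_(i <- r) F i x t).
Proof.
move=> cF; elim: r => [|i r IH].
  by rewrite (_ : (fun _ _ => _) = fun _ _ => 0); [exact: jcontinuous_cst|apply/funext=> x; apply/funext=> t; rewrite big_nil].
rewrite (_ : (fun _ _ => _) = fun x t => F i x t + \sum_(i <- r) F i x t); first exact: jcontinuousD.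
by apply/funext=> x; apply/funext=> t; rewrite big_cons.
Qed.

(** Compactness of [a, b] merges the radii found at its points into one. *)
Lemma jcontinuous_uniform f a b t e : jcontinuous f -> 0 < e ->
  exists2 del, 0 < del &
    forall x t', a <= x <= b -> `|t' - t| < del -> `|f x t' - f x t| < e.
Proof.
move=> cf e0.
have /compact_near_coveringP cpt := @segment_compact R a b.
have /= := cpt R (nbhs t) (fun t' x => `|f x t' - f x t| < e) _ _.
case.
  move=> x _; have e20 : 0 < e / 2 by lra.
  have [del del0 H] := jcontinuous_eps x t cf e20.
  exists (ball x del, ball t del); first by split; exact: nbhsx_ballx.
  move=> [x' t'] [/= hx ht].
  have h1 : `|f x' t' - f x t| < e / 2 by apply: H; rewrite distrC.
  have h2 : `|f x' t - f x t| < e / 2 by apply: H; [rewrite distrC|rewrite subrr normr0].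
  rewrite (_ : f x' t' - f x' t = (f x' t' - f x t) - (f x' t - f x t)); last by ring.
  by apply: le_lt_trans (ler_normB _ _) _; lra.
move=> del /= del0 H; exists del => // x t' xab ht.
by apply: (H t') => //=; rewrite ?in_itv//= distrC.
Qed.

Lemma jcontinuous_bounded f a b c d : jcontinuous f ->
  exists2 K, 0 < K & forall x t, a <= x <= b -> c <= t <= d -> `|f x t| <= K.
Proof.
move=> cf.
have cpt : compact (`[a, b] `*` `[c, d] : set (R * R)).
  by apply: compact_setX; exact: segment_compact.
have /compact_bounded[M [_ HM]] : compact ((fun z : R * R => f z.1 z.2) @` (`[a, b] `*` `[c, d])).
  by apply: continuous_compact => //; exact: continuous_subspaceT.
exists (`|M| + 1); first by have := normr_ge0 M; lra.
move=> x t hx ht; apply: (HM (`|M| + 1)); first by have := ler_norm M; lra.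
by exists (x, t) => //; split; rewrite /= in_itv.
Qed.

Lemma continuous_bounded (f : R -> R) a b : continuous f ->
  exists2 K, 0 < K & forall x, a <= x <= b -> `|f x| <= K.
Proof.
move=> cf; have [K K0 H] := @jcontinuous_bounded _ a b 0 0 (jcontinuous_of_x cf).
by exists K => // x hx; apply: (H x 0) => //; rewrite lexx.
Qed.

Lemma continuous_intg f a b : a <= b -> jcontinuous f ->
  continuous (fun t => intg a b (fun x => f x t)).
Proof.
move=> ab cf t; apply/cvgrPdist_le => e e0.
have e1 : 0 < e / (b - a + 1) by apply: divr_gt0 => //; lra.
have [del del0 H] := jcontinuous_uniform a b t cf e1.
apply/nbhs_ballP; exists del => //= t' ht.
have -> : intg a b (fun x => f x t) - intg a b (fun x => f x t')
   = intg a b (fun x => 1 * f x t + (-1) * f x t').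
  by rewrite intg_linear; [ring|exact: jcontinuous_x..].
apply: le_trans (@intg_norm_le _ _ (fun=> e / (b - a + 1)) _ _ ab _ _ _) _.
- by apply: continuous_lin; exact: jcontinuous_x.
- exact: cst_continuous.
- move=> x hx; have ht' : `|t' - t| < del by rewrite distrC.
  have := ltW (H x t' hx ht'); rewrite distrC.
  by congr (`|_| <= _); ring.
- rewrite intg_cst -mulrA ler_piMr//; first exact: ltW.
  by rewrite mulrC ler_pdivrMr; lra.
Qed.

(** Comparison of f with lines of slopes k + M and k - M, for b on either side of a. With k = 0 this
    is a Lipschitz bound, with k the derivative at a it is a first-order remainder. *)
Lemma is_derive_increment (f f' : R -> R) a b (k M : R) :
  (forall s : R, is_derive s 1 f (f' s)) ->
  (forall s : R, `|s - a| <= `|b - a| -> `|f' s - k| <= M) ->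
  `|f b - f a - (b - a) * k| <= M * `|b - a|.
Proof.
move=> df bd.
have key (s1 s2 : R) : s1 <= s2 -> (forall s, s1 <= s <= s2 -> `|f' s - k| <= M) ->
    `|f s2 - f s1 - (s2 - s1) * k| <= M * (s2 - s1).
  move=> s12 hs.
  have A := @le_of_derive _ f (fun y => (k + M) * y) f' (fun=> k + M) s1 s2 s12
     (fun s _ => df s) (fun s _ => is_derive_linear _ s) _.
  have B := @le_of_derive _ (fun y => (k - M) * y) f (fun=> k - M) f' s1 s2 s12
     (fun s _ => is_derive_linear _ s) (fun s _ => df s) _.
  rewrite ler_norml; apply/andP; split.
    have /B : forall s, s1 <= s <= s2 -> k - M <= f' s.
      by move=> s /hs; rewrite ler_norml; lra.
    lra.
  have /A : forall s, s1 <= s <= s2 -> f' s <= k + M.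
    by move=> s /hs; rewrite ler_norml; lra.
  lra.
have [h0|h0] := leP a b.
  rewrite (ger0_norm (_ : 0 <= b - a)); last by lra.
  apply: key => // s hs; apply: bd; rewrite !ger0_norm; lra.
rewrite (ltr0_norm (_ : b - a < 0)); last by lra.
rewrite (_ : _ - _ - _ = - (f a - f b - (a - b) * k)); last by ring.
rewrite normrN (_ : - (b - a) = a - b); last by ring.
apply: key => [|s hs]; first exact: ltW.
apply: bd; rewrite distrC [leRHS]distrC !ger0_norm; lra.
Qed.

Lemma is_derive_uniform f (f' : R -> R -> R) a b t e :
  (forall x t, is_derive t 1 (f x) (f' x t)) -> jcontinuous f' -> 0 < e ->
  exists2 del, 0 < del & forall x h, a <= x <= b -> `|h| < del ->
    `|f x (t + h) - f x t - h * f' x t| <= e * `|h|.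
Proof.
move=> df cf' e0; have [del del0 H] := jcontinuous_uniform a b t cf' e0.
exists del => // x h hx hdel.
have := @is_derive_increment (f x) (f' x) t (t + h) (f' x t) e (df x).
rewrite (_ : t + h - t = h); last by ring.
by apply => s hs; apply/ltW/H => //; exact: le_lt_trans hdel.
Qed.

(** The first-order error of f in t is small uniformly over x in [a, b], so it can be integrated.
    The divisor b - a + 1 in place of b - a stays positive when the interval is a point. *)
Lemma is_derive_param_intg f (f' : R -> R -> R) a b t : a <= b ->
  (forall x t, is_derive t 1 (f x) (f' x t)) -> jcontinuous f -> jcontinuous f' ->
  is_derive t 1 (fun t => intg a b (fun x => f x t)) (intg a b (fun x => f' x t)).
Proof.
move=> ab df cf cf'; apply/is_derive_approxP => e e0.
have e1 : 0 < e / (b - a + 1) by apply: divr_gt0 => //; lra.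
have [del del0 H] := is_derive_uniform a b t df cf' e1.
exists del => // h hdel.
have cl : continuous (fun x => 1 * f x (t + h) + (- 1) * f x t).
  by apply: continuous_lin; exact: jcontinuous_x.
have -> : intg a b (fun x => f x (t + h)) - intg a b (fun x => f x t) - h * intg a b (fun x => f' x t)
  = intg a b (fun x => 1 * (1 * f x (t + h) + (- 1) * f x t) + (- h) * f' x t).
  by rewrite !intg_linear //; [ring|exact: jcontinuous_x..].
apply: le_trans (@intg_norm_le _ _ (fun=> e / (b - a + 1) * `|h|) _ _ ab _ _ _) _.
- by apply: continuous_lin => //; exact: jcontinuous_x.
- exact: cst_continuous.
- by move=> x hx; have := H x h hx hdel; congr (`|_| <= _); ring.
- rewrite intg_cst (_ : _ * (b - a) = e * `|h| * ((b - a) / (b - a + 1))); last by ring.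
  rewrite ler_piMr//; first by rewrite mulr_ge0// ltW.
  by rewrite ler_pdivrMr; lra.
Qed.

Lemma is_derive_close (f : R -> R) x (d k M r : R) : 0 < r -> is_derive x 1 f d ->
  (forall y, `|y - x| < r -> `|f y - f x - (y - x) * k| <= M * `|y - x|) -> `|d - k| <= M.
Proof.
move=> r0 /is_derive_approxP df H; apply/ler_addgt0Pr => e e0.
have [del del0 Hd] := df e e0.
have m0 : 0 < Num.min del r by rewrite lt_min del0.
pose h := Num.min del r / 2.
have h0 : 0 < h by rewrite divr_gt0.
have [hd hr] : h < del /\ h < r.
  have : Num.min del r <= del /\ Num.min del r <= r by rewrite !ge_min !lexx orbT.
  by rewrite /h => -[]; lra.
have := Hd h; have := H (x + h); rewrite (_ : x + h - x = h); last by ring.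
rewrite gtr0_norm// => /(_ hr) A /(_ hd) B.
rewrite -(ler_pM2r h0) -{1}(gtr0_norm h0) -normrM.
rewrite (_ : (d - k) * h = (f (x + h) - f x - h * k) - (f (x + h) - f x - h * d)); last by ring.
by apply: le_trans (ler_normB _ _) _; rewrite mulrDl lerD.
Qed.

(** The mixed second difference is estimated by two mean value inequalities, one for [ft] in x and
    one in t; letting the x-increment tend to 0 turns it into an increment of [fx] in t. *)
Lemma clairaut f (fx ft ftx : R -> R -> R) :
  (forall x t, is_derive x 1 (fun y => f y t) (fx x t)) ->
  (forall x t, is_derive t 1 (f x) (ft x t)) ->
  (forall x t, is_derive x 1 (fun y => ft y t) (ftx x t)) ->
  jcontinuous ftx ->
  forall x t, is_derive t 1 (fx x) (ftx x t).
Proof.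
move=> dfx dft dftx c x t; apply/is_derive_approxP => e e0.
have [del del0 H] := jcontinuous_eps x t c e0.
exists del => // h hdel.
apply: (@is_derive_close (fun y => f y (t + h) - f y t) x _ (h * ftx x t) _ del) => //.
move=> y hy.
have dl (s : R) : is_derive s 1 (fun s => f y s - f x s) (ft y s - ft x s).
  exact: is_derive_funB.
have := @is_derive_increment _ _ t (t + h) ((y - x) * ftx x t) (e * `|y - x|) dl.
rewrite (_ : t + h - t = h); last by ring.
rewrite mulrAC => A; apply: le_trans (A _) => [|s hs].
  by apply: le_of_eq; congr (`|_|); ring.
apply: (@is_derive_increment (fun y => ft y s) (fun y => ftx y s)) => // z hz.
by apply/ltW/H; [exact: le_lt_trans hy|exact: le_lt_trans hdel].
Qed.

(** A locally bounded x-derivative makes f Lipschitz in x uniformly for nearby t, which upgrades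
    continuity in t alone to joint continuity. *)
Lemma jcontinuous_of_partial f (fx : R -> R -> R) : (forall x t, is_derive x 1 (fun y => f y t) (fx x t)) ->
  (forall x, continuous (f x)) ->
  (forall x t, exists K r, 0 < r /\ forall x' t', `|x' - x| < r -> `|t' - t| < r -> `|fx x' t'| <= K) ->
  jcontinuous f.
Proof.
move=> df cf bd; apply: eps_jcontinuous => x t e e0.
have [K [r [r0 HK]]] := bd x t.
have e20 : 0 < e / 2 by lra.
have /cvgrPdist_lt/(_ _ e20)/nbhs_ballP[d1 /= d10 H1] := cf x t.
have K0 : 0 <= K by apply: le_trans (HK x t _ _) => //; rewrite subrr normr0.
have d20 : 0 < e / 2 / (K + 1) by apply: divr_gt0 => //; lra.
exists (Num.min (Num.min d1 r) (e / 2 / (K + 1))); first by rewrite !lt_min d10 r0 d20.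
move=> x' t'; rewrite !lt_min => /andP[/andP[_ hx1] hx2] /andP[/andP[ht1 ht2] _].
have A : `|f x' t' - f x t'| <= K * `|x' - x|.
  have := @is_derive_increment (fun y => f y t') (fun y => fx y t') x x' 0 K (fun s => df s t').
  rewrite mulr0 subr0; apply=> s hs; rewrite subr0; apply: HK => //; exact: le_lt_trans hx1.
have B : `|f x t' - f x t| < e / 2 by rewrite distrC; apply: H1; rewrite /ball/= distrC.
have C : K * `|x' - x| <= e / 2.
  apply: le_trans (_ : (K + 1) * `|x' - x| <= _); first by rewrite ler_wpM2r//; lra.
  by rewrite mulrC -ler_pdivlMr; [exact: ltW|lra].
rewrite (_ : f x' t' - f x t = (f x' t' - f x t') + (f x t' - f x t)); last by ring.
by apply: le_trans (ler_normD _ _) _; lra.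
Qed.

End TwoVariables.

(** * Gronwall inequalities, limits at minus infinity, a Baire argument on the line *)

Section RealAnalysis.
Context {R : realType}.
Implicit Types (a b x t : R).

Lemma is_derive_exp_lin (k x : R) : is_derive x 1 (fun y => expR (k * y)) (k * expR (k * x)).
Proof.
have := @is_derive1_comp R expR (fun y => k * y) x (expR (k * x)) k.
by rewrite [k * expR _]mulrC; apply; exact: is_derive_linear.
Qed.

Lemma gronwall_ratio (y y' : R -> R) (k s1 s2 : R) : s1 <= s2 ->
  (forall s, s1 <= s <= s2 -> is_derive s 1 y (y' s)) ->
  (forall s, s1 <= s <= s2 -> y' s <= k * y s) ->
  y s2 <= expR (k * (s2 - s1)) * y s1.
Proof.
move=> s12 dy H.
pose z s := expR (- k * s) * y s.
pose z' s := - k * expR (- k * s) * y s + expR (- k * s) * y' s.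
have dz s : s1 <= s <= s2 -> is_derive s 1 z (z' s).
  by move=> hs; apply: is_derive_funM; [exact: is_derive_exp_lin|exact: dy].
have : z s2 - z s1 <= (fun _ : R => 0 : R) s2 - (fun _ : R => 0 : R) s1.
  apply: (@le_of_derive _ _ _ z' (fun=> 0)) => // s hs; rewrite /z'.
  have := H s hs; rewrite -(ler_pM2l (expR_gt0 (- k * s))); lra.
rewrite /= subrr subr_le0 /z => h.
have : expR (k * s2) * (expR (- k * s2) * y s2) <= expR (k * s2) * (expR (- k * s1) * y s1).
  by rewrite ler_pM2l// expR_gt0.
by rewrite !mulrA -!expRD !mulNr subrr expR0 mul1r mulrBr.
Qed.

(** For z = y + b / a the inequality becomes |z'| <= a z; forward in time this is [gronwall_ratio],
    backward it is the same lemma for z (- r). Both directions are wanted, since the reference time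
    may lie on either side. *)
Lemma gronwall (y y' : R -> R) (a b t1 t2 : R) : 0 < a -> 0 <= b ->
  (forall t, t1 <= t <= t2 -> is_derive t 1 y (y' t)) ->
  (forall t, t1 <= t <= t2 -> `|y' t| <= a * y t + b) ->
  forall s t, t1 <= s <= t2 -> t1 <= t <= t2 ->
  y t <= expR (a * (t2 - t1)) * (y s + b / a).
Proof.
move=> a0 b0 dy H s t hs ht.
pose z t := y t + b / a.
have dz r : t1 <= r <= t2 -> is_derive r 1 z (y' r).
  by move=> hr; rewrite -[y' r]addr0; exact: (is_derive_funD (dy r hr) (is_derive_funC _ _)).
have az r : a * z r = a * y r + b by rewrite /z; field; rewrite gt_eqF.
have z0 r : t1 <= r <= t2 -> 0 <= z r.
  by move=> hr; rewrite -(pmulr_rge0 _ a0) az; apply: le_trans (H r hr).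
have E r : 0 <= r -> r <= t2 - t1 -> expR (a * r) * z s <= expR (a * (t2 - t1)) * z s.
  by move=> r0 hr; rewrite ler_wpM2r ?z0// ler_expR ler_pM2l.
apply: le_trans (_ : z t <= _); first by rewrite /z lerDl divr_ge0// ltW.
have [st|ts] := leP s t.
  apply: le_trans (E (t - s) _ _); [|lra|lra].
  apply: (@gronwall_ratio z y') => // r hr.
    by apply: dz; lra.
  by rewrite az; apply: le_trans (H r _); [exact: ler_norm|lra].
apply: le_trans (E (s - t) _ _); [|lra|lra].
pose zo r := z (- r).
have := @gronwall_ratio zo (fun r => - y' (- r)) a (- s) (- t).
rewrite /zo !opprK (_ : - t + s = s - t); last by ring.
apply; first by lra.
  move=> r hr.
  have dN : is_derive r 1 (fun r : R => - r) (-1) by exact: is_derive_funN.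
  have : is_derive (- r) 1 z (y' (- r)) by apply: dz; lra.
  by move=> d; have := @is_derive1_comp R z (fun r => - r) r _ _ d dN; rewrite mulrN1.
move=> r hr; rewrite az; apply: le_trans (H (- r) _); last by lra.
by rewrite -normrN ler_norm.
Qed.

Lemma cvg_ninfty_epsP (f : R -> R) (l : R) :
  (f x @[x --> -oo] --> l) <-> forall e, 0 < e -> exists A, forall x, x < A -> `|f x - l| <= e.
Proof.
split.
  move=> /cvgrPdist_le H e e0; have [A [_ HA]] := H e e0.
  by exists A => x hx; rewrite distrC; exact: HA.
move=> H; apply/cvgrPdist_le => e e0; have [A HA] := H e e0.
by exists A; split; [exact: num_real|move=> x /= hx; rewrite distrC; exact: HA].
Qed.

Lemma nondecreasing_cvg_ninfty (h : R -> R) (m : R) :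
  (forall x y, x <= y -> h x <= h y) -> (forall x, m <= h x) ->
  exists l : R, h x @[x --> -oo] --> l.
Proof.
move=> nd lb.
have hi : has_inf (range h) by split; [exists (h 0); exists 0|exists m => _ [x _ <-]].
exists (inf (range h)); apply/cvg_ninfty_epsP => e e0.
have [_ [A _ <-] hA] := inf_adherent e0 hi.
exists A => x hx.
have : inf (range h) <= h x by apply: ge_inf; [exact: hi.2|exists x].
have := nd _ _ (ltW hx); rewrite ler_norml; lra.
Qed.

(** f + B atan is nondecreasing and bounded below, hence converges at -oo, and so does B atan; f is
    the difference of the two. *)
Lemma integrable_derive_cvg_ninfty (f f' : R -> R) (B : R) :
  (forall x, is_derive x 1 f (f' x)) -> (forall x, `|f' x| <= B * (1 + x ^+ 2)^-1) ->
  exists l : R, f x @[x --> -oo] --> l.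
Proof.
move=> df bd.
have B0 : 0 <= B by have := bd 0; rewrite expr0n addr0 invr1 mulr1; apply: le_trans.
have dB x : is_derive x 1 (fun y => B * atan y) (B * (1 + x ^+ 2)^-1).
  exact: is_derive_funZ.
pose h x := f x + B * atan x.
have nd (s1 s2 : R) : s1 <= s2 -> `|f s2 - f s1| <= B * atan s2 - B * atan s1.
  move=> s12; rewrite ler_norml; apply/andP; split.
    have A : - f s2 - (- f s1) <= B * atan s2 - B * atan s1.
      apply: (@le_of_derive _ (fun y => - f y) (fun y => B * atan y) (fun y => - f' y) _ s1 s2 s12
        (fun x _ => is_derive_funN (df x)) (fun x _ => dB x)).
      by move=> x _; have /ler_normlP[] := bd x.
    lra.
  apply: (@le_of_derive _ f (fun y => B * atan y) f' _ s1 s2 s12 (fun x _ => df x) (fun x _ => dB x)).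
  by move=> x _; have /ler_normlP[] := bd x.
have ndh x y : x <= y -> h x <= h y by move=> /nd; rewrite ler_norml /h; lra.
have lbf x : x <= 0 -> f 0 - B * (pi / 2) <= f x.
  move=> x0; have := nd _ _ x0; rewrite atan0 mulr0 ler_norml => /andP[_].
  have : B * - (pi / 2) <= B * atan x by rewrite ler_wpM2l// ltW// atan_gtNpi2.
  lra.
have lb x : B * - (pi / 2) <= B * atan x by rewrite ler_wpM2l// ltW// atan_gtNpi2.
have [l1 H1] : exists l : R, h x @[x --> -oo] --> l.
  apply: (@nondecreasing_cvg_ninfty h (f 0 - B * (pi / 2) + B * - (pi / 2))) => // x.
  have [x0|/ltW x0] := leP x 0; first by have := lbf x x0; have := lb x; rewrite /h; lra.
  have := ndh _ _ x0; have := lbf 0 (lexx _); have := lb 0; rewrite /h; lra.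
have [l2 H2] : exists l : R, B * atan x @[x --> -oo] --> l.
  apply: nondecreasing_cvg_ninfty (lb) => x y xy.
  by rewrite ler_wpM2l// le_atan.
exists (l1 - l2).
rewrite (_ : f = fun x => h x - B * atan x); first exact: cvgB.
by apply/funext => x; rewrite /h; ring.
Qed.

Lemma intg_inv_sqr_le (f : R -> R) (B a b : R) : a <= b -> continuous f ->
  (forall x, f x <= B * (1 + x ^+ 2)^-1) -> 0 <= B -> intg a b f <= B * pi.
Proof.
move=> ab cf bd B0.
have dB x : is_derive x 1 (fun y => B * atan y) (B * (1 + x ^+ 2)^-1).
  exact: is_derive_funZ.
have : intg a b f <= B * atan b - B * atan a.
  apply: (@le_of_derive _ _ (fun y => B * atan y) f (fun x => B * (1 + x ^+ 2)^-1)) => // x _.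
  exact: is_derive_primitive.
have : B * - (pi / 2) <= B * atan a by rewrite ler_wpM2l// ltW// atan_gtNpi2.
have : B * atan b <= B * (pi / 2) by rewrite ler_wpM2l// ltW// atan_ltpi2.
lra.
Qed.

(* Nested intervals on which [B n] fails at the n-th stage would share a point violating every [B n]. *)
Lemma baire_portion (E : set R) (B : nat -> R -> Prop) :
  (forall n t, ~ B n t -> exists2 del, 0 < del & forall s, `|s - t| < del -> ~ B n s) ->
  (forall t, exists n, B n t) -> E !=set0 ->
  exists n t0 del, [/\ E t0, 0 < del & forall t, E t -> `|t - t0| < del -> B n t].
Proof.
move=> openB coverB [e Ee]; apply: contrapT => no.
have step (n : nat) (p : R * R) : exists q : R * R, E p.1 -> 0 < p.2 ->
    [/\ E q.1, 0 < q.2, p.1 - p.2 <= q.1 - q.2, q.1 + q.2 <= p.1 + p.2 &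
     forall s, `|s - q.1| <= q.2 -> ~ B n s].
  have [Ep|] := pselect (E p.1); last by move=> ?; exists p.
  have [p0|] := pselect (0 < p.2); last by move=> ?; exists p.
  have /existsNP[t /not_implyP[Et /not_implyP[tp nB]]] : ~ forall t, E t -> `|t - p.1| < p.2 -> B n t.
    by move=> h; apply: no; exists n, p.1, p.2.
  have [del del0 Hdel] := openB n t nB.
  pose m := Num.min del (p.2 - `|t - p.1|).
  have m0 : 0 < m by rewrite lt_min del0 subr_gt0.
  have [m1 m2] : m <= del /\ m <= p.2 - `|t - p.1| by rewrite /m !ge_min !lexx orbT.
  (* Halving [m] puts the closed ball of the new radius inside both the open ball where [B n] fails
     and the previous ball. *)
  exists (t, m / 2) => _ _ /=; split => //; first by lra.
  - by have := ler_norm (- (t - p.1)); rewrite normrN; lra.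
  - by have := ler_norm (t - p.1); lra.
  - by move=> s hs; apply: Hdel; apply: le_lt_trans hs _; lra.
have [F HF] := choice (fun np : nat * (R * R) => step np.1 np.2).
pose p := fix p n := if n is n'.+1 then F (n', p n') else (e, 1).
have inv n : E (p n).1 /\ 0 < (p n).2.
  by elim: n => [//|n [h1 h2]] /=; have [] := HF (n, p n) h1 h2.
have nest n k : (p n).1 - (p n).2 <= (p (n + k)%N).1 - (p (n + k)%N).2 /\
  (p (n + k)%N).1 + (p (n + k)%N).2 <= (p n).1 + (p n).2.
  elim: k => [|k [h1 h2]]; first by rewrite addn0.
  rewrite addnS /=; have [i1 i2] := inv (n + k)%N.
  by have [_ _ h3 h4 _] := HF ((n + k)%N, p (n + k)%N) i1 i2; rewrite /= in h3 h4; lra.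
have le_ab n k : (p n).1 - (p n).2 <= (p k).1 + (p k).2.
  have := nest n k; have := nest k n; rewrite addnC.
  by have [_ i2] := inv (n + k)%N; lra.
pose A := range (fun n => (p n).1 - (p n).2).
have hA : has_sup A.
  by split; [exists ((p 0).1 - (p 0).2); exists 0%N|exists ((p 0).1 + (p 0).2) => _ [n _ <-]].
have lo n : (p n).1 - (p n).2 <= sup A by apply: ub_le_sup; [exact: hA.2|exists n].
have hi n : sup A <= (p n).1 + (p n).2 by apply: ge_sup; [exact: hA.1|move=> _ [k _ <-]].
(* The common point [sup A] may fall outside [E]. The cover is of the whole line, so some [B n]
   holds there all the same, against the ball chosen at stage n. *)
have [n Bn] := coverB (sup A).
have [i1 i2] := inv n.
have [_ _ _ _ h] := HF (n, p n) i1 i2.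
apply: (h (sup A)) => //.
by have := lo n.+1; have := hi n.+1; rewrite /= ler_norml; lra.
Qed.

End RealAnalysis.

(** * Complex matrices: entrywise calculus, adjoints, inner product and norm *)

Section ComplexMatrices.
Context {R : realType}.
Local Notation C := (R[i]).
Local Notation Re := (@complex.Re R).
Local Notation Im := (@complex.Im R).

Lemma complexReD (z w : C) : Re (z + w) = Re z + Re w. Proof. by case: z w => ? ? []. Qed.
Lemma complexImD (z w : C) : Im (z + w) = Im z + Im w. Proof. by case: z w => ? ? []. Qed.
Lemma complexReN (z : C) : Re (- z) = - Re z. Proof. by case: z. Qed.
Lemma complexImN (z : C) : Im (- z) = - Im z. Proof. by case: z. Qed.
Lemma complexReM (z w : C) : Re (z * w) = Re z * Re w - Im z * Im w.
Proof. by case: z w => ? ? []. Qed.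
Lemma complexImM (z w : C) : Im (z * w) = Re z * Im w + Im z * Re w.
Proof. by case: z w => ? ? []. Qed.
Lemma complexReJ (z : C) : Re (Num.conj z) = Re z. Proof. by case: z. Qed.
Lemma complexImJ (z : C) : Im (Num.conj z) = - Im z. Proof. by case: z. Qed.
Lemma complexRe_sum (I : Type) (r : seq I) (F : I -> C) : Re (\sum_(i <- r) F i) = \sum_(i <- r) Re (F i).
Proof. exact: (big_morph Re complexReD). Qed.
Lemma complexIm_sum (I : Type) (r : seq I) (F : I -> C) : Im (\sum_(i <- r) F i) = \sum_(i <- r) Im (F i).
Proof. exact: (big_morph Im complexImD). Qed.
Lemma complex_ext (z w : C) : Re z = Re w -> Im z = Im w -> z = w.
Proof. by case: z w => ? ? [? ?] /= -> ->. Qed.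

Section Derivation.
Implicit Types (x : R).

(** Existence of the derivative travels together with its value, so that the total function
    [mderive] is only evaluated at the end. *)
Definition is_mderive {p q} (f : R -> 'M[C]_(p, q)) x (d : 'M[C]_(p, q)) : Prop :=
  forall i j, is_derive x 1 (reE f i j) (Re (d i j)) /\ is_derive x 1 (imE f i j) (Im (d i j)).

Lemma is_mderive_mderivable p q (f : R -> 'M[C]_(p, q)) x d :
  is_mderive f x d -> mderivable f x.
Proof. by move=> df i j; have [[h1 _] [h2 _]] := df i j; split; [exact: h1|exact: h2]. Qed.

Lemma is_mderiveE p q (f : R -> 'M[C]_(p, q)) x d : is_mderive f x d -> mderive f x = d.
Proof.
move=> df; apply/matrixP => i j; have [[_ h1] [_ h2]] := df i j.
by rewrite mxE !derive1E h1 h2; exact: complex_ext.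
Qed.

Lemma mderivable_is_mderive p q (f : R -> 'M[C]_(p, q)) x :
  mderivable f x -> is_mderive f x (mderive f x).
Proof.
by move=> df i j; have [h1 h2] := df i j; rewrite mxE /= !derive1E; split; [exact: (DeriveDef h1 erefl)|exact: (DeriveDef h2 erefl)].
Qed.

Lemma eq_is_mderive p q (f g : R -> 'M[C]_(p, q)) x d : f =1 g -> is_mderive f x d -> is_mderive g x d.
Proof. by move=> /funext ->. Qed.

Lemma is_derive_big (I : Type) (r : seq I) (F : I -> R -> R) (d : I -> R) x :
  (forall i, is_derive x 1 (F i) (d i)) ->
  is_derive x 1 (fun y => \sum_(i <- r) F i y) (\sum_(i <- r) d i).
Proof.
move=> dF; elim: r => [|i r IH].
  rewrite big_nil (_ : (fun _ => _) = fun=> 0); first exact: is_derive_funC.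
  by apply/funext => y; rewrite big_nil.
rewrite big_cons (_ : (fun _ => _) = fun y => F i y + \sum_(i <- r) F i y).
  exact: (is_derive_funD (dF i) IH).
by apply/funext => y; rewrite big_cons.
Qed.

Lemma is_mderive_cst p q (A : 'M[C]_(p, q)) x : is_mderive (fun=> A) x 0.
Proof. by move=> i j; rewrite mxE; split; exact: is_derive_funC. Qed.

Lemma is_mderiveD p q (f g : R -> 'M[C]_(p, q)) x d e :
  is_mderive f x d -> is_mderive g x e -> is_mderive (fun y => f y + g y) x (d + e).
Proof.
move=> df dg i j; have [f1 f2] := df i j; have [g1 g2] := dg i j.
rewrite mxE complexReD complexImD /reE /imE; split.
  rewrite (_ : (fun _ => _) = fun y => reE f i j y + reE g i j y).
    exact: (is_derive_funD f1 g1).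
  by apply/funext => y; rewrite mxE complexReD.
rewrite (_ : (fun _ => _) = fun y => imE f i j y + imE g i j y).
  exact: (is_derive_funD f2 g2).
by apply/funext => y; rewrite mxE complexImD.
Qed.

Lemma is_mderiveN p q (f : R -> 'M[C]_(p, q)) x d :
  is_mderive f x d -> is_mderive (fun y => - f y) x (- d).
Proof.
move=> df i j; have [f1 f2] := df i j.
rewrite mxE complexReN complexImN /reE /imE; split.
  rewrite (_ : (fun _ => _) = fun y => - reE f i j y); first exact: (is_derive_funN f1).
  by apply/funext => y; rewrite mxE complexReN.
rewrite (_ : (fun _ => _) = fun y => - imE f i j y); first exact: (is_derive_funN f2).
by apply/funext => y; rewrite mxE complexImN.
Qed.

Lemma is_mderiveB p q (f g : R -> 'M[C]_(p, q)) x d e :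
  is_mderive f x d -> is_mderive g x e -> is_mderive (fun y => f y - g y) x (d - e).
Proof. by move=> df dg; apply: is_mderiveD => //; exact: is_mderiveN. Qed.

Lemma is_mderiveM p q r (f : R -> 'M[C]_(p, q)) (g : R -> 'M[C]_(q, r)) x d e :
  is_mderive f x d -> is_mderive g x e ->
  is_mderive (fun y => f y *m g y) x (d *m g x + f x *m e).
Proof.
move=> df dg i j.
rewrite !mxE complexReD complexImD !complexRe_sum !complexIm_sum -!big_split /=; split.
  rewrite /reE (_ : (fun _ => _) = fun y => \sum_k (reE f i k y * reE g k j y - imE f i k y * imE g k j y)).
    apply: is_derive_big => k; have [f1 f2] := df i k; have [g1 g2] := dg k j.
    rewrite !complexReM [X in is_derive _ _ _ X](_ : _ = (Re (d i k) * reE g k j x + reE f i k x * Re (e k j)) -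
      (Im (d i k) * imE g k j x + imE f i k x * Im (e k j))); last by rewrite /reE /imE; ring.
    exact: (is_derive_funB (is_derive_funM f1 g1) (is_derive_funM f2 g2)).
  by apply/funext => y; rewrite mxE complexRe_sum; apply: eq_bigr => k _; rewrite complexReM.
rewrite /imE (_ : (fun _ => _) = fun y => \sum_k (reE f i k y * imE g k j y + imE f i k y * reE g k j y)).
  apply: is_derive_big => k; have [f1 f2] := df i k; have [g1 g2] := dg k j.
  rewrite !complexImM [X in is_derive _ _ _ X](_ : _ = (Re (d i k) * imE g k j x + reE f i k x * Im (e k j)) +
    (Im (d i k) * reE g k j x + imE f i k x * Re (e k j))); last by rewrite /reE /imE; ring.
  exact: (is_derive_funD (is_derive_funM f1 g2) (is_derive_funM f2 g1)).
by apply/funext => y; rewrite mxE complexIm_sum; apply: eq_bigr => k _; rewrite complexImM.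
Qed.

Lemma is_mderive_adj p q (f : R -> 'M[C]_(p, q)) x d :
  is_mderive f x d -> is_mderive (fun y => adj (f y)) x (adj d).
Proof.
move=> df i j; have [f1 f2] := df j i.
rewrite !mxE complexReJ complexImJ; split.
  by rewrite /reE (_ : (fun _ => _) = reE f j i)//; apply/funext => y; rewrite !mxE complexReJ.
rewrite /imE (_ : (fun _ => _) = fun y => - imE f j i y).
  exact: is_derive_funN f2.
by apply/funext => y; rewrite !mxE complexImJ.
Qed.

Lemma is_mderiveMl p q r (A : 'M[C]_(p, q)) (f : R -> 'M[C]_(q, r)) x d :
  is_mderive f x d -> is_mderive (fun y => A *m f y) x (A *m d).
Proof. by move=> df; have := is_mderiveM (is_mderive_cst A x) df; rewrite mul0mx add0r. Qed.

Lemma is_mderiveMr p q r (f : R -> 'M[C]_(p, q)) (A : 'M[C]_(q, r)) x d :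
  is_mderive f x d -> is_mderive (fun y => f y *m A) x (d *m A).
Proof. by move=> df; have := is_mderiveM df (is_mderive_cst A x); rewrite mulmx0 addr0. Qed.

Lemma is_mderive_unique p q (f : R -> 'M[C]_(p, q)) x d e :
  is_mderive f x d -> is_mderive f x e -> d = e.
Proof. by move=> /is_mderiveE <- /is_mderiveE. Qed.

Lemma is_mderive0_cst p q (f : R -> 'M[C]_(p, q)) :
  (forall x, is_mderive f x 0) -> forall x y, f x = f y.
Proof.
move=> df x y; apply/matrixP => i j.
have d1 (z : R) : is_derive z 1 (reE f i j) 0 by have [] := df z i j; rewrite mxE.
have d2 (z : R) : is_derive z 1 (imE f i j) 0 by have [] := df z i j; rewrite mxE.
have h1 := eq_of_derive x y d1 (fun z => is_derive_funC 0 z).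
have h2 := eq_of_derive x y d2 (fun z => is_derive_funC 0 z).
by apply: complex_ext; move: h1 h2; rewrite /reE /imE; lra.
Qed.

Lemma is_mderive_translate p q (f : R -> 'M[C]_(p, q)) h x d :
  is_mderive f (x + h) d -> is_mderive (fun y => f (y + h)) x d.
Proof.
move=> df i j; have [f1 f2] := df i j.
have dh : is_derive x 1 (fun y : R => y + h) 1.
  by rewrite -[X in is_derive _ _ _ X]addr0; exact: (is_derive_funD (is_derive_id x 1) (is_derive_funC h x)).
have := @is_derive1_comp R _ _ x _ _ f1 dh; have := @is_derive1_comp R _ _ x _ _ f2 dh.
by rewrite !mulr1.
Qed.

End Derivation.

Section Adjoint.

Lemma adjK p q (A : 'M[C]_(p, q)) : adj (adj A) = A.
Proof. by apply/matrixP => i j; rewrite !mxE conjCK. Qed.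

Lemma adjD p q (A B : 'M[C]_(p, q)) : adj (A + B) = adj A + adj B.
Proof. by apply/matrixP => i j; rewrite !mxE rmorphD. Qed.

Lemma adjN p q (A : 'M[C]_(p, q)) : adj (- A) = - adj A.
Proof. by apply/matrixP => i j; rewrite !mxE rmorphN. Qed.

Lemma adj1 n : adj (1%:M : 'M[C]_n) = 1%:M.
Proof. by apply/matrixP => i j; rewrite !mxE eq_sym rmorph_nat. Qed.

Lemma adjM p q r (A : 'M[C]_(p, q)) (B : 'M[C]_(q, r)) : adj (A *m B) = adj B *m adj A.
Proof. by rewrite /adj map_mxM trmx_mul. Qed.

Lemma unitaryV n (g : 'M[C]_n) : unitary g -> adj g *m g = 1%:M.
Proof. exact: mulmx1C. Qed.

Lemma unitary_invmx n (g : 'M[C]_n) : unitary g -> invmx g = adj g.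
Proof.
move=> ug; have [uu _] := mulmx1_unit ug.
by rewrite -[invmx g]mulmx1 -ug mulKmx.
Qed.

Lemma unitary_adj n (g : 'M[C]_n) : unitary g -> unitary (adj g).
Proof. by move=> /unitaryV; rewrite /unitary adjK. Qed.

Lemma unitaryM n (g h : 'M[C]_n) : unitary g -> unitary h -> unitary (g *m h).
Proof. by move=> ug uh; rewrite /unitary adjM mulmxA -(mulmxA g) uh mulmx1. Qed.

Lemma unitary1 n : unitary (1%:M : 'M[C]_n).
Proof. by rewrite /unitary adj1 mulmx1. Qed.

End Adjoint.

Section InnerProduct.

(** Real part of the trace of A times the adjoint of B; on skew-adjoint matrices it is the invariant
    inner product -tr (A B). *)
Definition ip {p q} (A B : 'M[C]_(p, q)) : R :=
  \sum_i \sum_j (Re (A i j) * Re (B i j) + Im (A i j) * Im (B i j)).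

Lemma ip_trace p q (A B : 'M[C]_(p, q)) : ip A B = Re (\tr (A *m adj B)).
Proof.
rewrite /ip /mxtrace complexRe_sum; apply: eq_bigr => i _.
rewrite mxE complexRe_sum; apply: eq_bigr => j _.
by rewrite !mxE complexReM complexReJ complexImJ; ring.
Qed.

Lemma ipC p q (A B : 'M[C]_(p, q)) : ip A B = ip B A.
Proof. by apply: eq_bigr => i _; apply: eq_bigr => j _; ring. Qed.

Lemma ipDl p q (A A' B : 'M[C]_(p, q)) : ip (A + A') B = ip A B + ip A' B.
Proof.
rewrite -big_split; apply: eq_bigr => i _; rewrite -big_split; apply: eq_bigr => j _ /=.
by rewrite mxE complexReD complexImD; ring.
Qed.

Lemma ipDr p q (A B B' : 'M[C]_(p, q)) : ip A (B + B') = ip A B + ip A B'.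
Proof. by rewrite ipC ipDl !(ipC A). Qed.

Lemma ipNl p q (A B : 'M[C]_(p, q)) : ip (- A) B = - ip A B.
Proof.
rewrite /ip -sumrN; apply: eq_bigr => i _; rewrite -sumrN; apply: eq_bigr => j _ /=.
by rewrite mxE complexReN complexImN; ring.
Qed.

Lemma ipNr p q (A B : 'M[C]_(p, q)) : ip A (- B) = - ip A B.
Proof. by rewrite ipC ipNl (ipC A). Qed.

Lemma ip0l p q (B : 'M[C]_(p, q)) : ip 0 B = 0.
Proof. by rewrite /ip big1// => i _; rewrite big1// => j _; rewrite mxE !mul0r addr0. Qed.

Lemma ip_ge0 p q (A : 'M[C]_(p, q)) : 0 <= ip A A.
Proof. by apply: sumr_ge0 => i _; apply: sumr_ge0 => j _; rewrite addr_ge0// -expr2 sqr_ge0. Qed.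

(** Nonnegativity of |d A + B|^2 / d and of its counterpart for - A. The free parameter d replaces
    Cauchy-Schwarz and avoids square roots. *)
Lemma ip_Young p q (A B : 'M[C]_(p, q)) (d : R) : 0 < d ->
  2 * `|ip A B| <= d * ip A A + d^-1 * ip B B.
Proof.
move=> d0.
have key (x y : R) : 0 <= d * (x * x) + d^-1 * (y * y) + 2 * (x * y).
  rewrite (_ : _ + _ = d^-1 * (d * x + y) ^+ 2); last by field; rewrite gt_eqF.
  by rewrite mulr_ge0 ?sqr_ge0// invr_ge0 ltW.
have pos (A' B' : 'M[C]_(p, q)) : 0 <= d * ip A' A' + d^-1 * ip B' B' + 2 * ip A' B'.
  rewrite /ip !mulr_sumr -!big_split; apply: sumr_ge0 => i _ /=.
  rewrite !mulr_sumr -!big_split; apply: sumr_ge0 => j _ /=.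
  by have := key (Re (A' i j)) (Re (B' i j)); have := key (Im (A' i j)) (Im (B' i j)); lra.
have := pos A B; have := pos (- A) B; rewrite !ipNl ipNr opprK => h1 h2.
have : `|ip A B| <= (d * ip A A + d^-1 * ip B B) / 2 by rewrite ler_norml; lra.
lra.
Qed.

Lemma ip_mulmxl p q r (A : 'M[C]_(p, q)) (B : 'M[C]_(q, r)) (D : 'M[C]_(p, r)) :
  ip (A *m B) D = ip B (adj A *m D).
Proof. by rewrite !ip_trace adjM adjK -mulmxA mxtrace_mulC !mulmxA. Qed.

Lemma ip_mulmxr p q r (A : 'M[C]_(p, q)) (B : 'M[C]_(q, r)) (D : 'M[C]_(p, r)) :
  ip (A *m B) D = ip A (D *m adj B).
Proof. by rewrite !ip_trace adjM adjK mulmxA. Qed.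

Lemma ip_unitary n p (g : 'M[C]_n) (A B : 'M[C]_(n, p)) : unitary g ->
  ip (g *m A) (g *m B) = ip A B.
Proof. by move=> /unitaryV ug; rewrite ip_mulmxl mulmxA ug mul1mx. Qed.

Lemma ip_conj n (g : 'M[C]_n) (A B : 'M[C]_n) : unitary g ->
  ip (adj g *m A *m g) (adj g *m B *m g) = ip A B.
Proof. by move=> ug; rewrite ip_mulmxr -!mulmxA ug mulmx1 ip_unitary//; exact: unitary_adj. Qed.

Lemma is_derive_ip p q (f g : R -> 'M[C]_(p, q)) x d e :
  is_mderive f x d -> is_mderive g x e ->
  is_derive x 1 (fun y => ip (f y) (g y)) (ip d (g x) + ip (f x) e).
Proof.
move=> df dg; rewrite /ip -big_split; apply: is_derive_big => i /=.
rewrite -big_split; apply: is_derive_big => j /=.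
have [f1 f2] := df i j; have [g1 g2] := dg i j.
rewrite [X in is_derive _ _ _ X](_ : _ = (Re (d i j) * reE g i j x + reE f i j x * Re (e i j)) +
  (Im (d i j) * imE g i j x + imE f i j x * Im (e i j))); last by rewrite /reE /imE; ring.
exact: (is_derive_funD (is_derive_funM f1 g1) (is_derive_funM f2 g2)).
Qed.

(** An l^1 norm on real and imaginary parts: submultiplicative with constant 1, invariant under the
    adjoint, comparable with [ip]. *)
Definition mnorm {p q} (A : 'M[C]_(p, q)) : R :=
  \sum_i \sum_j (`|Re (A i j)| + `|Im (A i j)|).

Lemma mnorm_ge0 p q (A : 'M[C]_(p, q)) : 0 <= mnorm A.
Proof. by apply: sumr_ge0 => i _; apply: sumr_ge0 => j _; rewrite addr_ge0. Qed.

Lemma mnormD p q (A B : 'M[C]_(p, q)) : mnorm (A + B) <= mnorm A + mnorm B.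
Proof.
rewrite /mnorm -big_split; apply: ler_sum => i _ /=; rewrite -big_split; apply: ler_sum => j _ /=.
rewrite mxE complexReD complexImD; have := ler_normD (Re (A i j)) (Re (B i j)).
have := ler_normD (Im (A i j)) (Im (B i j)); lra.
Qed.

Lemma mnorm_adj p q (A : 'M[C]_(p, q)) : mnorm (adj A) = mnorm A.
Proof.
rewrite /mnorm exchange_big; apply: eq_bigr => i _; apply: eq_bigr => j _.
by rewrite !mxE complexReJ complexImJ normrN.
Qed.

Lemma ler_bigsum_single (I : finType) (F : I -> R) i : (forall j, 0 <= F j) -> F i <= \sum_j F j.
Proof. by move=> F0; rewrite (bigD1 i)//= lerDl sumr_ge0. Qed.

Lemma mnorm_entry p q (A : 'M[C]_(p, q)) i j : `|Re (A i j)| + `|Im (A i j)| <= mnorm A.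
Proof.
apply: le_trans (_ : \sum_j (`|Re (A i j)| + `|Im (A i j)|) <= _).
  by apply: (@ler_bigsum_single _ (fun j => `|Re (A i j)| + `|Im (A i j)|)) => k; rewrite addr_ge0.
apply: (@ler_bigsum_single _ (fun i => \sum_j (`|Re (A i j)| + `|Im (A i j)|))) => k.
by apply: sumr_ge0 => l _; rewrite addr_ge0.
Qed.

Lemma mnormM p q r (A : 'M[C]_(p, q)) (B : 'M[C]_(q, r)) : mnorm (A *m B) <= mnorm A * mnorm B.
Proof.
pose a i k := `|Re (A i k)| + `|Im (A i k)|.
pose b k j := `|Re (B k j)| + `|Im (B k j)|.
have a0 i k : 0 <= a i k by rewrite addr_ge0.
have b0 k j : 0 <= b k j by rewrite addr_ge0.
apply: le_trans (_ : \sum_i \sum_j \sum_k a i k * b k j <= _).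
  apply: ler_sum => i _; apply: ler_sum => j _; rewrite mxE complexRe_sum complexIm_sum.
  apply: le_trans (lerD (ler_norm_sum _ _ _) (ler_norm_sum _ _ _)) _.
  rewrite -big_split; apply: ler_sum => k _ /=; rewrite complexReM complexImM /a /b.
  rewrite mulrDl !mulrDr -!normrM.
  have := ler_normB (Re (A i k) * Re (B k j)) (Im (A i k) * Im (B k j)).
  have := ler_normD (Re (A i k) * Im (B k j)) (Im (A i k) * Re (B k j)); lra.
rewrite /mnorm mulr_suml; apply: ler_sum => i _.
rewrite exchange_big mulr_suml; apply: ler_sum => k _ /=.
rewrite -mulr_sumr ler_wpM2l//.
by apply: (@ler_bigsum_single _ (fun k => \sum_j b k j)) => l; exact: sumr_ge0.
Qed.

Lemma ip_le_mnorm p q (A B : 'M[C]_(p, q)) : `|ip A B| <= mnorm A * mnorm B.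
Proof.
apply: le_trans (ler_norm_sum _ _ _) _; rewrite /mnorm mulr_suml; apply: ler_sum => i _.
apply: le_trans (ler_norm_sum _ _ _) _; rewrite mulr_suml; apply: ler_sum => j _.
apply: le_trans (ler_normD _ _) _; rewrite !normrM.
have h1 := mnorm_entry B i j.
apply: le_trans (_ : (`|Re (A i j)| + `|Im (A i j)|) * (`|Re (B i j)| + `|Im (B i j)|) <= _); last first.
  by rewrite ler_wpM2l// addr_ge0.
rewrite mulrDl !mulrDr.
have : 0 <= `|Re (A i j)| * `|Im (B i j)| by rewrite mulr_ge0.
have : 0 <= `|Im (A i j)| * `|Re (B i j)| by rewrite mulr_ge0.
lra.
Qed.

Lemma entry_sqr_le_ip p q (A : 'M[C]_(p, q)) i j : Re (A i j) ^+ 2 + Im (A i j) ^+ 2 <= ip A A.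
Proof.
have t0 k l : 0 <= Re (A k l) * Re (A k l) + Im (A k l) * Im (A k l).
  by rewrite -!expr2 addr_ge0 ?sqr_ge0.
apply: le_trans (_ : \sum_j (Re (A i j) * Re (A i j) + Im (A i j) * Im (A i j)) <= _).
  by rewrite !expr2; apply: (@ler_bigsum_single _ (fun j => Re (A i j) * Re (A i j) + Im (A i j) * Im (A i j))).
apply: (@ler_bigsum_single _ (fun i => \sum_j (Re (A i j) * Re (A i j) + Im (A i j) * Im (A i j)))) => k.
exact: sumr_ge0.
Qed.

(** Each of the 2 p q real entries is at most the square root of [ip A A], whence the constant. *)
Lemma mnorm_sqr_le_ip p q (A : 'M[C]_(p, q)) :
  mnorm A ^+ 2 <= (2 * (p * q)%:R) ^+ 2 * ip A A.
Proof.
pose m := Num.sqrt (ip A A).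
have mm : m ^+ 2 = ip A A by rewrite sqr_sqrtr// ip_ge0.
have m0 : 0 <= m by exact: sqrtr_ge0.
rewrite -mm -exprMn ler_pXn2r ?nnegrE ?mnorm_ge0//; last by rewrite !mulr_ge0.
apply: le_trans (_ : \sum_(i < p) \sum_(j < q) (2 * m) <= _).
  apply: ler_sum => i _; apply: ler_sum => j _; have := entry_sqr_le_ip A i j; rewrite -mm => h.
  have h1 : `|Re (A i j)| <= m.
    rewrite -(@ler_pXn2r _ 2%N) ?nnegrE// -normrX ger0_norm ?sqr_ge0//.
    have := sqr_ge0 (Im (A i j)); lra.
  have h2 : `|Im (A i j)| <= m.
    rewrite -(@ler_pXn2r _ 2%N) ?nnegrE// -normrX ger0_norm ?sqr_ge0//.
    have := sqr_ge0 (Re (A i j)); lra.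
  lra.
by rewrite !sumr_const !card_ord -mulrnA mulnC -[leLHS]mulr_natr mulrAC.
Qed.

Lemma ip_self_le_mnorm p q (A : 'M[C]_(p, q)) : ip A A <= mnorm A ^+ 2.
Proof. by rewrite expr2; apply: le_trans (ip_le_mnorm A A); exact: ler_norm. Qed.

End InnerProduct.
End ComplexMatrices.

(** * Joint continuity of matrix-valued functions of (x, t) *)

Section JointContinuity.
Context {R : realType}.
Local Notation C := (R[i]).

Definition mjcontinuous {p q} (F : R -> R -> 'M[C]_(p, q)) : Prop :=
  forall i j, jcontinuous (fun x t => complex.Re (F x t i j)) /\
              jcontinuous (fun x t => complex.Im (F x t i j)).

Lemma eq_jcontinuous (F G : R -> R -> R) :
  (forall x t, F x t = G x t) -> jcontinuous F -> jcontinuous G.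
Proof. by move=> FG; rewrite (_ : G = F)//; apply/funext => x; apply/funext => t. Qed.

Lemma mjcontinuous_cst p q (A : 'M[C]_(p, q)) : mjcontinuous (fun _ _ => A).
Proof. by move=> i j; split; exact: jcontinuous_cst. Qed.

Lemma mjcontinuousD p q (F G : R -> R -> 'M[C]_(p, q)) :
  mjcontinuous F -> mjcontinuous G -> mjcontinuous (fun x t => F x t + G x t).
Proof.
move=> cF cG i j; have [F1 F2] := cF i j; have [G1 G2] := cG i j; split.
  by apply: eq_jcontinuous (jcontinuousD F1 G1) => x t; rewrite mxE complexReD.
by apply: eq_jcontinuous (jcontinuousD F2 G2) => x t; rewrite mxE complexImD.
Qed.

Lemma mjcontinuousN p q (F : R -> R -> 'M[C]_(p, q)) :
  mjcontinuous F -> mjcontinuous (fun x t => - F x t).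
Proof.
move=> cF i j; have [F1 F2] := cF i j; split.
  by apply: eq_jcontinuous (jcontinuousN F1) => x t; rewrite mxE complexReN.
by apply: eq_jcontinuous (jcontinuousN F2) => x t; rewrite mxE complexImN.
Qed.

Lemma mjcontinuousB p q (F G : R -> R -> 'M[C]_(p, q)) :
  mjcontinuous F -> mjcontinuous G -> mjcontinuous (fun x t => F x t - G x t).
Proof. by move=> cF cG; apply: mjcontinuousD => //; exact: mjcontinuousN. Qed.

Lemma mjcontinuousM p q r (F : R -> R -> 'M[C]_(p, q)) (G : R -> R -> 'M[C]_(q, r)) :
  mjcontinuous F -> mjcontinuous G -> mjcontinuous (fun x t => F x t *m G x t).
Proof.
move=> cF cG i j; split.
  apply: (@eq_jcontinuous (fun x t => \sum_k
    (complex.Re (F x t i k) * complex.Re (G x t k j) - complex.Im (F x t i k) * complex.Im (G x t k j)))).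
    by move=> x t; rewrite mxE complexRe_sum; apply: eq_bigr => k _; rewrite complexReM.
  apply: jcontinuous_sum => k; have [F1 F2] := cF i k; have [G1 G2] := cG k j.
  by apply: jcontinuousB; exact: jcontinuousM.
apply: (@eq_jcontinuous (fun x t => \sum_k
  (complex.Re (F x t i k) * complex.Im (G x t k j) + complex.Im (F x t i k) * complex.Re (G x t k j)))).
  by move=> x t; rewrite mxE complexIm_sum; apply: eq_bigr => k _; rewrite complexImM.
apply: jcontinuous_sum => k; have [F1 F2] := cF i k; have [G1 G2] := cG k j.
by apply: jcontinuousD; exact: jcontinuousM.
Qed.

Lemma mjcontinuous_adj p q (F : R -> R -> 'M[C]_(p, q)) :
  mjcontinuous F -> mjcontinuous (fun x t => adj (F x t)).
Proof.
move=> cF i j; have [F1 F2] := cF j i; split.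
  by apply: eq_jcontinuous F1 => x t; rewrite !mxE complexReJ.
by apply: eq_jcontinuous (jcontinuousN F2) => x t; rewrite !mxE complexImJ.
Qed.

Lemma mjcontinuous_shift p q (F : R -> R -> 'M[C]_(p, q)) h :
  mjcontinuous F -> mjcontinuous (fun x t => F x (t + h)).
Proof. by move=> cF i j; have [F1 F2] := cF i j; split; [exact: (@jcontinuous_shift _ _ h F1)|exact: (@jcontinuous_shift _ _ h F2)]. Qed.

Lemma mjcontinuous_freeze p q (F : R -> R -> 'M[C]_(p, q)) c :
  mjcontinuous F -> mjcontinuous (fun x _ => F x c).
Proof.
move=> cF i j; have [F1 F2] := cF i j; split; apply: jcontinuous_of_x.
  exact: (@jcontinuous_x _ _ c F1).
exact: (@jcontinuous_x _ _ c F2).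
Qed.

Lemma jcontinuous_ip p q (F G : R -> R -> 'M[C]_(p, q)) :
  mjcontinuous F -> mjcontinuous G -> jcontinuous (fun x t => ip (F x t) (G x t)).
Proof.
move=> cF cG; apply: jcontinuous_sum => i; apply: jcontinuous_sum => j.
have [F1 F2] := cF i j; have [G1 G2] := cG i j.
by apply: jcontinuousD; exact: jcontinuousM.
Qed.

Lemma jcontinuousZ (k : R) f : jcontinuous f -> jcontinuous (fun x t => k * f x t).
Proof. by move=> cf; apply: jcontinuousM => //; exact: jcontinuous_cst. Qed.

End JointContinuity.

(** * A polynomial cutoff and the localisation of integrals *)

Section Cutoff.
Context {R : realType}.
Implicit Types (L a b x t : R).

(** On [-L, L] this quartic lies in [0, 1], vanishes at both ends, has slope at most 4 / L in
    absolute value, and is at least 1 / 4 on the inner half. It grows outside [-L, L], so its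
    integrals are taken over that interval only. *)
Definition cutoff L x : R := (1 - (L^-1 * x) ^+ 2) ^+ 2.
Definition cutoff' L x : R := - (4 / L) * ((L^-1 * x) * (1 - (L^-1 * x) ^+ 2)).

Lemma is_derive_cutoff L x : is_derive x 1 (cutoff L) (cutoff' L x).
Proof.
have d1 := is_derive_linear L^-1 x.
have d2 := is_derive_funB (is_derive_funC 1 x) (is_derive_funM d1 d1).
have := is_derive_funM d2 d2.
rewrite (_ : (fun y => _) = cutoff L); last first.
  by apply/funext => y; rewrite /cutoff !expr2.
by rewrite [X in is_derive _ _ _ X -> _](_ : _ = cutoff' L x)// /cutoff' !expr2; ring.
Qed.

Lemma continuous_cutoff L : continuous (cutoff L).
Proof. by move=> x; exact: (is_derive_continuous (is_derive_cutoff L x)). Qed.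

Lemma continuous_cutoff' L : continuous (cutoff' L).
Proof.
move=> x.
have d1 := is_derive_linear L^-1 x.
have d2 := is_derive_funB (is_derive_funC 1 x) (is_derive_funM d1 d1).
apply: (@is_derive_continuous _ _ _ _ (is_derive_funZ (- (4 / L)) (is_derive_funM d1 d2))).
Qed.

Section Bounds.
Variables (L x : R).
Hypotheses (L0 : 0 < L) (Lx : - L <= x <= L).

Let z := L^-1 * x.

Let z1 : -1 <= z <= 1.
Proof. by rewrite /z mulrC ler_pdivlMr// ler_pdivrMr// mulN1r mul1r. Qed.

Let zz1 : z ^+ 2 <= 1.
Proof.
have /andP[h1 h2] := z1.
have : 0 <= (1 - z) * (1 + z) by rewrite mulr_ge0//; lra.
by rewrite expr2; lra.
Qed.

Lemma cutoff_ge0 : 0 <= cutoff L x. Proof. exact: sqr_ge0. Qed.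

Lemma cutoff_le1 : cutoff L x <= 1.
Proof.
rewrite /cutoff -/z expr2; have := zz1; have := sqr_ge0 z; move: (z ^+ 2) => w w0 w1.
have : 0 <= w * (2 - w) by rewrite mulr_ge0//; lra.
lra.
Qed.

Lemma cutoff'_le : `|cutoff' L x| <= 4 / L.
Proof.
have L4 : 0 <= 4 / L by rewrite divr_ge0// ltW.
rewrite /cutoff' -/z normrM normrN (ger0_norm L4).
apply: ler_piMr => //; rewrite normrM; apply: mulr_ile1 => //; rewrite ler_norml; first exact: z1.
by have := zz1; have := sqr_ge0 z; lra.
Qed.

Lemma cutoff_ge_quarter : `|x| <= L / 2 -> 1 <= 4 * cutoff L x.
Proof.
rewrite ler_norml /cutoff -/z => hx.
have : - (1 / 2) <= z <= 1 / 2 by rewrite /z (mulrC L^-1) ler_pdivlMr// ler_pdivrMr//; lra.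
move=> hz; have : 0 <= (1 / 2 - z) * (1 / 2 + z) by rewrite mulr_ge0//; lra.
rewrite !expr2 => h2; have : 1 / 2 <= 1 - z * z by lra.
move: (1 - z * z) => w h; have : 0 <= (w - 1 / 2) * (w + 1 / 2) by rewrite mulr_ge0//; lra.
lra.
Qed.

End Bounds.

Lemma cutoff_boundary L : 0 < L -> cutoff L L = 0 /\ cutoff L (- L) = 0.
Proof.
by move=> L0; rewrite /cutoff mulrN mulVf ?gt_eqF// sqrrN expr1n subrr expr0n.
Qed.

Lemma intg_cutoff_ge L a b (f : R -> R) : 0 < L -> a <= b -> `|a| <= L / 2 -> `|b| <= L / 2 ->
  continuous f -> (forall x, 0 <= f x) ->
  intg a b f <= 4 * intg (- L) L (fun x => cutoff L x * f x).
Proof.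
move=> L0 ab; rewrite !ler_norml => ha hb cf f0.
have cc : continuous (fun x => cutoff L x * f x).
  by move=> x; apply: continuousM; [exact: continuous_cutoff|exact: cf].
have c4 : continuous (fun x => 4 * (cutoff L x * f x) + 0 * f x) by exact: continuous_lin.
have -> : 4 * intg (- L) L (fun x => cutoff L x * f x) =
    intg (- L) L (fun x => 4 * (cutoff L x * f x) + 0 * f x).
  by rewrite intg_linear//; ring.
apply: le_trans (_ : intg a b (fun x => 4 * (cutoff L x * f x) + 0 * f x) <= _).
  apply: le_intg => // x hx.
  have : 1 <= 4 * cutoff L x by apply: cutoff_ge_quarter => //; rewrite ?ler_norml; lra.
  by move=> h; rewrite mul0r addr0 mulrA ler_peMl.
apply: le_intg_itv => //; try lra.
by move=> x _; rewrite mul0r addr0; apply: mulr_ge0 => //; apply: mulr_ge0 => //; exact: cutoff_ge0.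
Qed.

Lemma intg_cutoff_le L (f g : R -> R) : 0 < L -> continuous f -> continuous g ->
  (forall x, `|f x| <= g x) ->
  `|intg (- L) L (fun x => cutoff L x * f x)| <= intg (- L) L g.
Proof.
move=> L0 cf cg fg; apply: intg_norm_le => //; first by lra.
  by move=> x; apply: continuousM; [exact: continuous_cutoff|exact: cf].
move=> x hx; rewrite normrM (ger0_norm (cutoff_ge0 _ _)).
by apply: le_trans (fg x); rewrite ler_piMl// cutoff_le1.
Qed.

(** Integration by parts leaves no boundary term, the cutoff vanishing at both ends; what remains
    carries its slope, whence 4 / L. *)
Lemma intg_cutoff_flux L (F f g : R -> R) : 0 < L -> continuous f -> continuous g ->
  (forall x, is_derive x 1 F (f x)) -> (forall x, `|F x| <= g x) ->
  `|intg (- L) L (fun x => cutoff L x * f x)| <= 4 / L * intg (- L) L g.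
Proof.
move=> L0 cf cg dF Fg.
have cF : continuous F by move=> x; exact: (is_derive_continuous (dF x)).
rewrite (intg_parts _ _ (@continuous_cutoff' L) cf (is_derive_cutoff L) dF).
have [-> ->] := cutoff_boundary L0; rewrite !mul0r subrr sub0r normrN.
have -> : 4 / L * intg (- L) L g = intg (- L) L (fun x => 4 / L * g x + 0 * g x).
  by rewrite intg_linear//; ring.
apply: intg_norm_le; first by lra.
- by move=> x; apply: continuousM; [exact: cF|exact: continuous_cutoff'].
- exact: continuous_lin.
- move=> x hx; rewrite mul0r addr0 normrM mulrC ler_pM//; exact: cutoff'_le.
Qed.

Lemma is_derive_intg_cutoff L (e et : R -> R -> R) t : 0 < L ->
  (forall x t, is_derive t 1 (e x) (et x t)) -> jcontinuous e -> jcontinuous et ->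
  is_derive t 1 (fun t => intg (- L) L (fun x => cutoff L x * e x t))
                (intg (- L) L (fun x => cutoff L x * et x t)).
Proof.
move=> L0 de ce cet; have cc := jcontinuous_of_x (@continuous_cutoff L).
have dd (x s : R) : is_derive s 1 (fun t => cutoff L x * e x t) (cutoff L x * et x s).
  exact: (is_derive_funZ _ (de x s)).
by apply: (is_derive_param_intg _ _ dd); [lra|exact: jcontinuousM..].
Qed.

End Cutoff.

(** * Locally uniform H^1 bounds for the matrix equation u_t = s (u_xx - 2 u^3) *)

Section NonlinearSchrodinger.
Context {R : realType} (n : nat).
Local Notation M := 'M[R[i]]_n.
Variables (s : M) (u ux uxx ut utx : R -> R -> M).
Hypotheses (s_skew : adj s = - s) (s_sqr : s *m s = - 1%:M).
Hypotheses (u_skew : forall x t, adj (u x t) = - u x t)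
  (s_u : forall x t, s *m u x t = - (u x t *m s)).
Hypotheses (du_x : forall x t, is_mderive (fun y => u y t) x (ux x t))
  (dux_x : forall x t, is_mderive (fun y => ux y t) x (uxx x t))
  (du_t : forall x t, is_mderive (u x) t (ut x t))
  (dux_t : forall x t, is_mderive (ux x) t (utx x t))
  (dut_x : forall x t, is_mderive (fun y => ut y t) x (utx x t)).
Hypotheses (cu : mjcontinuous u) (cux : mjcontinuous ux) (cuxx : mjcontinuous uxx)
  (cut : mjcontinuous ut) (cutx : mjcontinuous utx).

Let cube (A : M) : M := A *m A *m A.

Hypothesis pde : forall x t, ut x t = s *m (uxx x t - (cube (u x t) + cube (u x t))).

Lemma ip_s_skew (A B : M) : ip A (s *m B) = - ip (s *m A) B.
Proof. by rewrite ip_mulmxl s_skew mulNmx ipNr opprK. Qed.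

Lemma ip_s_self (A : M) : ip A (s *m A) = 0.
Proof. by have := ip_s_skew A A; rewrite (ipC (s *m A)); lra. Qed.

Lemma ip_s_s (A : M) : ip (s *m A) (s *m A) = ip A A.
Proof. by rewrite ip_mulmxl s_skew mulNmx mulmxA s_sqr mulNmx mul1mx opprK. Qed.

Lemma ip_s_cube (A : M) : adj A = - A -> s *m A = - (A *m s) -> ip A (s *m cube A) = 0.
Proof.
move=> Aa sA.
have e : ip A (s *m cube A) = - ip (A *m A) (s *m (A *m A)).
  by rewrite ipC /cube !mulmxA ip_mulmxr Aa mulmxN ipNr [in LHS]ipC.
by rewrite e ip_s_self oppr0.
Qed.

(** Multiplication by s is skew, so <u_x, s u_x> and <u, s u^3> vanish; what is left of the time
    derivative of |u|^2 is the x-derivative of 2 <u, s u_x>. *)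
Lemma mass_law x t :
  ip (ut x t) (u x t) + ip (u x t) (ut x t) =
  (ip (ux x t) (s *m ux x t) + ip (u x t) (s *m uxx x t)) *+ 2.
Proof.
rewrite (ipC (ut x t)) -mulr2n ip_s_self add0r pde mulmxBr mulmxDr !(ipDr, ipNr).
by rewrite ip_s_cube// addr0 subr0.
Qed.

(** The density is |u_x|^2 - |u^2|^2. Pairing the equation with u_t kills the term s u_t and leaves
    <u_xx, u_t> = 2 <u^3, u_t>, which matches the derivative of the quartic term; the flux is 2
    <u_x, u_t>. *)
Lemma energy_law x t :
  (ip (utx x t) (ux x t) + ip (ux x t) (utx x t)) -
  (ip (ut x t *m u x t + u x t *m ut x t) (u x t *m u x t) +
   ip (u x t *m u x t) (ut x t *m u x t + u x t *m ut x t)) =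
  (ip (uxx x t) (ut x t) + ip (ux x t) (utx x t)) *+ 2.
Proof.
set v := u x t; set w := ut x t.
have e1 : ip (v *m v) (w *m v + v *m w) = - (ip (cube v) w *+ 2).
  rewrite ipDr ipC ip_mulmxr u_skew mulmxN ipNr (ipC (v *m v)) ip_mulmxl u_skew mulNmx ipNr.
  by rewrite /cube mulmxA -/v !(ipC w); ring.
have e2 : ip (uxx x t) w = ip (cube v) w *+ 2.
  have -> : uxx x t = cube v + cube v - s *m w.
    by rewrite /w pde -/v mulmxA s_sqr mulNmx mul1mx opprK addrCA subrr addr0.
  by rewrite !(ipDl, ipNl) (ipC (s *m w)) ip_s_self; ring.
rewrite e2 (ipC _ (v *m v)) e1 (ipC (utx x t)); ring.
Qed.

(** For a nonnegative density this bounds the integral over the line, without an improper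
    integral. *)
Definition density_le (K : R) (r : R -> R) : Prop := forall a b, a <= b -> intg a b r <= K.

Definition H1 (K t : R) : Prop :=
  density_le K (fun x => ip (u x t) (u x t)) /\ density_le K (fun x => ip (ux x t) (ux x t)).
(** Through the equation, u_t in L^2 plays the part of a bound on u_xx. *)
Definition H2 (K t : R) : Prop := density_le K (fun x => ip (ut x t) (ut x t)).

Hypotheses (H1_fin : forall t, exists K, H1 K t) (H2_fin : forall t, exists K, H2 K t).
Hypothesis u_vanish : forall t e, 0 < e -> exists A, forall x, x < A -> ip (u x t) (u x t) <= e.

Lemma density_le_mono K K' r : K <= K' -> density_le K r -> density_le K' r.
Proof. by move=> KK H a b ab; apply: le_trans (H a b ab) KK. Qed.

Lemma density_le_ge0 K r : density_le K r -> 0 <= K.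
Proof. by move=> /(_ 0 0 (lexx _)); rewrite intg_id. Qed.

Lemma H1_mono K K' t : K <= K' -> H1 K t -> H1 K' t.
Proof. by move=> KK [h1 h2]; split; exact: density_le_mono KK _. Qed.

Let c0 : jcontinuous (fun x t => ip (u x t) (u x t)). Proof. exact: jcontinuous_ip. Qed.
Let c1 : jcontinuous (fun x t => ip (ux x t) (ux x t)). Proof. exact: jcontinuous_ip. Qed.
Let c2 : jcontinuous (fun x t => ip (ut x t) (ut x t)). Proof. exact: jcontinuous_ip. Qed.
Let k0 t : continuous (fun x => ip (u x t) (u x t)). Proof. exact: (@jcontinuous_x _ _ t c0). Qed.
Let k1 t : continuous (fun x => ip (ux x t) (ux x t)). Proof. exact: (@jcontinuous_x _ _ t c1). Qed.
Let k2 t : continuous (fun x => ip (ut x t) (ut x t)). Proof. exact: (@jcontinuous_x _ _ t c2). Qed.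

(** From a point far to the left, where |u|^2 is at most e, integrate the derivative 2 <u, u_x> of
    |u|^2, split by Young with weight d. In this Sobolev inequality the factor d of the u_x norm can
    be taken small, which is what absorbs the quartic part of the energy. *)
Lemma pointwise_le t K X : density_le K (fun x => ip (u x t) (u x t)) ->
  density_le X (fun x => ip (ux x t) (ux x t)) ->
  forall d x, 0 < d -> ip (u x t) (u x t) <= d * X + d^-1 * K.
Proof.
move=> hK hX d x d0; apply/ler_addgt0Pr => e e0; have [A HA] := u_vanish t e0.
pose y := Num.min x (A - 1).
have [yx yA] : y <= x /\ y < A.
  by split; [rewrite ge_min lexx|apply: le_lt_trans (_ : A - 1 < A); [rewrite ge_min lexx orbT|lra]].
have d' (z : R) : is_derive z 1 (fun z => ip (u z t) (u z t)) (ip (ux z t) (u z t) + ip (u z t) (ux z t)).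
  exact: is_derive_ip.
have dP (z : R) : is_derive z 1 (fun z => intg y z (fun x => d * ip (ux x t) (ux x t) + d^-1 * ip (u x t) (u x t)))
   (d * ip (ux z t) (ux z t) + d^-1 * ip (u z t) (u z t)).
  apply: (@is_derive_intg _ (fun x => d * ip (ux x t) (ux x t) + d^-1 * ip (u x t) (u x t))).
  by apply: continuous_lin; [exact: k1|exact: k0].
have := le_of_derive yx (fun z _ => d' z) (fun z _ => dP z).
rewrite intg_id subr0 intg_linear; [|exact: k1|exact: k0] => h.
have : ip (u x t) (u x t) - ip (u y t) (u y t) <= d * intg y x (fun x => ip (ux x t) (ux x t)) + d^-1 * intg y x (fun x => ip (u x t) (u x t)).
  apply: h => z _; have := ip_Young (ux z t) (u z t) d0.
  by rewrite (ipC (u z t) (ux z t)); have := ler_norm (ip (ux z t) (u z t)); lra.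
have := HA y yA.
have : d * intg y x (fun x => ip (ux x t) (ux x t)) <= d * X by rewrite ler_pM2l//; exact: hX.
have : d^-1 * intg y x (fun x => ip (u x t) (u x t)) <= d^-1 * K by rewrite ler_pM2l ?invr_gt0//; exact: hK.
lra.
Qed.

(** The integral over one failing window [a, b] depends continuously on t. Hence each bound holds on
    a closed set of times, as Baire requires. *)
Lemma density_fail_open (r : R -> R -> R) K t : jcontinuous r -> ~ density_le K (fun x => r x t) ->
  exists2 del, 0 < del & forall t', `|t' - t| < del -> ~ density_le K (fun x => r x t').
Proof.
move=> cr /existsNP[a /existsNP[b /not_implyP[ab /negP]]]; rewrite -ltNge => lt.
have e0 : 0 < intg a b (fun x => r x t) - K by rewrite subr_gt0.
have /cvgrPdist_lt/(_ _ e0)/nbhs_ballP[del /= del0 H] := continuous_intg ab cr (x := t).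
exists del => // t' ht' /(_ a b ab) h.
have : `|intg a b (fun x => r x t) - intg a b (fun x => r x t')| < intg a b (fun x => r x t) - K.
  by apply: H; rewrite /ball/= distrC.
by rewrite ltr_norml; lra.
Qed.

Lemma density_le_closed (r : R -> R -> R) K t1 t2 : jcontinuous r -> t1 < t2 ->
  (forall t, t1 <= t < t2 -> density_le K (fun x => r x t)) -> density_le K (fun x => r x t2).
Proof.
move=> cr t12 H; apply: contrapT => h.
have [del del0 Hd] := density_fail_open cr h.
pose t := Num.max t1 (t2 - del / 2).
have [h1 h2] : t1 <= t /\ t2 - del / 2 <= t by rewrite !le_max !lexx orbT.
have h3 : t < t2 by rewrite gt_max t12/=; lra.
by apply: (Hd t); [rewrite ltr_norml; lra|apply: H; rewrite h1 h3].
Qed.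

Lemma H1_fail_open K t : ~ H1 K t ->
  exists2 del, 0 < del & forall t', `|t' - t| < del -> ~ H1 K t'.
Proof.
move=> /not_andP[] h.
  by have [del del0 H] := density_fail_open c0 h; exists del => // t' /H ? [].
by have [del del0 H] := density_fail_open c1 h; exists del => // t' /H ? [].
Qed.

Lemma H2_fail_open K t : ~ H2 K t ->
  exists2 del, 0 < del & forall t', `|t' - t| < del -> ~ H2 K t'.
Proof. by move=> h; exact: (density_fail_open c2 h). Qed.

(** For w = u(t) - u(c), the time derivative of |w|^2 is at most |w|^2 / h + h |u_t|^2. Gronwall at
    rate 1 / h over a time h costs only the factor [expR 1], and w starts from 0. *)
Lemma increment_le K c h a b : 0 < h -> (forall t, c <= t <= c + h -> H2 K t) -> a <= b ->
  intg a b (fun x => ip (u x (c + h) - u x c) (u x (c + h) - u x c)) <= expR 1 * (h ^+ 2 * K).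
Proof.
move=> h0 HK ab.
pose w x t := u x t - u x c.
have cw : mjcontinuous w by apply: mjcontinuousB => //; exact: mjcontinuous_freeze.
have dw (x t : R) : is_mderive (w x) t (ut x t).
  by rewrite -[ut x t]subr0; exact: (is_mderiveB (du_t x t) (is_mderive_cst _ t)).
have cww : jcontinuous (fun x t => ip (w x t) (w x t)) by exact: jcontinuous_ip.
have cwt : jcontinuous (fun x t => ip (ut x t) (w x t) + ip (w x t) (ut x t)).
  by apply: jcontinuousD; exact: jcontinuous_ip.
have dww (x t : R) : is_derive t 1 (fun t => ip (w x t) (w x t)) (ip (ut x t) (w x t) + ip (w x t) (ut x t)).
  exact: (is_derive_ip (dw x t) (dw x t)).
have d' (t : R) : is_derive t 1 (fun t => intg a b (fun x => ip (w x t) (w x t)))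
    (intg a b (fun x => ip (ut x t) (w x t) + ip (w x t) (ut x t))).
  exact: (is_derive_param_intg t ab dww cww cwt).
have K0 : 0 <= K by have := HK c; rewrite lexx lerDl (ltW h0) => /(_ isT)/density_le_ge0.
have w0 : intg a b (fun x => ip (w x c) (w x c)) = 0.
  rewrite (_ : (fun _ => _) = fun=> 0) ?intg_cst ?mul0r//.
  by apply/funext => x; rewrite /w subrr ip0l.
have := @gronwall R _ _ h^-1 (h * K) c (c + h) _ _ (fun t _ => d' t) _ c (c + h).
rewrite w0 add0r (_ : h^-1 * (c + h - c) = 1); last by field; rewrite gt_eqF.
rewrite (_ : h * K / h^-1 = h ^+ 2 * K); last by rewrite invrK; ring.
apply; rewrite ?invr_gt0 ?lexx ?lerDl ?(ltW h0)//; first by rewrite mulr_ge0// ltW.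
move=> t ht.
have cwx : continuous (fun x => ip (w x t) (w x t)) by exact: (@jcontinuous_x _ _ t cww).
apply: le_trans (_ : intg a b (fun x => h^-1 * ip (w x t) (w x t) + h * ip (ut x t) (ut x t)) <= _).
  apply: intg_norm_le => //; first exact: (@jcontinuous_x _ _ t cwt).
    by apply: continuous_lin => //; exact: k2.
  move=> x _; rewrite (ipC (ut x t)).
  have := @ip_Young R _ _ (w x t) (ut x t) h^-1; rewrite invr_gt0 invrK => /(_ h0).
  by move=> Y; rewrite -mulr2n normrMn; lra.
rewrite intg_linear; [|exact: cwx|exact: k2].
by rewrite lerD2l ler_pM2l//; exact: (HK t ht).
Qed.

Lemma ipB_le p q (A B : 'M[R[i]]_(p, q)) : ip (A - B) (A - B) <= 2 * ip A A + 2 * ip B B.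
Proof.
have := ip_ge0 (A + B); rewrite !(ipDl, ipDr, ipNl, ipNr) (ipC B A); lra.
Qed.

Lemma cube_lipschitz (A B : M) (k : R) : mnorm A <= k -> mnorm B <= k ->
  mnorm (cube B - cube A) <= 3 * (k * k) * mnorm (B - A).
Proof.
move=> Ak Bk; set D := B - A.
have -> : cube B - cube A = B *m B *m D + B *m D *m A + D *m A *m A.
  by rewrite /D /cube !mulmxBr !mulmxBl !addrA !subrK.
have m3 (X Y Z : M) (a b c : R) : mnorm X <= a -> mnorm Y <= b -> mnorm Z <= c -> mnorm (X *m Y *m Z) <= a * b * c.
  move=> Xa Yb Zc; apply: le_trans (mnormM _ _) _; apply: ler_pM => //; try exact: mnorm_ge0.
  by apply: le_trans (mnormM _ _) _; apply: ler_pM => //; exact: mnorm_ge0.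
apply: le_trans (mnormD _ _) _; apply: le_trans (lerD (mnormD _ _) (lexx _)) _.
have h1 := m3 B B D _ _ _ Bk Bk (lexx _).
have h2 := m3 B D A _ _ _ Bk (lexx _) Ak.
have h3 := m3 D A A _ _ _ (lexx _) Ak Ak.
lra.
Qed.

(** [pointwise_le] with d = 1 bounds |u|^2 by 2 K, and m <= m^2 + 1 removes the square. *)
Lemma mnorm_u_le K : exists2 k, 0 < k & forall x t, H1 K t -> mnorm (u x t) <= k.
Proof.
pose D : R := (2 * (n * n)%:R) ^+ 2.
exists (D * (2 * `|K|) + 1); first by rewrite ltr_pwDr// !mulr_ge0// sqr_ge0.
move=> x t [h1 h2]; have K0 := density_le_ge0 h1.
have := @pointwise_le t K K h1 h2 1 x ltr01; rewrite invr1 !mul1r => hu.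
have := mnorm_sqr_le_ip (u x t); rewrite -/D => hm.
have : D * ip (u x t) (u x t) <= D * (2 * `|K|).
  by rewrite ler_wpM2l ?sqr_ge0// ger0_norm//; lra.
have := mnorm_ge0 (u x t); move: (mnorm (u x t)) hm => m hm m0 hP.
have : 0 <= (m - 1) * (m - 1) by rewrite -expr2 sqr_ge0.
by move: hm hP; rewrite expr2; lra.
Qed.

(** The time difference w = u(t + h) - u(t) solves the free equation w_t = s w_xx up to a cubic
    difference, which is Lipschitz in w because u is bounded. Working with w instead of u_t keeps
    second time derivatives out. The rate [al] depends on K alone. *)
Lemma difference_growth K : exists2 al, 0 < al & forall t1 t2 h L, 0 < h -> 0 < L ->
  (forall t, t1 <= t <= t2 + h -> H1 K t) ->
  let Y t := intg (- L) L (fun x => cutoff L x * ip (u x (t + h) - u x t) (u x (t + h) - u x t)) in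
  forall c t, t1 <= c <= t2 -> t1 <= t <= t2 ->
  Y t <= expR (al * (t2 - t1)) * (Y c + 64 * K / L / al).
Proof.
have [k k0' Hk] := mnorm_u_le K.
pose D : R := (2 * (n * n)%:R) ^+ 2.
have D0 : 0 <= D by exact: sqr_ge0.
(* 12 = 4 * 3: the factor 4 of the cubic term [r] below, and 3 from [cube_lipschitz]. [D] converts
   the square of [mnorm] into [ip], and the summand 1 makes the rate positive. *)
pose al := 12 * (k * k) * mnorm s * D + 1.
have al0 : 0 < al by rewrite ltr_pwDr// !mulr_ge0// ?mnorm_ge0// ltW.
exists al => // t1 t2 h L h0 L0 HK Y c t hc ht.
pose w x t := u x (t + h) - u x t.
pose wx x t := ux x (t + h) - ux x t.
pose wxx x t := uxx x (t + h) - uxx x t.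
pose wt x t := ut x (t + h) - ut x t.
have cw : mjcontinuous w by apply: mjcontinuousB => //; exact: mjcontinuous_shift.
have cwx : mjcontinuous wx by apply: mjcontinuousB => //; exact: mjcontinuous_shift.
have cwxx : mjcontinuous wxx by apply: mjcontinuousB => //; exact: mjcontinuous_shift.
have cwt : mjcontinuous wt by apply: mjcontinuousB => //; exact: mjcontinuous_shift.
have dw_t (x t0 : R) : is_mderive (w x) t0 (wt x t0).
  exact: (is_mderiveB (is_mderive_translate (du_t x (t0 + h))) (du_t x t0)).
have dw_x (x t0 : R) : is_mderive (fun x => w x t0) x (wx x t0).
  exact: (is_mderiveB (du_x x (t0 + h)) (du_x x t0)).
have dwx_x (x t0 : R) : is_mderive (fun x => wx x t0) x (wxx x t0).
  exact: (is_mderiveB (dux_x x (t0 + h)) (dux_x x t0)).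
pose r x t := - (4 * ip (w x t) (s *m (cube (u x (t + h)) - cube (u x t)))).
have cr : jcontinuous r.
  apply: jcontinuousN; apply: jcontinuousZ; apply: jcontinuous_ip => //.
  apply: mjcontinuousM; first exact: mjcontinuous_cst.
  have cc : mjcontinuous (fun x t => cube (u x t)).
    by apply: mjcontinuousM => //; exact: mjcontinuousM.
  by apply: mjcontinuousB => //; exact: (@mjcontinuous_shift _ _ _ _ h cc).
have et x t' : ip (wt x t') (w x t') + ip (w x t') (wt x t') =
    2 * (ip (wx x t') (s *m wx x t') + ip (w x t') (s *m wxx x t')) + r x t'.
  have e : wt x t' = s *m wxx x t' - (s *m (cube (u x (t' + h)) - cube (u x t')) + s *m (cube (u x (t' + h)) - cube (u x t'))).
    rewrite /wt !pde -mulmxBr -mulmxDr -mulmxBr; congr (_ *m _); rewrite /wxx.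
    move: (cube _) (cube _) (uxx _ _) (uxx _ _) => a b c' d; apply/matrixP => i j; rewrite !mxE; ring.
  by rewrite (ipC (wt x t')) e !(ipDr, ipNr) ip_s_self /r; ring.
have dww (x t0 : R) : is_derive t0 1 (fun t => ip (w x t) (w x t)) (ip (wt x t0) (w x t0) + ip (w x t0) (wt x t0)).
  exact: (is_derive_ip (dw_t x t0) (dw_t x t0)).
have cww : jcontinuous (fun x t => ip (w x t) (w x t)) by exact: jcontinuous_ip.
have cwwt : jcontinuous (fun x t => ip (wt x t) (w x t) + ip (w x t) (wt x t)).
  by apply: jcontinuousD; exact: jcontinuous_ip.
have csx : mjcontinuous (fun x t => s *m wx x t) by apply: mjcontinuousM => //; exact: mjcontinuous_cst.
have csxx : mjcontinuous (fun x t => s *m wxx x t) by apply: mjcontinuousM => //; exact: mjcontinuous_cst.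
have dY t' := is_derive_intg_cutoff t' L0 dww cww cwwt.
have := @gronwall R _ _ al (64 * K / L) t1 t2 al0 _ (fun t _ => dY t) _ c t hc ht.
apply.
  have hK := HK c _; rewrite divr_ge0 ?mulr_ge0 ?(ltW L0)//.
  by apply: (@density_le_ge0 K (fun x => ip (u x c) (u x c))); apply hK; lra.
move=> t' ht'.
have [H1a H1b] : H1 K t' by apply: HK; lra.
have [H1c H1d] : H1 K (t' + h) by apply: HK; lra.
pose Fx x := ip (wx x t') (s *m wx x t') + ip (w x t') (s *m wxx x t').
have cFx : continuous Fx.
  exact: (@jcontinuous_x _ _ t' (jcontinuousD (jcontinuous_ip cwx csx) (jcontinuous_ip cw csxx))).
have crx : continuous (fun x => r x t') by exact: (@jcontinuous_x _ _ t' cr).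
have cut1 (f : R -> R) : continuous f -> continuous (fun x => cutoff L x * f x).
  by move=> cf x; apply: continuousM; [exact: continuous_cutoff|exact: cf].
have -> : intg (- L) L (fun x => cutoff L x * (ip (wt x t') (w x t') + ip (w x t') (wt x t'))) =
    2 * intg (- L) L (fun x => cutoff L x * Fx x) + 1 * intg (- L) L (fun x => cutoff L x * r x t').
  rewrite -intg_linear; [|exact: cut1..].
  by congr intg; apply/funext => x; rewrite et; rewrite /Fx; ring.
have LL : - L <= L by lra.
rewrite mul1r; apply: le_trans (ler_normD _ _) _; rewrite addrC; apply: lerD.
  have -> : al * intg (- L) L (fun x => cutoff L x * ip (w x t') (w x t')) =
     intg (- L) L (fun x => al * (cutoff L x * ip (w x t') (w x t')) + 0 * 1).
    rewrite intg_linear; first by ring.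
      by apply: cut1; exact: (@jcontinuous_x _ _ t' cww).
    exact: cst_continuous.
  apply: intg_norm_le => //; first exact: cut1.
    by apply: continuous_lin; [apply: cut1; exact: (@jcontinuous_x _ _ t' cww)|exact: cst_continuous].
  move=> x hx; rewrite mul0r addr0 normrM (ger0_norm (cutoff_ge0 _ _)) mulrCA ler_wpM2l ?cutoff_ge0//.
  rewrite /r normrN normrM ger0_norm//.
  have hu1 := Hk x t' (conj H1a H1b); have hu2 := Hk x (t' + h) (conj H1c H1d).
  have hc3 := cube_lipschitz hu1 hu2.
  have hm := mnorm_sqr_le_ip (w x t'); rewrite -/D in hm.
  apply: le_trans (_ : 4 * (mnorm (w x t') * (mnorm s * (3 * (k * k) * mnorm (w x t')))) <= _).
    rewrite ler_pM2l//; apply: le_trans (ip_le_mnorm _ _) _.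
    rewrite ler_wpM2l ?mnorm_ge0//; apply: le_trans (mnormM _ _) _.
    by rewrite ler_wpM2l ?mnorm_ge0.
  rewrite (_ : 4 * _ = 12 * (k * k) * mnorm s * mnorm (w x t') ^+ 2); last by ring.
  apply: le_trans (_ : 12 * (k * k) * mnorm s * (D * ip (w x t') (w x t')) <= _).
    by rewrite ler_wpM2l// !mulr_ge0// ?mnorm_ge0// ltW.
  by rewrite [_ * (D * _)]mulrA ler_wpM2r ?ip_ge0// /al lerDl.
rewrite normrM ger0_norm//.
pose g x := 1 * ip (w x t') (w x t') + 1 * ip (wx x t') (wx x t').
have cwwx : continuous (fun x => ip (w x t') (w x t')) by exact: (@jcontinuous_x _ _ t' cww).
have cwxwx : continuous (fun x => ip (wx x t') (wx x t')).
  apply: (@jcontinuous_x _ (fun x t => ip (wx x t) (wx x t)) t'); exact: jcontinuous_ip.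
have cg : continuous g by exact: continuous_lin.
have hflux : `|intg (- L) L (fun x => cutoff L x * Fx x)| <= 4 / L * intg (- L) L g.
  have dF (x : R) : is_derive x 1 (fun x => ip (w x t') (s *m wx x t')) (Fx x).
    exact: (is_derive_ip (dw_x x t') (is_mderiveMl s (dwx_x x t'))).
  apply: (intg_cutoff_flux L0 cFx cg dF) => x; rewrite /g.
  have := @ip_Young R _ _ (w x t') (s *m wx x t') 1 ltr01.
  rewrite ip_s_s invr1; have := ip_ge0 (w x t'); have := ip_ge0 (wx x t'); lra.
have key (v : R -> R -> M) : mjcontinuous v ->
   density_le K (fun x => ip (v x t') (v x t')) -> density_le K (fun x => ip (v x (t' + h)) (v x (t' + h))) ->
   intg (- L) L (fun x => ip (v x (t' + h) - v x t') (v x (t' + h) - v x t')) <= 4 * K.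
  move=> cv v1 v2.
  have cvv : jcontinuous (fun x t => ip (v x t) (v x t)) by exact: jcontinuous_ip.
  have cv1 := @jcontinuous_x _ _ t' cvv; have cv2 := @jcontinuous_x _ _ (t' + h) cvv.
  apply: le_trans (_ : intg (- L) L (fun x => 2 * ip (v x (t' + h)) (v x (t' + h)) + 2 * ip (v x t') (v x t')) <= _).
    apply: le_intg => //.
    - apply: (@jcontinuous_x _ (fun x t => ip (v x (t + h) - v x t) (v x (t + h) - v x t))).
      by apply: jcontinuous_ip; apply: mjcontinuousB => //; exact: (@mjcontinuous_shift _ _ _ _ h cv).
    - exact: continuous_lin.
    - by move=> x _; exact: ipB_le.
  rewrite intg_linear//; have := v1 _ _ LL; have := v2 _ _ LL; lra.
have hg : intg (- L) L g <= 8 * K.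
  rewrite intg_linear//; have := key u cu H1a H1c; have := key ux cux H1b H1d.
  rewrite -/(wx) /w /wx; lra.
(* 64 = 2 * 4 * 8: the factor of the flux, the slope of the cutoff, and 4 K for each of |w|^2 and
   |w_x|^2. *)
apply: le_trans (_ : 2 * (4 / L * (8 * K)) <= _); last by apply: le_of_eq; ring.
rewrite ler_pM2l//; apply: le_trans hflux _; rewrite ler_pM2l//; exact: divr_gt0.
Qed.

(** The bound on u_t over [c, d] controls the difference quotient at time c; [difference_growth]
    carries this to every other time, and L -> oo removes the cutoff error. Then h -> 0 returns a
    bound on u_t. *)
Lemma H2_propagate K K' t1 t2 c d : t1 <= c -> c < d -> d <= t2 ->
  (forall t, t1 <= t <= t2 -> H1 K t) -> (forall t, c <= t <= d -> H2 K' t) ->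
  exists K2, forall t, t1 <= t <= t2 -> H2 K2 t.
Proof.
move=> t1c cd dt2 HK HK'.
have [al al0 grow] := difference_growth K.
pose E := expR (al * (t2 - t1)).
have E0 : 0 < E by exact: expR_gt0.
(* 4 because the cutoff is at least 1 / 4 on the inner half, [E] for the growth between two times,
   [expR 1 * K'] from [increment_le]. *)
pose B := 4 * E * (expR 1 * K').
have t12 : t1 < t2 by lra.
have K0 : 0 <= K.
  by apply: (@density_le_ge0 K (fun x => ip (u x t1) (u x t1))); apply HK; lra.
(* The difference needs t + h <= t2; the end point t2 is recovered by closedness. *)
have step t : t1 <= t < t2 -> density_le B (fun x => ip (ut x t) (ut x t)).
  move=> /andP[ht1 ht2] a b ab.
  set J := intg a b _.
  have [r [r0 r1 r2]] : exists r, [/\ 0 < r, r <= t2 - t & r <= d - c].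
    exists (Num.min (t2 - t) (d - c)); rewrite !ge_min !lexx orbT.
    by split=> //; rewrite lt_min !subr_gt0 ht2.
  have wbound h : 0 < h -> h <= r ->
      intg a b (fun x => ip (u x (t + h) - u x t) (u x (t + h) - u x t)) <= B * h ^+ 2.
    move=> h0 hr; apply/ler_addgt0Pr => e e0.
    (* Large enough for a and b to lie in the inner half, and for 4 E times the flux error 64 K / L
       / al to stay below e. *)
    pose L := 2 * `|a| + 2 * `|b| + 1 + 4 * E * (64 * K) / al / e.
    have a0 := normr_ge0 a; have b0 := normr_ge0 b.
    have Q0 : 0 <= 4 * E * (64 * K) / al by rewrite divr_ge0 ?mulr_ge0// ltW.
    have Q1 : 0 <= 4 * E * (64 * K) / al / e by rewrite divr_ge0// ltW.
    have L0 : 0 < L by rewrite /L; lra.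
    have LQ : 4 * E * (64 * K / L / al) <= e.
      rewrite (_ : 4 * E * _ = 4 * E * (64 * K) / al / L); last by ring.
      by rewrite ler_pdivrMr// [e * L]mulrC -ler_pdivrMr// /L; lra.
    have cw : continuous (fun x => ip (u x (t + h) - u x t) (u x (t + h) - u x t)).
      apply: (@jcontinuous_x _ (fun x t => ip (u x (t + h) - u x t) (u x (t + h) - u x t))).
      by apply: jcontinuous_ip; apply: mjcontinuousB => //; exact: (@mjcontinuous_shift _ _ _ _ h cu).
    have cwc : continuous (fun x => ip (u x (c + h) - u x c) (u x (c + h) - u x c)).
      apply: (@jcontinuous_x _ (fun x t => ip (u x (t + h) - u x t) (u x (t + h) - u x t))).
      by apply: jcontinuous_ip; apply: mjcontinuousB => //; exact: (@mjcontinuous_shift _ _ _ _ h cu).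
    have A1 := intg_cutoff_ge L0 ab _ _ cw (fun x => ip_ge0 _).
    have la : `|a| <= L / 2 by rewrite /L; lra.
    have lb : `|b| <= L / 2 by rewrite /L; lra.
    apply: le_trans (A1 la lb) _.
    have A2 := grow t1 (Num.max t c) h L h0 L0 _ c t _ _.
    have mx : Num.max t c + h <= t2.
      by rewrite -lerBrDr ge_max; apply/andP; split; lra.
    have m1 : t <= Num.max t c by rewrite le_max lexx.
    have m2 : c <= Num.max t c by rewrite le_max lexx orbT.
    have A3 : intg (- L) L (fun x => cutoff L x * ip (u x (c + h) - u x c) (u x (c + h) - u x c)) <= expR 1 * (h ^+ 2 * K').
      apply: le_trans (ler_norm _) _; apply: le_trans (intg_cutoff_le L0 cwc cwc _) _.
        by move=> x; rewrite ger0_norm// ip_ge0.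
      apply: increment_le => //; last by lra.
      by move=> t' ht'; apply: HK'; lra.
    have A4 : expR (al * (Num.max t c - t1)) <= E by rewrite ler_expR ler_pM2l//; lra.
    have Q2 : 0 <= 64 * K / L / al by rewrite !divr_ge0 ?mulr_ge0// ltW.
    have A5 : intg (- L) L (fun x => cutoff L x * ip (u x (t + h) - u x t) (u x (t + h) - u x t)) <=
       E * (expR 1 * (h ^+ 2 * K') + 64 * K / L / al).
      apply: le_trans (A2 _ _ _) _.
      - by move=> t' /andP[ht'1 ht'2]; apply: HK; rewrite ht'1 (le_trans ht'2 mx).
      - by rewrite t1c.
      - by rewrite ht1.
      apply: (ler_pM (expR_ge0 _) _ A4); last by rewrite lerD2r.
      rewrite addr_ge0//; apply: intg_ge0; first by rewrite ge0_cp ?ltW.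
        by move=> x; apply: continuousM; [exact: continuous_cutoff|exact: cwc].
      by move=> x _; rewrite mulr_ge0 ?cutoff_ge0 ?ip_ge0.
    have -> : B * h ^+ 2 = 4 * (E * (expR 1 * (h ^+ 2 * K'))) by rewrite /B; ring.
    by move: A5 LQ; lra.
  have dv (x t' : R) : is_derive t' 1 (fun t' => ip (u x t') (ut x t)) (ip (ut x t') (ut x t)).
    have := is_derive_ip (du_t x t') (is_mderive_cst (ut x t) t').
    by rewrite [ip _ 0]ipC ip0l addr0.
  have cut0 : mjcontinuous (fun x _ => ut x t) by exact: mjcontinuous_freeze.
  have cv : jcontinuous (fun x t' => ip (u x t') (ut x t)) by exact: jcontinuous_ip.
  have cv' : jcontinuous (fun x t' => ip (ut x t') (ut x t)) by exact: jcontinuous_ip.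
  have /is_derive_approxP dZ := is_derive_param_intg t ab dv cv cv'.
  have J0 : 0 <= J by apply: intg_ge0; [exact: ab|exact: k2|move=> x _; exact: ip_ge0].
  apply/ler_addgt0Pr => e e0; have e20 : 0 < e / 2 by lra.
  have [del del0 Hd] := dZ _ e20.
  have [h [h0 h1 h2]] : exists h, [/\ 0 < h, h <= r & h <= del / 2].
    exists (Num.min r (del / 2)); rewrite !ge_min !lexx orbT.
    by split=> //; rewrite lt_min r0 divr_gt0.
  have hd : `|h| < del by rewrite gtr0_norm//; lra.
  have := Hd h hd; rewrite (gtr0_norm h0) -/J.
  have cvth := @jcontinuous_x _ _ (t + h) cv; have cvt := @jcontinuous_x _ _ t cv.
  have cw : continuous (fun x => ip (u x (t + h) - u x t) (u x (t + h) - u x t)).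
    apply: (@jcontinuous_x _ (fun x t => ip (u x (t + h) - u x t) (u x (t + h) - u x t))).
    by apply: jcontinuous_ip; apply: mjcontinuousB => //; exact: (@mjcontinuous_shift _ _ _ _ h cu).
  have : intg a b (fun x => 2 * ip (u x (t + h)) (ut x t) + (- 2) * ip (u x t) (ut x t)) <=
     intg a b (fun x => h^-1 * ip (u x (t + h) - u x t) (u x (t + h) - u x t) + h * ip (ut x t) (ut x t)).
    apply: le_intg => //; [exact: continuous_lin|by apply: continuous_lin; [exact: cw|exact: k2]|].
    move=> x _; have hi : 0 < h^-1 by rewrite invr_gt0.
    have := ip_Young (u x (t + h) - u x t) (ut x t) hi; rewrite invrK.
    have := ler_norm (ip (u x (t + h) - u x t) (ut x t)); rewrite !(ipDl, ipNl); lra.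
  rewrite intg_linear// intg_linear; [|exact: cw|exact: k2]; rewrite -/J.
  have := wbound h h0 h1; rewrite -(@ler_pM2l _ h^-1) ?invr_gt0//.
  have -> : h^-1 * (B * h ^+ 2) = h * B by field; rewrite gt_eqF.
  move=> hw hpq /ler_normlP[hp _].
  rewrite -(ler_pM2l h0); lra.
exists B => t /andP[ht1 ht2].
move: ht2; rewrite le_eqVlt => /orP[/eqP ->|ht2]; last by apply: step; rewrite ht1.
exact: (density_le_closed c2 t12 step).
Qed.
(** Finiteness at each time and Baire on the open interval, whose relatively open portions contain
    genuine intervals, give a piece with a uniform bound on u_t; [H2_propagate] spreads it. *)
Lemma H1_to_H2 K t1 t2 : t1 < t2 -> (forall t, t1 <= t <= t2 -> H1 K t) ->
  exists K2, forall t, t1 <= t <= t2 -> H2 K2 t.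
Proof.
move=> t12 HK.
have cover t : exists k : nat, H2 k%:R t.
  have [K2 hK2] := H2_fin t; exists (Num.bound `|K2|).
  apply: density_le_mono hK2; apply: le_trans (ler_norm _) _; apply/ltW.
  exact: archi_boundP.
have [|k [t0 [del [/= /andP[t01 t02] del0 Hk]]]] :=
  @baire_portion R [set t | t1 < t < t2] (fun k => H2 k%:R) (fun k t => @H2_fail_open k%:R t) cover.
  by exists ((t1 + t2) / 2) => /=; apply/andP; split; lra.
have [d [d0 d1 d2]] : exists d, [/\ t0 < d, d < t2 & d < t0 + del].
  exists ((t0 + Num.min t2 (t0 + del)) / 2).
  have : t0 < Num.min t2 (t0 + del) by rewrite lt_min t02; lra.
  have : Num.min t2 (t0 + del) <= t2 by rewrite ge_min lexx.
  have : Num.min t2 (t0 + del) <= t0 + del by rewrite ge_min lexx orbT.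
  by move: (Num.min _ _) => m h1 h2 h3; split; lra.
apply: (@H2_propagate K k%:R t1 t2 t0 d) => //; [exact: ltW|exact: ltW|].
move=> t /andP[h1 h2]; apply: Hk => /=; first by apply/andP; split; lra.
by rewrite ltr_norml; lra.
Qed.

Lemma is_derive_change (y y' : R -> R) (m t1 t2 : R) : (forall t : R, is_derive t 1 y (y' t)) ->
  0 <= m -> (forall t, t1 <= t <= t2 -> `|y' t| <= m) ->
  forall r t, t1 <= r <= t2 -> t1 <= t <= t2 -> y t <= y r + m * (t2 - t1).
Proof.
move=> dy m0 bd r t /andP[s1 s2] /andP[h1 h2].
have key (k : R) : 0 <= k -> k <= t2 - t1 -> m * k <= m * (t2 - t1) by move=> *; exact: ler_wpM2l.
have [st|/ltW ts] := leP r t.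
  have := @le_of_derive _ y (fun y => m * y) y' (fun=> m) r t st (fun z _ => dy z) (fun z _ => is_derive_linear m z).
  have hk := key (t - r); have h : forall x, r <= x <= t -> y' x <= m.
    move=> x /andP[x1 x2]; apply: le_trans (ler_norm _) _; apply: bd; apply/andP; split; lra.
  by move=> /(_ h); have := hk ltac:(lra) ltac:(lra); lra.
have := @le_of_derive _ (fun y => - m * y) y (fun=> - m) y' t r ts (fun z _ => is_derive_linear (- m) z) (fun z _ => dy z).
have hk := key (r - t); have h : forall x, t <= x <= r -> - m <= y' x.
  move=> x /andP[x1 x2].
  have : `|y' x| <= m by apply: bd; apply/andP; split; lra.
  by rewrite ler_norml => /andP[].
by move=> /(_ h); have := hk ltac:(lra) ltac:(lra); lra.
Qed.

(* Local conservation law [e_t = 2 F_x]: the cutoff integral of [e] changes by O(1/L). *)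
Lemma cutoff_conservation (e et F Fx g : R -> R -> R) (Kg t1 t2 L : R) : 0 < L ->
  (forall x t : R, is_derive t 1 (e x) (et x t)) -> jcontinuous e -> jcontinuous et ->
  (forall x t : R, is_derive x 1 (fun y => F y t) (Fx x t)) -> jcontinuous Fx -> jcontinuous g ->
  (forall x t, et x t = Fx x t *+ 2) -> (forall x t, `|F x t| <= g x t) ->
  (forall t, t1 <= t <= t2 -> density_le Kg (fun x => g x t)) ->
  forall t0 t, t1 <= t0 <= t2 -> t1 <= t <= t2 ->
  intg (- L) L (fun x => cutoff L x * e x t) <=
  intg (- L) L (fun x => cutoff L x * e x t0) + 8 * Kg / L * (t2 - t1).
Proof.
move=> L0 de ce cet dF cFx cg etF Fg Hg t0 t ht0 ht.
have Kg0 : 0 <= Kg by exact: density_le_ge0 (Hg t0 ht0).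
apply: (is_derive_change (fun t => is_derive_intg_cutoff t L0 de ce cet)) => //.
  by rewrite divr_ge0 ?mulr_ge0// ltW.
move=> t' ht'.
have cF1 := @jcontinuous_x _ _ t' cFx; have cg1 := @jcontinuous_x _ _ t' cg.
have := intg_cutoff_flux L0 cF1 cg1 (fun x => dF x t') (fun x => Fg x t').
have cc : continuous (fun x => cutoff L x * Fx x t').
  by move=> x; apply: continuousM; [exact: continuous_cutoff|exact: cF1].
have -> : intg (- L) L (fun x => cutoff L x * et x t') = 2 * intg (- L) L (fun x => cutoff L x * Fx x t').
  transitivity (intg (- L) L (fun x => 2 * (cutoff L x * Fx x t') + 0 * Fx x t')).
    by congr intg; apply/funext => x; rewrite etF; ring.
  by rewrite intg_linear//; ring.
rewrite normrM ger0_norm// => h.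
have LL : - L <= L by lra.
have h2 : 4 / L * intg (- L) L (fun x => g x t') <= 4 / L * Kg.
  by rewrite ler_pM2l ?divr_gt0//; exact: Hg.
rewrite (_ : 8 * Kg / L = 2 * (4 / L * Kg)); last by ring.
by rewrite ler_pM2l//; exact: le_trans h2.
Qed.

Lemma density_le_add K K' (r r' : R -> R) : continuous r -> continuous r' ->
  density_le K r -> density_le K' r' -> density_le (K + K') (fun x => r x + r' x).
Proof.
move=> cr cr' hK hK' a b ab.
have -> : intg a b (fun x => r x + r' x) = 1 * intg a b r + 1 * intg a b r'.
  by rewrite -intg_linear//; congr intg; apply/funext => x; ring.
by rewrite !mul1r lerD ?hK ?hK'.
Qed.

(** The supremum of the window integrals is finite by the a priori bound [X0], and the hypothesis at
    that supremum reads sup <= sup / 2 + G. The size of [X0] leaves no trace in the result. *)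
Lemma density_le_absorb r X0 G : (0 <= G) -> density_le X0 r ->
  (forall X, density_le X r -> density_le (X / 2 + G) r) -> density_le (2 * G) r.
Proof.
move=> G0 hX0 H.
pose A := [set z | exists a b, a <= b /\ z = intg a b r].
have hA : has_sup A.
  split; first by exists (intg 0 0 r), 0, 0.
  by exists X0 => _ [a [b [ab ->]]]; exact: hX0.
have hS : density_le (sup A) r.
  by move=> a b ab; apply: ub_le_sup; [exact: hA.2|exists a, b].
have : sup A <= sup A / 2 + G.
  by apply: ge_sup; [exact: hA.1|move=> _ [a [b [ab ->]]]; exact: H].
move=> h; apply: density_le_mono hS; lra.
Qed.

(** [K] and [K2] only make the fluxes vanish as L -> oo, so they do not enter [Fn]. The mass is
    bounded first; the energy then bounds u_x, its quartic term being absorbed through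
    [pointwise_le]. *)
Lemma H1_conserved : exists Fn : R -> R, forall t1 t2 K K2,
  (forall t, t1 <= t <= t2 -> H1 K t) -> (forall t, t1 <= t <= t2 -> H2 K2 t) ->
  forall K0 t0 t, t1 <= t0 <= t2 -> t1 <= t <= t2 -> H1 K0 t0 -> H1 (Fn K0) t.
Proof.
pose D : R := (2 * (n * n)%:R) ^+ 2.
have D0 : 0 <= D by exact: sqr_ge0.
(* [Mn] is 4 (K0 + 1): the factor of the cutoff, and 1 for a flux error made at most 1 by a large L.
   [dn] makes 8 D^2 [Mn] [dn] at most 1, so that the quartic term costs at most half of X; [G]
   collects the rest. *)
pose Mn (K0 : R) := 4 * K0 + 4.
pose dn (K0 : R) := (8 * (D * D) * Mn K0 + 1)^-1.
pose G (K0 : R) := 4 * (K0 + 1) + 4 * (D * D) * Mn K0 * ((dn K0)^-1 * Mn K0).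
have ratio (z : R) : 0 <= z -> z * (z + 1)^-1 <= 1.
  by move=> z0; rewrite ler_pdivrMr ?mul1r; lra.
(* The final arithmetic over plain reals: I is the window integral of |u_x|^2, Y and Y0 its cutoff
   integrals at t and t0, rt and r0 those of the quartic term, z the flux error. *)
have conclude (I Y Y0 r0 rt P Q X kk z : R) : 1 * Y + (-1) * rt <= 1 * Y0 + (-1) * r0 + z ->
    I <= 4 * Y -> 0 <= r0 -> Y0 <= kk -> rt <= P + Q -> 8 * P <= X -> z <= 1 ->
    I <= X / 2 + 4 * (kk + 1) + 4 * Q by lra.
exists (fun K0 => Mn K0 + 2 * G K0) => t1 t2 K K2 HK HK2 K0 t0 t ht0 ht H0.
have K00 : 0 <= K0 by exact: density_le_ge0 H0.1.
have Kp : 0 <= K by exact: density_le_ge0 (HK t0 ht0).1.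
have K2p : 0 <= K2 by exact: density_le_ge0 (HK2 t0 ht0).
have M0 : 0 <= Mn K0 by rewrite /Mn; lra.
have DM0 : 0 <= D * D * Mn K0 by rewrite !mulr_ge0.
have d0 : 0 < dn K0 by rewrite invr_gt0; lra.
have G0 : 0 <= G K0.
  by rewrite /G addr_ge0// ?mulr_ge0// ?invr_ge0 ?ltW//; lra.
have T0 : 0 <= t2 - t1 by lra.
have bigL (Q a b : R) : 0 <= Q -> exists L, [/\ 0 < L, `|a| <= L / 2, `|b| <= L / 2 & 8 * Q / L * (t2 - t1) <= 1].
  move=> Q0; have a0 := normr_ge0 a; have b0 := normr_ge0 b.
  have QT : 0 <= 8 * Q * (t2 - t1) by rewrite !mulr_ge0.
  have L0 : 0 < 2 * `|a| + 2 * `|b| + 1 + 8 * Q * (t2 - t1) by lra.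
  exists (2 * `|a| + 2 * `|b| + 1 + 8 * Q * (t2 - t1)); split => //; try lra.
  by rewrite mulrAC ler_pdivrMr//; lra.
have cs : mjcontinuous (fun _ _ => s) by exact: mjcontinuous_cst.
have cutoff_cont L (f : R -> R) : continuous f -> continuous (fun x => cutoff L x * f x).
  by move=> cf x; apply: continuousM; [exact: continuous_cutoff|exact: cf].
have mass : density_le (Mn K0) (fun x => ip (u x t) (u x t)).
  move=> a b ab; have [L [L0 la lb hL]] := bigL (2 * K) a b ltac:(lra).
  have B := intg_cutoff_ge L0 ab la lb (@k0 t) (fun x => ip_ge0 _).
  apply: le_trans B _.
  have csux : mjcontinuous (fun x t => s *m ux x t) by exact: mjcontinuousM.
  have csuxx : mjcontinuous (fun x t => s *m uxx x t) by exact: mjcontinuousM.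
  have A : intg (- L) L (fun x => cutoff L x * ip (u x t0) (u x t0)) <= K0.
    apply: le_trans (ler_norm _) _; apply: le_trans (intg_cutoff_le L0 (@k0 t0) (@k0 t0) _) _.
      by move=> x; rewrite ger0_norm// ip_ge0.
    by apply: H0.1; lra.
  have Fg x t' : `|ip (u x t') (s *m ux x t')| <= ip (u x t') (u x t') + ip (ux x t') (ux x t').
    have := @ip_Young R _ _ (u x t') (s *m ux x t') 1 ltr01.
    rewrite ip_s_s invr1; have := ip_ge0 (u x t'); have := ip_ge0 (ux x t'); lra.
  have Hg t' : t1 <= t' <= t2 -> density_le (2 * K) (fun x => ip (u x t') (u x t') + ip (ux x t') (ux x t')).
    move=> ht'; rewrite mulr2n mulrDl mul1r.
    by apply: density_le_add; [exact: k0|exact: k1|exact: (HK t' ht').1|exact: (HK t' ht').2].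
  have := cutoff_conservation L0 (fun x t => is_derive_ip (du_t x t) (du_t x t)) c0
    (jcontinuousD (jcontinuous_ip cut cu) (jcontinuous_ip cu cut))
    (fun x t => is_derive_ip (du_x x t) (is_mderiveMl s (dux_x x t)))
    (jcontinuousD (jcontinuous_ip cux csux) (jcontinuous_ip cu csuxx))
    (jcontinuousD c0 c1) mass_law Fg Hg ht0 ht.
  rewrite /Mn; move: A hL; lra.
split.
  by apply: density_le_mono mass; lra.
apply: (@density_le_mono (2 * G K0)); first by lra.
apply: (density_le_absorb G0 (HK t ht).2) => X hX a b ab.
have X0 := density_le_ge0 hX.
have [L [L0 la lb hL]] := bigL (K + K2) a b ltac:(lra).
have cuu : mjcontinuous (fun x t => u x t *m u x t) by exact: mjcontinuousM.
have cdu : mjcontinuous (fun x t => ut x t *m u x t + u x t *m ut x t).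
  by apply: mjcontinuousD; exact: mjcontinuousM.
have Fg x t' : `|ip (ux x t') (ut x t')| <= ip (ux x t') (ux x t') + ip (ut x t') (ut x t').
  have := @ip_Young R _ _ (ux x t') (ut x t') 1 ltr01.
  rewrite invr1; have := ip_ge0 (ux x t'); have := ip_ge0 (ut x t'); lra.
have Hg t' : t1 <= t' <= t2 -> density_le (K + K2) (fun x => ip (ux x t') (ux x t') + ip (ut x t') (ut x t')).
  by move=> ht'; apply: density_le_add; [exact: k1|exact: k2|exact: (HK t' ht').2|exact: HK2].
have := cutoff_conservation L0
  (fun x t => is_derive_funB (is_derive_ip (dux_t x t) (dux_t x t))
     (is_derive_ip (is_mderiveM (du_t x t) (du_t x t)) (is_mderiveM (du_t x t) (du_t x t))))
  (jcontinuousB c1 (jcontinuous_ip cuu cuu))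
  (jcontinuousB (jcontinuousD (jcontinuous_ip cutx cux) (jcontinuous_ip cux cutx))
     (jcontinuousD (jcontinuous_ip cdu cuu) (jcontinuous_ip cuu cdu)))
  (fun x t => is_derive_ip (dux_x x t) (dut_x x t))
  (jcontinuousD (jcontinuous_ip cuxx cut) (jcontinuous_ip cux cutx))
  (jcontinuousD c1 c2) energy_law Fg Hg ht0 ht.
pose r4 t x := ip (u x t *m u x t) (u x t *m u x t).
have c4 t' : continuous (r4 t') by exact: (@jcontinuous_x _ _ t' (jcontinuous_ip cuu cuu)).
have split4 t' : intg (- L) L (fun x => cutoff L x * (ip (ux x t') (ux x t') - ip (u x t' *m u x t') (u x t' *m u x t'))) =
   1 * intg (- L) L (fun x => cutoff L x * ip (ux x t') (ux x t')) + (-1) * intg (- L) L (fun x => cutoff L x * r4 t' x).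
  rewrite -intg_linear; first by congr intg; apply/funext => x; rewrite /r4; ring.
    by apply: cutoff_cont; exact: k1.
  exact: cutoff_cont.
rewrite !split4.
have r40 : 0 <= intg (- L) L (fun x => cutoff L x * r4 t0 x).
  apply: intg_ge0; [lra|exact: cutoff_cont|].
  by move=> x _; rewrite mulr_ge0 ?cutoff_ge0 ?ip_ge0.
have A1 : intg (- L) L (fun x => cutoff L x * ip (ux x t0) (ux x t0)) <= K0.
  apply: le_trans (ler_norm _) _; apply: le_trans (intg_cutoff_le L0 (@k1 t0) (@k1 t0) _) _.
    by move=> x; rewrite ger0_norm// ip_ge0.
  by apply: H0.2; lra.
pose S := dn K0 * X + (dn K0)^-1 * Mn K0.
have dn0 := ltW d0.
have S0 : 0 <= S.
  by apply: addr_ge0; apply: mulr_ge0 => //; rewrite invr_ge0.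
have r4le x : r4 t x <= D * D * S * ip (u x t) (u x t).
  have hu := pointwise_le mass hX x d0; rewrite -/S in hu.
  have m1 := ip_self_le_mnorm (u x t *m u x t).
  have m2 := mnormM (u x t) (u x t).
  have m3 := mnorm_sqr_le_ip (u x t); rewrite -/D in m3.
  have i0 := ip_ge0 (u x t).
  apply: le_trans m1 _; apply: le_trans (_ : (mnorm (u x t) ^+ 2) ^+ 2 <= _).
    by rewrite ler_pXn2r ?nnegrE ?mnorm_ge0// ?sqr_ge0// [leRHS]expr2.
  apply: le_trans (_ : (D * ip (u x t) (u x t)) ^+ 2 <= _).
    by rewrite ler_pXn2r ?nnegrE ?sqr_ge0// mulr_ge0.
  rewrite (_ : _ ^+ 2 = D * D * ip (u x t) (u x t) * ip (u x t) (u x t)); last by ring.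
  by rewrite ler_wpM2r// ler_wpM2l// mulr_ge0.
have A2 : intg (- L) L (fun x => cutoff L x * r4 t x) <= D * D * S * Mn K0.
  have cS : continuous (fun x => D * D * S * ip (u x t) (u x t) + 0 * ip (u x t) (u x t)).
    by apply: continuous_lin; exact: k0.
  apply: le_trans (ler_norm _) _; apply: le_trans (intg_cutoff_le L0 (@c4 t) cS _) _.
    by move=> x; rewrite ger0_norm ?ip_ge0// mul0r addr0.
  rewrite intg_linear; [|exact: k0|exact: k0].
  rewrite mul0r addr0 ler_wpM2l ?mulr_ge0//; apply: mass; lra.
have B := intg_cutoff_ge L0 ab la lb (@k1 t) (fun x => ip_ge0 _).
have hd : 8 * (D * D) * Mn K0 * dn K0 <= 1.
  by apply: ratio; rewrite !mulr_ge0.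
have hdX : 8 * (D * D * Mn K0 * dn K0 * X) <= X.
  by apply: le_trans (_ : 8 * (D * D) * Mn K0 * dn K0 * X <= _); [apply: le_of_eq; ring|rewrite ler_piMl].
have -> : X / 2 + G K0 = X / 2 + 4 * (K0 + 1) + 4 * (D * D * Mn K0 * ((dn K0)^-1 * Mn K0)) by rewrite /G; ring.
move=> h; apply: (conclude _ _ _ _ _ _ _ _ _ _ h B r40 A1 _ hdX hL).
by apply: le_trans A2 _; apply: le_of_eq; rewrite /S; ring.
Qed.


Let good t := exists2 del, 0 < del & exists K, forall t', `|t' - t| < del -> H1 K t'.

Lemma good_compact t1 t2 : (forall t, t1 <= t <= t2 -> good t) ->
  exists K, forall t, t1 <= t <= t2 -> H1 K t.
Proof.
move=> hg.
have /compact_near_coveringP cpt := @segment_compact R t1 t2.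
have [] := cpt R (pinfty_nbhs R) (fun K t => H1 K t) _ _.
  move=> t /=; rewrite in_itv /= => /hg[del del0 [K hK]].
  exists (ball t del, [set K' | K < K']).
    by split; [exact: nbhsx_ballx|exists K; split => //; exact: num_real].
  move=> [t' K'] [/= ht' hK']; apply: (@H1_mono K); first exact: ltW.
  by apply: hK; rewrite distrC.
move=> A [_ HA]; exists (A + 1) => t ht; apply: (HA (A + 1)) => /=; first by rewrite ltrDl.
by rewrite in_itv.
Qed.

(** No uniform bound near e is known in advance. From an interior time, [H1_conserved] on intervals
    avoiding e gives a bound independent of the interval, so all of [p, q] is bounded, e included,
    and conservation can be restarted from e. The result depends on n0 only and is therefore common
    to all gaps. *)
Lemma H1_gap : exists Fn : R -> R, forall p q e n0, p <= q -> e = p \/ e = q -> H1 n0 e ->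
  (forall t, p <= t <= q -> t != e -> good t) -> forall t, p <= t <= q -> H1 (Fn n0) t.
Proof.
have [Fn HFn] := H1_conserved.
exists (fun k => `|Fn k| + `|k|) => p q e n0 pq epq He hg t ht.
have n00 : 0 <= n0 by exact: density_le_ge0 He.1.
move: pq; rewrite le_eqVlt => /orP[/eqP pq|pq].
  apply: H1_mono (_ : n0 <= _) _; first by rewrite (ger0_norm n00) lerDr.
  have -> // : t = e by move: ht => /andP[? ?]; case: epq => ->; lra.
have sub (r1 r2 : R) : r1 < r2 -> p <= r1 -> r2 <= q -> (e < r1 \/ r2 < e) ->
    forall K0 t0 t, r1 <= t0 <= r2 -> r1 <= t <= r2 -> H1 K0 t0 -> H1 (Fn K0) t.
  move=> r12 pr1 r2q er K0 t0 t' h1 h2 h3.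
  have [K HK] : exists K, forall t, r1 <= t <= r2 -> H1 K t.
    apply: good_compact => r /andP[hr1 hr2]; apply: hg; first by apply/andP; split; lra.
    by apply/eqP => re; case: er; lra.
  have [K2 HK2] := H1_to_H2 r12 HK.
  exact: (HFn r1 r2 K K2 HK HK2 K0 t0 t').
have [t1 [pt1 t1q]] : exists t1, p < t1 /\ t1 < q by exists ((p + q) / 2); lra.
have [K1 HK1] := H1_fin t1.
have near_t1 r : p <= r <= q -> r != e -> H1 (`|Fn K1| + `|K1|) r.
  move=> /andP[r1 r2] re.
  have F1 : Fn K1 <= `|Fn K1| + `|K1| by have := ler_norm (Fn K1); have := normr_ge0 K1; lra.
  have [rt|tr|->] := ltrgtP r t1.
  - have er : e < r \/ t1 < e.
      case: epq => ee; [left|right]; last by rewrite ee.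
      by rewrite lt_neqAle eq_sym re ee.
    apply: (H1_mono F1); apply: (sub r t1 rt r1 (ltW t1q) er K1 t1) => //.
      by rewrite lexx ltW.
    by rewrite lexx ltW.
  - have er : e < t1 \/ r < e.
      case: epq => ee; [left|right]; first by rewrite ee.
      by rewrite lt_neqAle re ee.
    apply: (H1_mono F1); apply: (sub t1 r tr (ltW pt1) r2 er K1 t1) => //.
      by rewrite lexx ltW.
    by rewrite lexx ltW.
  - by apply: H1_mono HK1; have := ler_norm K1; have := normr_ge0 (Fn K1); lra.
have [K HK] : exists K, forall t, p <= t <= q -> H1 K t.
  exists (`|Fn K1| + `|K1| + n0) => r hr.
  have [->|re] := eqVneq r e; first by apply: H1_mono He; rewrite lerDr addr_ge0.
  by apply: H1_mono (near_t1 r hr re); rewrite lerDl.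
have [K2 HK2] := H1_to_H2 pq HK.
apply: (@H1_mono (Fn n0)); first by have := ler_norm (Fn n0); have := normr_ge0 n0; lra.
apply: (HFn p q K K2 HK HK2 n0 e t) => //.
by case: epq => ->; apply/andP; split; lra.
Qed.

Theorem H1_locally_bounded t1 t2 : exists K, forall t, t1 <= t <= t2 -> H1 K t.
Proof.
apply: good_compact => t _; apply: contrapT => nt.
pose E := [set t | ~ good t].
have cover r : exists k : nat, H1 k%:R r.
  have [K hK] := H1_fin r; exists (Num.bound `|K|).
  apply: H1_mono hK; apply: le_trans (ler_norm _) _; apply/ltW.
  exact: archi_boundP.
have [|k [t0 [del [nt0 del0 Hk]]]] :=
  @baire_portion R E (fun k => H1 k%:R) (fun k t => @H1_fail_open k%:R t) cover.
  by exists t.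
have [Fn HFn] := H1_gap.
apply: (nt0); exists del => //; exists (`|Fn k%:R| + k%:R) => r rt0.
have [gr|ngr] := pselect (good r); last first.
  by apply: H1_mono (Hk r ngr rt0); rewrite lerDr.
apply: (@H1_mono (Fn k%:R)); first by have := ler_norm (Fn k%:R); have := ler0n R k; lra.
have good_open x : good x -> exists2 d, 0 < d & forall y, `|y - x| < d -> good y.
  move=> [d d0 [K HK]]; exists (d / 2); first by rewrite divr_gt0.
  move=> y hy; exists (d / 2); first by rewrite divr_gt0.
  exists K => z hz; apply: HK; move: hy hz; rewrite !ltr_norml => /andP[? ?] /andP[? ?].
  by apply/andP; split; lra.
have closed_sup (A : set R) : A `<=` E -> has_sup A -> E (sup A).
  move=> AE hA /good_open[d d0 Hd]; have [x Ax hx] := sup_adherent d0 hA.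
  have xs : x <= sup A by apply: ub_le_sup => //; exact: hA.2.
  by apply: (AE x Ax); apply: Hd; rewrite ltr_norml; apply/andP; split; lra.
have closed_inf (A : set R) : A `<=` E -> has_inf A -> E (inf A).
  move=> AE hA /good_open[d d0 Hd]; have [x Ax hx] := inf_adherent d0 hA.
  have xs : inf A <= x by apply: ge_inf => //; exact: hA.2.
  by apply: (AE x Ax); apply: Hd; rewrite ltr_norml; apply/andP; split; lra.
move: rt0; rewrite ltr_norml => /andP[r1 r2].
have [rt|tr|rt] := ltrgtP r t0; last by case: nt0; rewrite -rt.
  (* [inf A] is the bad time nearest to r on the side of t0. The segment between them is a gap whose
     only bad time is that end, and there the bound [k] holds. *)
  pose A := [set x | E x /\ r <= x <= t0].
  have hA : has_inf A by split; [exists t0; split => //=; rewrite lexx ltW|exists r => x [_ /andP[]]].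
  have eE : E (inf A) by apply: closed_inf => // x [].
  have e1 : r <= inf A by apply: lb_le_inf; [exact: hA.1|move=> x [_ /andP[]]].
  have e2 : inf A <= t0 by apply: ge_inf; [exact: hA.2|split => //=; rewrite lexx ltW].
  apply: (HFn r (inf A) (inf A)) => //; [by right| | |by rewrite lexx e1].
    by apply: Hk => //; rewrite ltr_norml; apply/andP; split; lra.
  move=> x /andP[x1 x2] xe; apply: contrapT => nx.
  have xA : inf A <= x by apply: ge_inf; [exact: hA.2|split => //=; rewrite x1 (le_trans x2)].
  by move: xe; rewrite eq_le x2 xA.
pose A := [set x | E x /\ t0 <= x <= r].
have hA : has_sup A by split; [exists t0; split => //=; rewrite lexx ltW|exists r => x [_ /andP[]]].
have eE : E (sup A) by apply: closed_sup => // x [].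
have e1 : sup A <= r by apply: ge_sup; [exact: hA.1|move=> x [_ /andP[]]].
have e2 : t0 <= sup A by apply: ub_le_sup; [exact: hA.2|split => //=; rewrite lexx ltW].
apply: (HFn (sup A) r (sup A)) => //; [by left| | |by rewrite lexx e1].
  by apply: Hk => //; rewrite ltr_norml; apply/andP; split; lra.
move=> x /andP[x1 x2] xe; apply: contrapT => nx.
have xA : x <= sup A by apply: ub_le_sup; [exact: hA.2|split => //=; rewrite x2 (le_trans e2)].
by move: xe; rewrite eq_le x1 xA.
Qed.


End NonlinearSchrodinger.

(** * Global existence for linear ordinary differential equations by Picard iteration *)

Section LinearODE.
Context {R : realType}.
Local Notation C := (R[i]).

(** The lower envelopes a k - 2 B / 2^k increase and stay below the decreasing upper ones, so their
    supremum lies between the two at every k. The explicit rate is what gets used. *)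
Lemma geometric_limit (a : nat -> R) (B : R) : 0 <= B -> (forall k, `|a k.+1 - a k| <= B * 2^-1 ^+ k) ->
  exists l, forall k, `|l - a k| <= 2 * B * 2^-1 ^+ k.
Proof.
move=> B0 H.
pose lo k := a k - 2 * B * 2^-1 ^+ k; pose hi k := a k + 2 * B * 2^-1 ^+ k.
have p0 k : 0 <= 2 * B * 2^-1 ^+ k by rewrite !mulr_ge0// exprn_ge0// invr_ge0.
have inc k : lo k <= lo k.+1.
  by have := H k; rewrite /lo exprS ler_norml; lra.
have dec k : hi k.+1 <= hi k.
  by have := H k; rewrite /hi exprS ler_norml; lra.
have inc2 k j : lo k <= lo (k + j)%N.
  by elim: j => [|j IH]; [rewrite addn0|rewrite addnS; exact: le_trans (inc _)].
have dec2 k j : hi (k + j)%N <= hi k.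
  by elim: j => [|j IH]; [rewrite addn0|rewrite addnS; exact: le_trans (dec _) _].
have lohi k j : lo k <= hi j.
  apply: le_trans (inc2 k j) _; apply: le_trans (_ : hi (k + j)%N <= _).
    by rewrite /lo /hi; have := p0 (k + j)%N; lra.
  by rewrite addnC; exact: dec2.
have hA : has_sup (range lo) by split; [exists (lo 0%N); exists 0%N|exists (hi 0%N) => _ [k _ <-]].
exists (sup (range lo)) => k.
have h1 : lo k <= sup (range lo) by apply: ub_le_sup; [exact: hA.2|exists k].
have h2 : sup (range lo) <= hi k by apply: ge_sup; [exact: hA.1|move=> _ [j _ <-]].
by rewrite ler_norml; move: h1 h2; rewrite /lo /hi; lra.
Qed.

Lemma mnormBE p q (A B : 'M[C]_(p, q)) : mnorm (A - B) =
  \sum_i \sum_j (`|complex.Re (A i j) - complex.Re (B i j)| + `|complex.Im (A i j) - complex.Im (B i j)|).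
Proof.
apply: eq_bigr => i _; apply: eq_bigr => j _.
by rewrite !mxE complexReD complexReN complexImD complexImN.
Qed.

Lemma mnorm_entryB p q (A B : 'M[C]_(p, q)) i j :
  `|complex.Re (A i j) - complex.Re (B i j)| <= mnorm (A - B) /\
  `|complex.Im (A i j) - complex.Im (B i j)| <= mnorm (A - B).
Proof.
have := mnorm_entry (A - B) i j; rewrite !mxE complexReD complexReN complexImD complexImN => H.
by split; apply: le_trans H; rewrite ?lerDl ?lerDr.
Qed.

Lemma half_pow_small (B e : R) : 0 <= B -> 0 < e -> exists k, B * 2^-1 ^+ k <= e.
Proof.
move=> B0 e0; exists (Num.bound (B / e)).
have Be : 0 <= B / e by rewrite divr_ge0// ltW.
have h1 := archi_boundP Be.
have h2 k : k%:R <= 2 ^+ k :> R.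
  by rewrite -natrX ler_nat ltnW// ltn_expl.
rewrite exprVn ler_pdivrMr ?exprn_gt0//.
rewrite mulrC -ler_pdivrMr//; exact: le_trans (ltW h1) (h2 _).
Qed.

(** The limit is chosen once at each point x, whereas B changes with the interval under
    consideration; hence a single [l] serving every admissible B. *)
Lemma geometric_limit_any (a : nat -> R) :
  (exists2 B, 0 <= B & forall k, `|a k.+1 - a k| <= B * 2^-1 ^+ k) ->
  exists l, forall B, 0 <= B -> (forall k, `|a k.+1 - a k| <= B * 2^-1 ^+ k) ->
    forall k, `|l - a k| <= 2 * B * 2^-1 ^+ k.
Proof.
move=> [B0 B00 H0]; have [l Hl] := geometric_limit B00 H0.
exists l => B Bp H; have [l' Hl'] := geometric_limit Bp H.
suff -> : l = l' by [].
apply/eqP; rewrite -subr_eq0 -normr_le0; apply/ler_addgt0Pr => e e0; rewrite add0r.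
have [k hk] : exists k, (2 * B0 + 2 * B) * 2^-1 ^+ k <= e.
  by apply: half_pow_small => //; rewrite addr_ge0 ?mulr_ge0.
apply: le_trans hk; rewrite mulrDl (_ : l - l' = (l - a k) - (l' - a k)); last by ring.
by apply: le_trans (ler_normB _ _) _; rewrite lerD.
Qed.

(** The mean value inequality is applied to [f m] with m as large as wished, its derivative being
    compared with g' x through one fixed [f' k], which is continuous at x. *)
Lemma is_derive_uniform_limit (f f' : nat -> R -> R) (g g' : R -> R) (eps : nat -> R) x r :
  0 < r -> (forall k (y : R), is_derive y 1 (f k) (f' k y)) -> (forall k, continuous (f' k)) ->
  (forall k y, `|y - x| < r -> `|g y - f k y| <= eps k) ->
  (forall k y, `|y - x| < r -> `|g' y - f' k y| <= eps k) ->
  (forall e, 0 < e -> exists k, eps k <= e) ->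
  is_derive x 1 g (g' x).
Proof.
move=> r0 df cf' fg fg' eps0; apply/is_derive_approxP => e e0.
have e6 : 0 < e / 6 by lra.
have [k hk] := eps0 _ e6.
have /cvgrPdist_lt/(_ _ e6)/nbhs_ballP[d /= d0 Hd] := cf' k x.
exists (Num.min d r); first by rewrite lt_min d0.
move=> h; rewrite lt_min => /andP[hd hr].
apply/ler_addgt0Pr => e' e'0.
(* The slack [e'] pays for the errors of [f m] at x and x + h, which do not scale with h. *)
pose w := Num.min (e / 6) (e' / 4).
have w0 : 0 < w by rewrite lt_min e6; lra.
have [w1 w2] : w <= e / 6 /\ w <= e' / 4 by rewrite /w !ge_min !lexx orbT.
have [m hm] := eps0 _ w0.
have xx : `|x - x| < r by rewrite subrr normr0.
have xh : `|x + h - x| < r by rewrite (_ : x + h - x = h)//; ring.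
have bd y : `|y - x| <= `|x + h - x| -> `|f' m y - g' x| <= e / 6 + e / 6 + e / 6 + e / 6.
  rewrite (_ : x + h - x = h); last by ring.
  move=> hy; have yr : `|y - x| < r by exact: le_lt_trans hr.
  have yd : `|f' k x - f' k y| < e / 6 by apply: Hd; rewrite /ball/= distrC; exact: le_lt_trans hd.
  have := fg' m y yr; have := fg' k y yr; have := fg' k x xx.
  move: yd; rewrite ltr_norml !ler_norml => /andP[? ?] /andP[? ?] /andP[? ?] /andP[? ?].
  by apply/andP; split; lra.
have := is_derive_increment (df m) bd; rewrite (_ : x + h - x = h); last by ring.
have := fg m _ xx; have := fg m _ xh.
have eh : (e / 6 + e / 6 + e / 6 + e / 6) * `|h| <= e * `|h| by rewrite ler_wpM2r//; lra.
move: (h * g' x) eh => z eh; rewrite !ler_norml => /andP[? ?] /andP[? ?] /andP[? ?].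
by apply/andP; split; lra.
Qed.

Section Picard.
Variables (n : nat) (P : R -> 'M[C]_n).
Hypothesis cP : forall i j, continuous (reE P i j) /\ continuous (imE P i j).

Let ctsm p q (f : R -> 'M[C]_(p, q)) := forall i j, continuous (reE f i j) /\ continuous (imE f i j).

Lemma is_mderive_ctsm p q (f f' : R -> 'M[C]_(p, q)) : (forall x, is_mderive f x (f' x)) -> ctsm f.
Proof.
move=> df i j; split => x; have [h1 h2] := df x i j.
  exact: (is_derive_continuous h1).
exact: (is_derive_continuous h2).
Qed.

Lemma ctsmM p q r (f : R -> 'M[C]_(p, q)) (g : R -> 'M[C]_(q, r)) : ctsm f -> ctsm g -> ctsm (fun x => f x *m g x).
Proof.
move=> cf cg.
have F : mjcontinuous (fun x (_ : R) => f x).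
  by move=> i j; split; apply: jcontinuous_of_x; [exact: (cf i j).1|exact: (cf i j).2].
have G : mjcontinuous (fun x (_ : R) => g x).
  by move=> i j; split; apply: jcontinuous_of_x; [exact: (cg i j).1|exact: (cg i j).2].
move=> i j; have [h1 h2] := mjcontinuousM F G i j.
by split; [exact: (@jcontinuous_x _ _ 0 h1)|exact: (@jcontinuous_x _ _ 0 h2)].
Qed.

Definition mint (f : R -> 'M[C]_n) : R -> 'M[C]_n :=
  fun x => \matrix_(i, j) (@complex.Complex R (intg 0 x (reE f i j)) (intg 0 x (imE f i j))).

Lemma is_mderive_mint f x : ctsm f -> is_mderive (mint f) x (f x).
Proof.
move=> cf i j; have [c1 c2] := cf i j; split.
  rewrite (_ : reE (mint f) i j = fun x => intg 0 x (reE f i j)); first exact: is_derive_intg.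
  by apply/funext => y; rewrite /reE mxE.
rewrite (_ : imE (mint f) i j = fun x => intg 0 x (imE f i j)); first exact: is_derive_intg.
by apply/funext => y; rewrite /imE mxE.
Qed.

Fixpoint picard (k : nat) : R -> 'M[C]_n :=
  if k is k'.+1 then fun x => 1%:M + mint (fun y => P y *m picard k' y) x else fun=> 1%:M.

Lemma picard_cts k : ctsm (picard k).
Proof.
elim: k => [|k IH].
  by apply: (@is_mderive_ctsm _ _ _ (fun=> 0)) => x; exact: is_mderive_cst.
apply: (@is_mderive_ctsm _ _ _ (fun x => 0 + P x *m picard k x)) => x.
by apply: is_mderiveD; [exact: is_mderive_cst|apply: (@is_mderive_mint (fun y => P y *m picard k y)); exact: ctsmM].
Qed.

Lemma picard_derive k x : is_mderive (picard k.+1) x (P x *m picard k x).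
Proof.
rewrite -[P x *m _]add0r; apply: is_mderiveD; first exact: is_mderive_cst.
by apply: (@is_mderive_mint (fun y => P y *m picard k y)); apply: ctsmM => //; exact: picard_cts.
Qed.

Lemma picard0 k : picard k 0 = 1%:M.
Proof.
case: k => //= k; rewrite (_ : mint _ 0 = 0) ?addr0//.
by apply/matrixP => i j; rewrite !mxE !intg_id.
Qed.

Lemma ctsm_bounded p q (f : R -> 'M[C]_(p, q)) L : ctsm f ->
  exists2 K, 0 <= K & forall x, - L <= x <= L -> mnorm (f x) <= K.
Proof.
move=> cf.
have H (ij : 'I_p * 'I_q) : exists K, forall x, - L <= x <= L ->
    `|complex.Re (f x ij.1 ij.2)| + `|complex.Im (f x ij.1 ij.2)| <= K.
  have [c1 c2] := cf ij.1 ij.2.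
  have [K1 _ H1] := continuous_bounded (- L) L c1; have [K2 _ H2] := continuous_bounded (- L) L c2.
  by exists (K1 + K2) => x hx; rewrite lerD ?H1 ?H2.
have [K HK] := choice H.
exists `|\sum_i \sum_j K (i, j)| => // x hx; apply: le_trans (ler_norm _).
by apply: ler_sum => i _; apply: ler_sum => j _; exact: (HK (i, j)).
Qed.

(** Twice cosh (mu x), the weight of a Bielecki norm: integrating from 0 a function bounded by [w]
    gains a factor 1 / mu, so that a large mu makes the Picard map contract on a whole interval at
    once. [v] below is the odd primitive. *)
Let w (mu x : R) : R := expR (mu * x) + expR (- mu * x).
Let v (mu x : R) : R := mu^-1 * (expR (mu * x) - expR (- mu * x)).

Let dv mu (x : R) : mu != 0 -> is_derive x 1 (v mu) (w mu x).
Proof.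
move=> m0.
have := is_derive_funZ mu^-1 (is_derive_funB (is_derive_exp_lin mu x) (is_derive_exp_lin (- mu) x)).
by rewrite [X in is_derive _ _ _ X -> _](_ : _ = w mu x)//; rewrite /w; field.
Qed.

Let v_le mu x : 0 < mu -> `|v mu x| <= mu^-1 * w mu x.
Proof.
move=> m0; have mi : 0 < mu^-1 by rewrite invr_gt0.
rewrite /v /w normrM (gtr0_norm mi) ler_pM2l//.
by have := expR_ge0 (mu * x); have := expR_ge0 (- mu * x); rewrite ler_norml; lra.
Qed.

Let w_ge1 mu x : 1 <= w mu x.
Proof.
have e1 (y : R) : 0 <= y -> 1 <= expR y by move=> y0; rewrite -[leLHS]expR0 ler_expR.
rewrite /w mulNr; have [h|h] := leP 0 (mu * x).
  by have := expR_ge0 (- (mu * x)); have := e1 _ h; lra.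
have hn : 0 <= - (mu * x) by lra.
by have := expR_ge0 (mu * x); have := e1 _ hn; lra.
Qed.

Lemma derive_le_sym (f f' : R -> R) (mu k x : R) : 0 < mu -> 0 <= k -> f 0 = 0 ->
  (forall y : R, is_derive y 1 f (f' y)) -> (forall y, `|y| <= `|x| -> `|f' y| <= k * w mu y) ->
  `|f x| <= k * (mu^-1 * w mu x).
Proof.
move=> m0 k0 f0 df bd.
have v0 : v mu 0 = 0 by rewrite /v !mulr0 subrr mulr0.
have dkv (y : R) : is_derive y 1 (fun y => k * v mu y) (k * w mu y).
  by apply: is_derive_funZ; apply: dv; rewrite gt_eqF.
have dnf (y : R) : is_derive y 1 (fun y => - f y) (- f' y) by exact: (is_derive_funN (df y)).
have key (a b : R) : a <= b -> (forall y, a <= y <= b -> `|y| <= `|x|) -> `|f b - f a| <= k * v mu b - k * v mu a.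
  move=> ab h; rewrite ler_norml; apply/andP; split.
    have := le_of_derive ab (fun y _ => dnf y) (fun y _ => dkv y).
    have hh : forall y, a <= y <= b -> - f' y <= k * w mu y.
      by move=> y /h/bd; rewrite ler_norml; lra.
    by move=> /(_ hh); lra.
  have := le_of_derive ab (fun y _ => df y) (fun y _ => dkv y).
  have hh : forall y, a <= y <= b -> f' y <= k * w mu y.
    by move=> y /h/bd; rewrite ler_norml; lra.
  by move=> /(_ hh).
apply: le_trans (_ : k * `|v mu x| <= _); last by rewrite ler_wpM2l// v_le.
have kv : k * v mu x <= k * `|v mu x| by rewrite ler_wpM2l// ler_norm.
have kv' : - (k * v mu x) <= k * `|v mu x| by rewrite -mulrN ler_wpM2l// -normrN ler_norm.
have [x0|x0] := leP 0 x.
  have := key 0 x x0; rewrite f0 v0 mulr0 !subr0 => h; apply: le_trans (h _) kv.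
  by move=> y /andP[y0 yx]; rewrite !ger0_norm.
have := key x 0 (ltW x0); rewrite f0 v0 mulr0 !sub0r normrN => h; apply: le_trans (h _) kv'.
by move=> y /andP[y0 yx]; rewrite (ler0_norm yx) (ltr0_norm x0); lra.
Qed.

Lemma picard_cauchy L : 0 < L -> exists2 B, 0 <= B &
  forall k x, - L <= x <= L -> mnorm (picard k.+1 x - picard k x) <= B * 2^-1 ^+ k.
Proof.
move=> L0.
have [K K0 HK] := ctsm_bounded L cP.
have [A A0 HA] : exists2 A, 0 <= A & forall x, - L <= x <= L -> mnorm (picard 1 x - picard 0 x) <= A.
  apply: ctsm_bounded; apply: (@is_mderive_ctsm _ _ _ (fun x => P x *m picard 0 x - 0)) => x.
  by apply: is_mderiveB; [exact: picard_derive|exact: is_mderive_cst].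
pose c : R := (n * n)%:R.
have c0 : 0 <= c by [].
(* Summing entries costs 2 c and the coefficient costs K, so the contraction factor 2 c K / mu is
   below 1 / 2. *)
pose mu := 4 * c * K + 1.
have cK : 0 <= c * K by rewrite mulr_ge0.
have mu0 : 0 < mu by rewrite /mu; lra.
have step k x : - L <= x <= L -> mnorm (picard k.+1 x - picard k x) <= A * 2^-1 ^+ k * w mu x.
  elim: k x => [|k IH] x hx.
    by rewrite expr0 mulr1; apply: le_trans (HA x hx) _; rewrite ler_peMr.
  have Ak : 0 <= A * 2^-1 ^+ k by rewrite mulr_ge0// exprn_ge0// invr_ge0.
  pose f x := picard k.+2 x - picard k.+1 x.
  pose f' x := P x *m (picard k.+1 x - picard k x).
  have df y : is_mderive f y (f' y).
    by rewrite /f' mulmxBr; apply: is_mderiveB; exact: picard_derive.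
  have f0 : f 0 = 0 by rewrite /f !picard0 subrr.
  have bd y : `|y| <= `|x| -> mnorm (f' y) <= K * (A * 2^-1 ^+ k) * w mu y.
    move=> yx; have hy : - L <= y <= L.
      by rewrite -ler_norml; apply: le_trans yx _; rewrite ler_norml.
    rewrite -mulrA; apply: le_trans (mnormM _ _) _; apply: ler_pM; rewrite ?mnorm_ge0 ?HK ?IH//.
  have KA : 0 <= K * (A * 2^-1 ^+ k) by rewrite mulr_ge0.
  have entry i j : `|complex.Re (f x i j)| + `|complex.Im (f x i j)| <= 2 * (K * (A * 2^-1 ^+ k) * (mu^-1 * w mu x)).
    have h1 : `|complex.Re (f x i j)| <= K * (A * 2^-1 ^+ k) * (mu^-1 * w mu x).
      apply: (@derive_le_sym (reE f i j) (reE f' i j)) => //; first by rewrite /reE f0 mxE.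
        by move=> y; exact: (df y i j).1.
      move=> y /bd; apply: le_trans; apply: le_trans (mnorm_entry _ i j); rewrite /reE lerDl//.
    have h2 : `|complex.Im (f x i j)| <= K * (A * 2^-1 ^+ k) * (mu^-1 * w mu x).
      apply: (@derive_le_sym (imE f i j) (imE f' i j)) => //; first by rewrite /imE f0 mxE.
        by move=> y; exact: (df y i j).2.
      move=> y /bd; apply: le_trans; apply: le_trans (mnorm_entry _ i j); rewrite /imE lerDr//.
    lra.
  apply: le_trans (_ : \sum_(i < n) \sum_(j < n) (2 * (K * (A * 2^-1 ^+ k) * (mu^-1 * w mu x))) <= _).
    by apply: ler_sum => i _; apply: ler_sum => j _; exact: entry.
  rewrite !sumr_const !card_ord -mulrnA -[leLHS]mulr_natr -/c exprS.
  have w0 : 0 <= w mu x by apply: le_trans (w_ge1 mu x).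
  have cKmu : 4 * c * K * mu^-1 <= 1 by rewrite ler_pdivrMr// mul1r /mu; lra.
  rewrite (_ : 2 * _ * c = (4 * c * K * mu^-1) * (A * (2^-1 * 2^-1 ^+ k) * w mu x)); last by field; rewrite gt_eqF.
  by rewrite ler_piMl// mulr_ge0// mulrCA mulr_ge0.
exists (A * w mu L * 2) => [|k x hx].
  by rewrite !mulr_ge0//; apply: le_trans (w_ge1 mu L).
have wL : w mu x <= w mu L * 2.
  have [hx1 hx2] := andP hx.
  have : expR (mu * x) <= expR (mu * L) by rewrite ler_expR ler_pM2l.
  have : expR (- mu * x) <= expR (mu * L) by rewrite ler_expR mulNr -mulrN ler_pM2l//; lra.
  by have := expR_ge0 (- mu * L); rewrite /w; lra.
apply: le_trans (step k x hx) _; apply: le_trans (_ : A * 2^-1 ^+ k * (w mu L * 2) <= _).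
  by rewrite ler_wpM2l// mulr_ge0// exprn_ge0// invr_ge0.
by apply: le_of_eq; ring.
Qed.

Theorem linear_ode : exists Y : R -> 'M[C]_n, Y 0 = 1%:M /\ forall x, is_mderive Y x (P x *m Y x).
Proof.
pose c : R := (n * n)%:R.
have c0 : 0 <= c by [].
have lim x : exists Y : 'M[C]_n, forall B, 0 <= B ->
    (forall k, mnorm (picard k.+1 x - picard k x) <= B * 2^-1 ^+ k) ->
    forall k, mnorm (Y - picard k x) <= 4 * c * B * 2^-1 ^+ k.
  have [B B0 HB] : exists2 B, 0 <= B & forall k, mnorm (picard k.+1 x - picard k x) <= B * 2^-1 ^+ k.
    have x1 : 0 < `|x| + 1 by have := normr_ge0 x; lra.
    have [B B0 HB] := picard_cauchy x1; exists B => // k; apply: HB.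
    by rewrite -ler_norml; have := normr_ge0 x; lra.
  have entry_re i j B' k : mnorm (picard k.+1 x - picard k x) <= B' * 2^-1 ^+ k ->
      `|complex.Re (picard k.+1 x i j) - complex.Re (picard k x i j)| <= B' * 2^-1 ^+ k.
    by apply: le_trans; exact: (mnorm_entryB _ _ i j).1.
  have entry_im i j B' k : mnorm (picard k.+1 x - picard k x) <= B' * 2^-1 ^+ k ->
      `|complex.Im (picard k.+1 x i j) - complex.Im (picard k x i j)| <= B' * 2^-1 ^+ k.
    by apply: le_trans; exact: (mnorm_entryB _ _ i j).2.
  have re (ij : 'I_n * 'I_n) := @geometric_limit_any (fun k => complex.Re (picard k x ij.1 ij.2))
    (ex_intro2 _ _ B B0 (fun k => entry_re _ _ _ _ (HB k))).
  have im (ij : 'I_n * 'I_n) := @geometric_limit_any (fun k => complex.Im (picard k x ij.1 ij.2))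
    (ex_intro2 _ _ B B0 (fun k => entry_im _ _ _ _ (HB k))).
  have [Yr HYr] := choice re; have [Yi HYi] := choice im.
  exists (\matrix_(i, j) (@complex.Complex R (Yr (i, j)) (Yi (i, j)))) => B' B'0 HB' k.
  rewrite mnormBE.
  apply: le_trans (_ : \sum_(i < n) \sum_(j < n) (4 * B' * 2^-1 ^+ k) <= _).
    apply: ler_sum => i _; apply: ler_sum => j _.
    rewrite [(\matrix_(_, _) _) i j]mxE /=.
    have := HYr (i, j) B' B'0 (fun k => entry_re _ _ _ _ (HB' k)) k.
    have := HYi (i, j) B' B'0 (fun k => entry_im _ _ _ _ (HB' k)) k.
    by rewrite /=; lra.
  rewrite !sumr_const !card_ord -mulrnA -[leLHS]mulr_natr -/c; apply: le_of_eq; ring.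
have [Y HY] := choice lim.
exists Y; split.
  have h k : mnorm (Y 0 - picard k 0) <= 4 * c * 0 * 2^-1 ^+ k.
    apply: HY => // k'; rewrite !picard0 subrr mul0r.
    by rewrite /mnorm big1// => i _; rewrite big1// => j _; rewrite mxE normr0 addr0.
  have := h 0%N; rewrite mulr0 mul0r => h0.
  apply/matrixP => i j; have [h1 h2] := mnorm_entryB (Y 0) (picard 0 0) i j.
  have z1 := le_trans h1 h0; have z2 := le_trans h2 h0.
  by apply: complex_ext; apply/eqP; rewrite -subr_eq0 -normr_le0.
move=> x.
have L0 : 0 < `|x| + 1 by have := normr_ge0 x; lra.
have [B B0 HB] := picard_cauchy L0.
have [K K0 HK] := ctsm_bounded (`|x| + 1) cP.
(* One rate for the iterates and for their derivatives: K + 1 covers both multiplication by P and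
   the bare iterate. *)
pose eps k := (K + 1) * (4 * c * B) * 2^-1 ^+ k.
have dom y : `|y - x| < 1 -> - (`|x| + 1) <= y <= `|x| + 1.
  rewrite -ler_norml => h; rewrite (_ : y = x + (y - x)); last by ring.
  by apply: le_trans (ler_normD _ _) _; lra.
have YB y k : `|y - x| < 1 -> mnorm (Y y - picard k y) <= 4 * c * B * 2^-1 ^+ k.
  by move=> /dom hy; apply: HY => // k'; exact: HB.
have p0 k : 0 <= 4 * c * B * 2^-1 ^+ k by rewrite !mulr_ge0// exprn_ge0// invr_ge0.
have eps0 e : 0 < e -> exists k, eps k <= e.
  by move=> e0; apply: half_pow_small => //; rewrite !mulr_ge0//; lra.
have e1 k y : `|y - x| < 1 -> mnorm (Y y - picard k.+1 y) <= eps k.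
  move=> hy; apply: le_trans (YB y k.+1 hy) _; rewrite exprS /eps -[leRHS]mulrA.
  have Kp : 0 <= K * (4 * c * B * 2^-1 ^+ k) by rewrite mulr_ge0.
  have := p0 k; move: Kp; lra.
have e2 k y : `|y - x| < 1 -> mnorm (P y *m Y y - P y *m picard k y) <= eps k.
  move=> hy; rewrite -mulmxBr; apply: le_trans (mnormM _ _) _.
  rewrite /eps -[leRHS]mulrA; apply: ler_pM; rewrite ?mnorm_ge0 ?YB//.
  by apply: le_trans (HK y (dom y hy)) _; lra.
have cPk k := ctsmM cP (picard_cts k).
have ent (A A' : 'M[C]_n) i j e : mnorm (A - A') <= e ->
   `|complex.Re (A i j) - complex.Re (A' i j)| <= e /\ `|complex.Im (A i j) - complex.Im (A' i j)| <= e.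
  by have [h1 h2] := mnorm_entryB A A' i j => h; split; [exact: le_trans h1 h|exact: le_trans h2 h].
move=> i j; split.
  apply: (@is_derive_uniform_limit (fun k => reE (picard k.+1) i j) (fun k => reE (fun y => P y *m picard k y) i j)
    (reE Y i j) (reE (fun y => P y *m Y y) i j) eps x 1 ltr01 _ _ _ _ eps0).
  - by move=> k y; exact: (picard_derive k y i j).1.
  - by move=> k; exact: (cPk k i j).1.
  - by move=> k y hy; exact: (ent _ _ i j _ (e1 k y hy)).1.
  - by move=> k y hy; exact: (ent _ _ i j _ (e2 k y hy)).1.
apply: (@is_derive_uniform_limit (fun k => imE (picard k.+1) i j) (fun k => imE (fun y => P y *m picard k y) i j)
  (imE Y i j) (imE (fun y => P y *m Y y) i j) eps x 1 ltr01 _ _ _ _ eps0).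
- by move=> k y; exact: (picard_derive k y i j).2.
- by move=> k; exact: (cPk k i j).2.
- by move=> k y hy; exact: (ent _ _ i j _ (e1 k y hy)).2.
- by move=> k y hy; exact: (ent _ _ i j _ (e2 k y hy)).2.
Qed.

End Picard.
End LinearODE.

(* Closes identities between sums of fully expanded matrix monomials. *)
Ltac mx_abel :=
  repeat (match goal with |- context [@mulmx ?S ?m ?n ?p ?A ?B] => let Z := fresh "Z" in set Z := (@mulmx S m n p A B); move: Z => Z end);
  apply/matrixP => ? ?; rewrite !mxE; ring.

(** * Unitary frames of a flat connection on the (x, t)-plane *)

Section FlatFrame.
Context {R : realType}.
Local Notation C := (R[i]).

Lemma Re_subE p q (A B : 'M[C]_(p, q)) i j :
  complex.Re ((A - B) i j) = complex.Re (A i j) - complex.Re (B i j).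
Proof. by rewrite !mxE complexReD complexReN. Qed.

Lemma Im_subE p q (A B : 'M[C]_(p, q)) i j :
  complex.Im ((A - B) i j) = complex.Im (A i j) - complex.Im (B i j).
Proof. by rewrite !mxE complexImD complexImN. Qed.

Lemma mnormM_le p q r (A : 'M[C]_(p, q)) (B : 'M[C]_(q, r)) a b :
  mnorm A <= a -> mnorm B <= b -> mnorm (A *m B) <= a * b.
Proof.
by move=> Aa Bb; apply: le_trans (mnormM _ _) _; apply: ler_pM => //; exact: mnorm_ge0.
Qed.

(** Trades an L^1 norm over a long window for an L^2 norm, at a small cost d per unit length. *)
Lemma le_sqr_div (z d : R) : 0 < d -> z <= d + d^-1 * z ^+ 2.
Proof.
move=> d0; rewrite -subr_ge0.
have -> : d + d^-1 * z ^+ 2 - z = d^-1 * ((z - d / 2) ^+ 2 + 3 / 4 * d ^+ 2) by field; rewrite gt_eqF.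
apply: mulr_ge0; first by rewrite invr_ge0 ltW.
by apply: addr_ge0; [exact: sqr_ge0|apply: mulr_ge0; [lra|exact: sqr_ge0]].
Qed.

Lemma mul_divD1_le (c e : R) : 0 <= c -> 0 <= e -> c * (e / (c + 1)) <= e.
Proof.
move=> c0 e0; have c1 : 0 < c + 1 by lra.
by rewrite mulrCA; apply: ler_piMr => //; rewrite ler_pdivrMr// mul1r lerDl.
Qed.

Definition rscale {p q} (r : R) (A : 'M[C]_(p, q)) : 'M[C]_(p, q) := (r%:C)%C *: A.

Lemma Re_rscale p q r (A : 'M[C]_(p, q)) i j : complex.Re (rscale r A i j) = r * complex.Re (A i j).
Proof. by rewrite mxE complexReM /= mul0r subr0. Qed.

Lemma Im_rscale p q r (A : 'M[C]_(p, q)) i j : complex.Im (rscale r A i j) = r * complex.Im (A i j).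
Proof. by rewrite mxE complexImM /= mul0r addr0. Qed.

Lemma rscaleD p q r r' (A : 'M[C]_(p, q)) : rscale (r + r') A = rscale r A + rscale r' A.
Proof. by rewrite /rscale rmorphD scalerDl. Qed.

Lemma rscale_mulmxr p q m r (A : 'M[C]_(p, q)) (B : 'M[C]_(q, m)) : rscale r A *m B = rscale r (A *m B).
Proof. by rewrite -scalemxAl. Qed.

Lemma rscale_mulmxl p q m r (A : 'M[C]_(p, q)) (B : 'M[C]_(q, m)) : A *m rscale r B = rscale r (A *m B).
Proof. by rewrite -scalemxAr. Qed.

Lemma mnorm_rscale p q r (A : 'M[C]_(p, q)) : mnorm (rscale r A) = `|r| * mnorm A.
Proof.
rewrite /mnorm mulr_sumr; apply: eq_bigr => i _; rewrite mulr_sumr; apply: eq_bigr => j _.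
by rewrite Re_rscale Im_rscale !normrM mulrDr.
Qed.

Lemma is_mderive_rscale p q (f : R -> 'M[C]_(p, q)) r x d :
  is_mderive f x d -> is_mderive (fun y => rscale r (f y)) x (rscale r d).
Proof.
move=> df i j; have [h1 h2] := df i j; rewrite Re_rscale Im_rscale; split.
  rewrite (_ : reE _ i j = fun y => r * reE f i j y); first exact: is_derive_funZ.
  by apply/funext => y; rewrite /reE Re_rscale.
rewrite (_ : imE _ i j = fun y => r * imE f i j y); first exact: is_derive_funZ.
by apply/funext => y; rewrite /imE Im_rscale.
Qed.

Lemma mnorm_le_entries p q (A : 'M[C]_(p, q)) e :
  (forall i j, `|complex.Re (A i j)| <= e /\ `|complex.Im (A i j)| <= e) ->
  mnorm A <= (2 * (p * q)%:R) * e.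
Proof.
move=> H; apply: le_trans (_ : \sum_(i < p) \sum_(j < q) (2 * e) <= _).
  by apply: ler_sum => i _; apply: ler_sum => j _; have [h1 h2] := H i j; lra.
rewrite !sumr_const !card_ord -mulrnA mulnC -[leLHS]mulr_natr; apply: le_of_eq; ring.
Qed.

Lemma mnorm_increment p q (f f' : R -> 'M[C]_(p, q)) a b M :
  (forall y, is_mderive f y (f' y)) -> (forall y, `|y - a| <= `|b - a| -> mnorm (f' y) <= M) ->
  mnorm (f b - f a) <= (2 * (p * q)%:R) * (M * `|b - a|).
Proof.
move=> df bd; apply: mnorm_le_entries => i j; rewrite !mxE complexReD complexReN complexImD complexImN.
split.
  have := @is_derive_increment R (reE f i j) (reE f' i j) a b 0 M (fun y => (df y i j).1).
  rewrite mulr0 subr0; apply => y hy; rewrite subr0; apply: le_trans (bd y hy).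
  by apply: le_trans (mnorm_entry _ i j); rewrite lerDl.
have := @is_derive_increment R (imE f i j) (imE f' i j) a b 0 M (fun y => (df y i j).2).
rewrite mulr0 subr0; apply => y hy; rewrite subr0; apply: le_trans (bd y hy).
by apply: le_trans (mnorm_entry _ i j); rewrite lerDr.
Qed.

Lemma finite_radius (I : finType) (Q : I -> R -> Prop) :
  (forall i, exists2 d, 0 < d & Q i d) -> (forall i d d', 0 < d' -> d' <= d -> Q i d -> Q i d') ->
  exists2 d, 0 < d & forall i, Q i d.
Proof.
move=> ex mono; have [f Hf] := choice (fun i => let: ex_intro2 d d0 Qd := ex i in ex_intro (fun d => 0 < d /\ Q i d) d (conj d0 Qd)).
have [d d0 Hd] : exists2 d, 0 < d & forall i, i \in enum I -> d <= f i.
  elim: (enum I) => [|i s [d d0 Hd]]; first by exists 1.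
  exists (Num.min (f i) d); first by rewrite lt_min (Hf i).1.
  move=> j; rewrite inE => /orP[/eqP->|js]; first by rewrite ge_min lexx.
  by rewrite ge_min Hd// orbT.
by exists d => // i; apply: (mono i (f i) d d0 _ (Hf i).2); apply: Hd; rewrite mem_enum.
Qed.

Lemma mjcontinuous_uniform p q (F : R -> R -> 'M[C]_(p, q)) a b t e : mjcontinuous F -> 0 < e ->
  exists2 d, 0 < d & forall x t', a <= x <= b -> `|t' - t| < d -> mnorm (F x t' - F x t) <= e.
Proof.
move=> cF e0.
have c0 : 0 < 2 * (p * q)%:R + 1 :> R by rewrite ltr_pwDr// mulr_ge0.
have e1 : 0 < e / (2 * (p * q)%:R + 1) by rewrite divr_gt0.
have [d d0 Hd] : exists2 d, 0 < d & forall ij : 'I_p * 'I_q, forall x t', a <= x <= b -> `|t' - t| < d ->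
   `|complex.Re (F x t' ij.1 ij.2) - complex.Re (F x t ij.1 ij.2)| <= e / (2 * (p * q)%:R + 1) /\
   `|complex.Im (F x t' ij.1 ij.2) - complex.Im (F x t ij.1 ij.2)| <= e / (2 * (p * q)%:R + 1).
  apply: finite_radius => [[i j]|ij d d' d'0 dd H x t' hx ht]; last by apply: H => //; exact: lt_le_trans dd.
  have [c1 c2] := cF i j.
  have [d1 d10 H1] := jcontinuous_uniform a b t c1 e1.
  have [d2 d20 H2] := jcontinuous_uniform a b t c2 e1.
  exists (Num.min d1 d2); first by rewrite lt_min d10.
  by move=> x t' hx; rewrite lt_min => /andP[h1 h2]; split; apply/ltW; [exact: H1|exact: H2].
exists d => // x t' hx ht; apply: le_trans (mnorm_le_entries (e := e / (2 * (p * q)%:R + 1)) _) _.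
  move=> i j; rewrite !mxE complexReD complexReN complexImD complexImN; exact: (Hd (i, j)).
by apply: mul_divD1_le; [rewrite mulr_ge0|exact: ltW].
Qed.

Lemma mjcontinuous_bounded p q (F : R -> R -> 'M[C]_(p, q)) a b c d : mjcontinuous F ->
  exists2 K, 0 <= K & forall x t, a <= x <= b -> c <= t <= d -> mnorm (F x t) <= K.
Proof.
move=> cF.
have H (ij : 'I_p * 'I_q) : exists K, forall x t, a <= x <= b -> c <= t <= d ->
    `|complex.Re (F x t ij.1 ij.2)| + `|complex.Im (F x t ij.1 ij.2)| <= K.
  have [c1 c2] := cF ij.1 ij.2.
  have [K1 _ H1] := jcontinuous_bounded a b c d c1; have [K2 _ H2] := jcontinuous_bounded a b c d c2.
  by exists (K1 + K2) => x t hx ht; rewrite lerD ?H1 ?H2.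
have [K HK] := choice H.
exists `|\sum_i \sum_j K (i, j)| => // x t hx ht; apply: le_trans (ler_norm _).
by apply: ler_sum => i _; apply: ler_sum => j _; exact: (HK (i, j)).
Qed.

Lemma is_mderive_approxP p q (f : R -> 'M[C]_(p, q)) x d :
  (forall e, 0 < e -> exists2 del, 0 < del &
    forall h, `|h| < del -> mnorm (f (x + h) - f x - rscale h d) <= e * `|h|) -> is_mderive f x d.
Proof.
move=> H i j; split; apply/is_derive_approxP => e e0; have [del del0 Hd] := H e e0;
  exists del => // h hh; apply: le_trans (Hd h hh); apply: le_trans (mnorm_entry _ i j).
  by rewrite !Re_subE Re_rscale lerDl.
by rewrite !Im_subE Im_rscale lerDr.
Qed.

Lemma is_mderive_uniform p q (F F' : R -> R -> 'M[C]_(p, q)) a b t e :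
  (forall x t, is_mderive (F x) t (F' x t)) -> mjcontinuous F' -> 0 < e ->
  exists2 del, 0 < del & forall x h, a <= x <= b -> `|h| < del ->
    mnorm (F x (t + h) - F x t - rscale h (F' x t)) <= e * `|h|.
Proof.
move=> dF cF' e0.
have c0 : 0 < 2 * (p * q)%:R + 1 :> R by rewrite ltr_pwDr// mulr_ge0.
have e1 : 0 < e / (2 * (p * q)%:R + 1) by rewrite divr_gt0.
have [d d0 Hd] := mjcontinuous_uniform a b t cF' e1.
exists d => // x h hx hh.
have dg s : is_mderive (fun s => F x s - rscale s (F' x t)) s (F' x s - F' x t).
  apply: is_mderiveB; first exact: dF.
  move=> i j; split.
    rewrite (_ : reE _ i j = fun s => complex.Re (F' x t i j) * s); first exact: is_derive_linear.
    by apply/funext => y; rewrite /reE Re_rscale mulrC.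
  rewrite (_ : imE _ i j = fun s => complex.Im (F' x t i j) * s); first exact: is_derive_linear.
  by apply/funext => y; rewrite /imE Im_rscale mulrC.
have := @mnorm_increment _ _ _ _ t (t + h) (e / (2 * (p * q)%:R + 1)) dg.
rewrite (_ : t + h - t = h); last by ring.
have -> : F x (t + h) - rscale (t + h) (F' x t) - (F x t - rscale t (F' x t)) = F x (t + h) - F x t - rscale h (F' x t).
  rewrite rscaleD; move: (F x (t + h)) (F x t) (rscale t _) (rscale h _) => A B D E.
  by apply/matrixP => i j; rewrite !mxE; ring.
move=> H; apply: le_trans (H _) _ => [y hy|].
  by apply: Hd => //; exact: le_lt_trans hh.
by rewrite mulrA ler_wpM2r//; apply: mul_divD1_le; [rewrite mulr_ge0|exact: ltW].
Qed.

(** [ip g g] is the trace n of the identity, and m <= m^2 + 1 removes the square from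
    [mnorm_sqr_le_ip]. *)
Lemma mnorm_unitary_le n (g : 'M[C]_n) : unitary g -> mnorm g <= 4 * (n * n)%:R ^+ 2 * n%:R + 1.
Proof.
move=> ug; have h := mnorm_sqr_le_ip g.
have e : ip g g = n%:R.
  rewrite ip_trace ug mxtrace1; elim: (n) => [|k IH]; first by rewrite mulr0n.
  by rewrite -natr1 -[in RHS]natr1 complexReD IH.
rewrite e in h.
have := mnorm_ge0 g; move: (mnorm g) h => m h m0.
have : 0 <= (m - 1) * (m - 1) by rewrite -expr2 sqr_ge0.
by move: h; rewrite exprMn expr2; lra.
Qed.

Lemma jcontinuous_of_t (f : R -> R) : continuous f -> jcontinuous (fun _ t => f t).
Proof. by move=> cf z; apply: (@continuous_comp _ _ _ snd f); [exact: cvg_snd|exact: cf]. Qed.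

Section Frame.
Variables (n : nat) (P N Nx Pt : R -> R -> 'M[C]_n).
Hypotheses (cP : mjcontinuous P) (cN : mjcontinuous N) (cPt : mjcontinuous Pt).
Hypotheses (P_skew : forall x t, adj (P x t) = - P x t) (N_skew : forall x t, adj (N x t) = - N x t).
Hypotheses (dN : forall x t, is_mderive (fun y => N y t) x (Nx x t))
  (dP : forall x t, is_mderive (P x) t (Pt x t)).
Hypothesis flat : forall x t, Pt x t = Nx x t + (N x t *m P x t - P x t *m N x t).

Lemma frame_error (a q F g g' : 'M[C]_n) h :
  a *m ((q - rscale h F) *m g' + rscale h F *m (g' - g)) = a *m q *m g' - rscale h (a *m F *m g).
Proof.
rewrite mulmxBl mulmxBr addrA subrK mulmxBr !rscale_mulmxr rscale_mulmxl.
by rewrite !mulmxA.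
Qed.

Lemma unitary_ode (A Y : R -> 'M[C]_n) : (forall x, adj (A x) = - A x) -> unitary (Y 0) ->
  (forall x, is_mderive Y x (A x *m Y x)) -> forall x, unitary (Y x).
Proof.
move=> skA u0 dY x; apply: mulmx1C.
have d y : is_mderive (fun y => adj (Y y) *m Y y) y 0.
  have := is_mderiveM (is_mderive_adj (dY y)) (dY y).
  by rewrite adjM skA mulmxN mulNmx mulmxA addNr.
by rewrite (is_mderive0_cst d x 0); exact: unitaryV.
Qed.

(** The frame is g0 transported in t along x = 0, then in x at fixed t. By flatness the pullback by
    G of G_t - N G would have zero x-derivative; as G_t is not yet known to exist, increments in t
    are estimated in its place. *)
Lemma flat_frame (g0 : 'M[C]_n) : unitary g0 ->
  exists G : R -> R -> 'M[C]_n, [/\ G 0 0 = g0, forall x t, unitary (G x t),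
    forall x t, is_mderive (fun y => G y t) x (P x t *m G x t),
    forall x t, is_mderive (G x) t (N x t *m G x t) & mjcontinuous G].
Proof.
move=> ug0.
have [H [H0 dH]] : exists H : R -> 'M[C]_n, H 0 = 1%:M /\ forall t, is_mderive H t (N 0 t *m H t).
  apply: linear_ode => i j; split; [exact: (@jcontinuous_t _ _ 0 (cN i j).1)|exact: (@jcontinuous_t _ _ 0 (cN i j).2)].
have /choice[F HF] t : exists Y : R -> 'M[C]_n, Y 0 = 1%:M /\ forall x, is_mderive Y x (P x t *m Y x).
  apply: linear_ode => i j; split; [exact: (@jcontinuous_x _ _ t (cP i j).1)|exact: (@jcontinuous_x _ _ t (cP i j).2)].
pose G x t := F t x *m (H t *m g0).
have uH t : unitary (H t).
  by apply: (@unitary_ode (N 0) H) => //; rewrite H0; exact: unitary1.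
have uG x t : unitary (G x t).
  apply: unitaryM; last exact: unitaryM.
  by apply: (@unitary_ode (fun x => P x t) (F t)) => [y||]; [exact: P_skew|rewrite (HF t).1; exact: unitary1|exact: (HF t).2].
have G0 t : G 0 t = H t *m g0 by rewrite /G (HF t).1 mul1mx.
have dGx x t : is_mderive (fun y => G y t) x (P x t *m G x t).
  by rewrite /G mulmxA; apply: is_mderiveMr; exact: (HF t).2.
have dG0 t : is_mderive (G 0) t (N 0 t *m G 0 t).
  apply: (@eq_is_mderive _ _ _ (fun t => H t *m g0)); first by move=> s; rewrite G0.
  by rewrite G0 mulmxA; exact: is_mderiveMr.
pose gb : R := 4 * (n * n)%:R ^+ 2 * n%:R + 1.
have gb0 : 0 <= gb by rewrite addr_ge0// !mulr_ge0// exprn_ge0.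
have gle x t : mnorm (G x t) <= gb by exact: mnorm_unitary_le.
have gle' x t : mnorm (adj (G x t)) <= gb by rewrite mnorm_adj.
have dGadj x t : is_mderive (fun y => adj (G y t)) x (- (adj (G x t) *m P x t)).
  by have := is_mderive_adj (dGx x t); rewrite adjM P_skew mulmxN.
(* Both frames solve the same equation up to the change of P, so G(.,t)^* G(.,t') is nearly constant. *)
have cc0 : 0 <= 2 * (n * n)%:R :> R by rewrite mulr_ge0.
have cG0 : mjcontinuous (fun _ : R => G 0).
  by move=> i j; split; apply: jcontinuous_of_t => t; [exact: (is_derive_continuous (dG0 t i j).1)|exact: (is_derive_continuous (dG0 t i j).2)].
have GG x t : adj (G x t) *m G x t = 1%:M by exact: unitaryV.
have GG' x t : G x t *m adj (G x t) = 1%:M by exact: uG.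
have cont X t e : 0 <= X -> 0 < e -> exists2 d, 0 < d & forall x h, - X <= x <= X -> `|h| < d ->
    mnorm (G x (t + h) - G x t) <= e.
  move=> X0 e0.
  pose S := gb * (2 * (n * n)%:R * (gb * gb) * X + gb).
  have S0 : 0 <= S by rewrite !mulr_ge0// addr_ge0// !mulr_ge0.
  have [eta eta0 Seta] : exists2 eta, 0 < eta & S * eta <= e.
    by exists (e / (S + 1)); [rewrite divr_gt0//; lra|apply: mul_divD1_le => //; exact: ltW].
  have [d1 d10 H1] := mjcontinuous_uniform (- X) X t cP eta0.
  have [d2 d20 H2] := mjcontinuous_uniform 0 0 t cG0 eta0.
  exists (Num.min d1 d2); first by rewrite lt_min d10.
  move=> x h hx; rewrite lt_min => /andP[h1 h2].
  have th : t + h - t = h by ring.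
  pose W y := adj (G y t) *m G y (t + h).
  have dW y : is_mderive W y (adj (G y t) *m (P y (t + h) - P y t) *m G y (t + h)).
    have := is_mderiveM (dGadj y t) (dGx y (t + h)).
    by rewrite mulNmx mulmxA [- _ + _]addrC -mulmxBl -mulmxBr.
  have W0 : mnorm (W 0 - 1%:M) <= gb * eta.
    rewrite -(GG 0 t) /W -mulmxBr; apply: mnormM_le => //.
    by apply: (H2 0); rewrite ?lexx ?th.
  have Wx : mnorm (W x - W 0) <= 2 * (n * n)%:R * (gb * eta * gb * X).
    apply: le_trans (mnorm_increment (M := gb * eta * gb) dW _) _.
      move=> y; rewrite subr0 => hy; rewrite subr0 in hy.
      apply: mnormM_le => //; apply: mnormM_le => //.
      apply: H1; last by rewrite th.
      by rewrite -ler_norml; apply: le_trans hy _; rewrite ler_norml.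
    rewrite subr0; apply: ler_wpM2l => //; apply: ler_wpM2l; last by rewrite ler_norml.
    by have eta1 := ltW eta0; rewrite !mulr_ge0.
  have -> : G x (t + h) - G x t = G x t *m ((W x - W 0) + (W 0 - 1%:M)).
    by rewrite addrA subrK mulmxBr mulmx1 /W mulmxA GG' mul1mx.
  apply: le_trans (_ : gb * (2 * (n * n)%:R * (gb * eta * gb * X) + gb * eta) <= _).
    by apply: mnormM_le => //; apply: le_trans (mnormD _ _) _; exact: lerD.
  by apply: le_trans Seta; apply: le_of_eq; rewrite /S; ring.
have deriv x t : is_mderive (G x) t (N x t *m G x t).
  apply: is_mderive_approxP => e e0.
  have X0 : 0 <= `|x| by [].
  have [kP kP0 HkP] := mjcontinuous_bounded (- `|x|) `|x| t t cPt.
  pose S := gb * (2 * (n * n)%:R * (gb * (gb + kP)) * `|x| + gb).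
  have S0 : 0 <= S by rewrite !mulr_ge0// addr_ge0// !mulr_ge0// addr_ge0.
  have [eta eta0 Seta] : exists2 eta, 0 < eta & S * eta <= e.
    by exists (e / (S + 1)); [rewrite divr_gt0//; lra|apply: mul_divD1_le => //; exact: ltW].
  have [d1 d10 H1] := is_mderive_uniform (- `|x|) `|x| t dP cPt eta0.
  have cNG0 : mjcontinuous (fun (_ : R) t => N 0 t *m G 0 t).
    apply: mjcontinuousM => //; move=> i j; split; apply: jcontinuous_of_t.
      exact: (@jcontinuous_t _ _ 0 (cN i j).1).
    exact: (@jcontinuous_t _ _ 0 (cN i j).2).
  have [d2 d20 H2] := is_mderive_uniform (F := fun _ : R => G 0) 0 0 t (fun _ t => dG0 t) cNG0 eta0.
  have [d3 d30 H3] := cont `|x| t eta X0 eta0.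
  exists (Num.min (Num.min d1 d2) d3); first by rewrite !lt_min d10 d20.
  move=> h; rewrite !lt_min => /andP[/andP[h1 h2] h3].
  (* The first-order error in t, pulled back by [adj G]. Flatness reduces its x-derivative to the
     Taylor remainder of P and to h P_t times an increment of G, both o(h) uniformly over |y| <=
     |x|. *)
  pose E y := adj (G y t) *m (G y (t + h) - G y t) - rscale h (adj (G y t) *m N y t *m G y t).
  pose E' y := adj (G y t) *m ((P y (t + h) - P y t - rscale h (Pt y t)) *m G y (t + h)
      + rscale h (Pt y t) *m (G y (t + h) - G y t)).
  have dE y : is_mderive E y (E' y).
    have D1 := is_mderiveM (dGadj y t) (is_mderiveB (dGx y (t + h)) (dGx y t)).
    have D2 := is_mderiveM (is_mderiveM (dGadj y t) (dN y t)) (dGx y t).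
    have := is_mderiveB D1 (is_mderive_rscale h D2).
    set d := (X in is_mderive _ _ X -> _); suff -> : d = E' y by [].
    rewrite /d /E' flat; move: (P y (t + h)) (G y (t + h)) => p' g'.
    rewrite frame_error; congr (_ - rscale h _).
      by rewrite !(mulmxBl, mulmxBr, mulNmx, mulmxA); mx_abel.
    by rewrite !(mulmxBl, mulmxBr, mulmxDl, mulmxDr, mulNmx, mulmxN, mulmxA); mx_abel.
  have E0 : mnorm (E 0) <= gb * (eta * `|h|).
    have -> : E 0 = adj (G 0 t) *m (G 0 (t + h) - G 0 t - rscale h (N 0 t *m G 0 t)).
      by rewrite mulmxBr rscale_mulmxl mulmxA.
    apply: mnormM_le => //.
    by apply: (H2 0); rewrite ?lexx.
  have Ex : mnorm (E x - E 0) <= 2 * (n * n)%:R * (gb * (eta * `|h| * gb + `|h| * kP * eta) * `|x|).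
    apply: le_trans (mnorm_increment (M := gb * (eta * `|h| * gb + `|h| * kP * eta)) dE _) _; last by rewrite subr0.
    move=> y hy; rewrite !subr0 in hy.
    have hy' : - `|x| <= y <= `|x| by rewrite -ler_norml.
    apply: mnormM_le => //; apply: le_trans (mnormD _ _) _; apply: lerD.
      by apply: mnormM_le => //; exact: H1.
    apply: mnormM_le; last exact: H3.
    by rewrite mnorm_rscale ler_wpM2l// HkP ?lexx.
  have -> : G x (t + h) - G x t - rscale h (N x t *m G x t) = G x t *m ((E x - E 0) + E 0).
    by rewrite subrK /E mulmxBr rscale_mulmxl !mulmxA GG' !mul1mx.
  apply: le_trans (_ : gb * (2 * (n * n)%:R * (gb * (eta * `|h| * gb + `|h| * kP * eta) * `|x|) + gb * (eta * `|h|)) <= _).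
    by apply: mnormM_le => //; apply: le_trans (mnormD _ _) _; exact: lerD.
  apply: le_trans (_ : S * eta * `|h| <= _); first by apply: le_of_eq; rewrite /S; ring.
  exact: ler_wpM2r.
exists G; split => //; first by rewrite G0 H0 mul1mx.
move=> i j.
have bd x t : exists K r, 0 < r /\ forall x' t', `|x' - x| < r -> `|t' - t| < r -> mnorm (P x' t' *m G x' t') <= K.
  have [K K0 HK] := mjcontinuous_bounded (x - 1) (x + 1) (t - 1) (t + 1) cP.
  exists (K * gb), 1; split=> // x' t'; rewrite !ltr_norml => /andP[a1 a2] /andP[b1 b2].
  apply: mnormM_le => //.
  by apply: HK; apply/andP; split; lra.
split.
  apply: (jcontinuous_of_partial (fun x t => (dGx x t i j).1)).
    by move=> x t; exact: (is_derive_continuous (deriv x t i j).1).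
  move=> x t; have [K [r [r0 H']]] := bd x t; exists K, r; split => // x' t' hx ht.
  by apply: le_trans (H' x' t' hx ht); apply: le_trans (mnorm_entry _ i j); rewrite lerDl.
apply: (jcontinuous_of_partial (fun x t => (dGx x t i j).2)).
  by move=> x t; exact: (is_derive_continuous (deriv x t i j).2).
move=> x t; have [K [r [r0 H']]] := bd x t; exists K, r; split => // x' t' hx ht.
by apply: le_trans (H' x' t' hx ht); apply: le_trans (mnorm_entry _ i j); rewrite lerDr.
Qed.

End Frame.
End FlatFrame.

(** * The base point a, the complex structure s = 2 a, and the orbit of a *)

Section BasePoint.
Context {R : realType} (k m : nat).
Local Notation C := (R[i]).
Local Notation M := 'M[C]_(k + m).
Local Notation a := (@base_a R k m).
Definition cstruct : M := a + a.
Local Notation s := cstruct.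

Lemma cstructE : s = block_mx ('i%:M) 0 0 (- 'i%:M).
Proof.
rewrite /cstruct /base_a add_block_mx !addr0 -opprD -!raddfD /=.
by rewrite (_ : 'i / 2 + 'i / 2 = 'i :> C)//; field.
Qed.

Lemma adj_block p1 p2 q1 q2 (A : 'M[C]_(p1, q1)) (B : 'M[C]_(p1, q2)) (A' : 'M[C]_(p2, q1)) (B' : 'M[C]_(p2, q2)) :
  adj (block_mx A B A' B') = block_mx (adj A) (adj A') (adj B) (adj B').
Proof. by rewrite /adj map_block_mx tr_block_mx. Qed.

Lemma adj0 p q : adj (0 : 'M[C]_(p, q)) = 0.
Proof. by apply/matrixP => i j; rewrite !mxE rmorph0. Qed.

Lemma adj_scalar p (z : C) : adj (z%:M : 'M[C]_p) = (Num.conj z)%:M.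
Proof. by apply/matrixP => i j; rewrite !mxE eq_sym rmorphMn. Qed.

Lemma adj_a : adj a = - a.
Proof.
rewrite /base_a adj_block !adj0 adjN !adj_scalar opp_block_mx !oppr0.
have -> : Num.conj ('i / 2 : C) = - ('i / 2) by rewrite rmorphM /= conjCi fmorphV /= rmorph_nat mulNr.
by rewrite !raddfN.
Qed.

Lemma ss : s *m s = - 1%:M.
Proof.
rewrite cstructE mulmx_block !(mulmx0, mul0mx, addr0, add0r, mulNmx, mulmxN, opprK) -!scalar_mxM.
by rewrite -expr2 sqrCi [in RHS]scalar_mx_block opp_block_mx !oppr0 !raddfN.
Qed.

Lemma orbitP (A : M) : Defs.in_orbit A -> exists2 g, unitary g & A = g *m a *m adj g.
Proof. by move=> [g [ug ->]]; exists g => //; rewrite unitary_invmx. Qed.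

Lemma orbit_skew (A : M) : Defs.in_orbit A -> adj A = - A.
Proof. by move=> /orbitP[g ug ->]; rewrite !adjM adjK adj_a !mulNmx !mulmxN mulmxA. Qed.

Lemma orbit_sqr (A : M) : Defs.in_orbit A -> (A + A) *m (A + A) = - 1%:M.
Proof.
move=> /orbitP[g ug ->]; rewrite -mulmxDl -mulmxDr -/s.
rewrite -!mulmxA (mulmxA (adj g)) unitaryV// mul1mx (mulmxA s) ss mulNmx mul1mx mulmxN.
by rewrite ug.
Qed.

(** Anticommuting with diag(i, -i) kills the diagonal blocks, and skewness ties the other two
    together. The block-free form is the one that frame computations produce. *)
Lemma in_perpP (A : M) : in_perp A <-> adj A = - A /\ s *m A = - (A *m s).
Proof.
split.
  move=> [q ->]; split.
    by rewrite adj_block !adj0 adjN adjK opp_block_mx !oppr0 opprK.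
  rewrite cstructE !mulmx_block !(mulmx0, mul0mx, addr0, add0r, mulNmx, mulmxN, opprK).
  by rewrite opp_block_mx !oppr0 !opprK !mul_scalar_mx !mul_mx_scalar.
move=> [skA sA]; move: skA sA; rewrite -[A]submxK.
move: (ulsubmx A) (ursubmx A) (dlsubmx A) (drsubmx A) => B q q' D.
rewrite adj_block opp_block_mx => /eq_block_mx[_ e1 _ _].
rewrite cstructE !mulmx_block !(mulmx0, mul0mx, addr0, add0r, mulNmx, mulmxN, opprK) opp_block_mx !opprK.
rewrite !mul_scalar_mx !mul_mx_scalar => /eq_block_mx[h1 _ _ h2].
have z p q0 (E : 'M[C]_(p, q0)) : 'i *: E = - ('i *: E) -> E = 0.
  move/eqP; rewrite -addr_eq0 -scalerDr scaler_eq0 (negbTE (neq0Ci _)) /= => h.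
  apply/matrixP => i j; have /eqP/matrixP/(_ i j) := h; rewrite !mxE => /eqP.
  by rewrite -mulr2n mulrn_eq0 /= => /eqP.
exists q; rewrite (z _ _ B h1) (z _ _ D (esym h2)).
by congr block_mx; rewrite -[q']adjK e1 adjN.
Qed.

End BasePoint.

(** * Limits of matrices at minus infinity *)

Section MatrixLimits.
Context {R : realType}.
Local Notation C := (R[i]).

Lemma cvg_bigsum (I : Type) (r : seq I) (F : I -> R -> R) (l : I -> R) :
  (forall i, F i x @[x --> -oo] --> l i) ->
  \sum_(i <- r) F i x @[x --> -oo] --> \sum_(i <- r) l i.
Proof.
move=> cF; elim: r => [|i r IH].
  rewrite big_nil (_ : (fun x => _) = fun=> 0); first exact: cvg_cst.
  by apply/funext => x; rewrite big_nil.
rewrite big_cons (_ : (fun x => _) = fun x => F i x + \sum_(i <- r) F i x); first exact: cvgD.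
by apply/funext => x; rewrite big_cons.
Qed.

Lemma mlim_minf_cst p q (A : 'M[C]_(p, q)) : mlim_minf (fun=> A) A.
Proof. by move=> i j; split; exact: cvg_cst. Qed.

Lemma mlim_minf_ext p q (f g : R -> 'M[C]_(p, q)) l : f =1 g -> mlim_minf f l -> mlim_minf g l.
Proof. by move=> /funext ->. Qed.

Lemma mlim_minfM p q r (f : R -> 'M[C]_(p, q)) (g : R -> 'M[C]_(q, r)) l l' :
  mlim_minf f l -> mlim_minf g l' -> mlim_minf (fun x => f x *m g x) (l *m l').
Proof.
move=> cf cg i j; rewrite !mxE complexRe_sum complexIm_sum; split.
  rewrite (_ : reE _ i j = fun x => \sum_k (reE f i k x * reE g k j x - imE f i k x * imE g k j x)).
    apply: cvg_bigsum => k; rewrite complexReM; have [f1 f2] := cf i k; have [g1 g2] := cg k j.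
    by apply: cvgB; exact: cvgM.
  by apply/funext => x; rewrite /reE mxE complexRe_sum; apply: eq_bigr => k _; rewrite complexReM.
rewrite (_ : imE _ i j = fun x => \sum_k (reE f i k x * imE g k j x + imE f i k x * reE g k j x)).
  apply: cvg_bigsum => k; rewrite complexImM; have [f1 f2] := cf i k; have [g1 g2] := cg k j.
  by apply: cvgD; exact: cvgM.
by apply/funext => x; rewrite /imE mxE complexIm_sum; apply: eq_bigr => k _; rewrite complexImM.
Qed.

Lemma mlim_minf_adj p q (f : R -> 'M[C]_(p, q)) l : mlim_minf f l -> mlim_minf (fun x => adj (f x)) (adj l).
Proof.
move=> cf i j; have [f1 f2] := cf j i; rewrite !mxE complexReJ complexImJ; split.
  by rewrite (_ : reE _ i j = reE f j i)//; apply/funext => x; rewrite /reE !mxE complexReJ.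
rewrite (_ : imE _ i j = fun x => - imE f j i x); first exact: cvgN.
by apply/funext => x; rewrite /imE !mxE complexImJ.
Qed.

Lemma mlim_minf_unique p q (f : R -> 'M[C]_(p, q)) l l' : mlim_minf f l -> mlim_minf f l' -> l = l'.
Proof.
move=> h h'; apply/matrixP => i j; have [a1 a2] := h i j; have [b1 b2] := h' i j.
by apply: complex_ext; [exact: (cvg_unique _ a1 b1)|exact: (cvg_unique _ a2 b2)].
Qed.

End MatrixLimits.

(** * Identities between S = 2 gamma, T = gamma_x, X = gamma_xx, V = gamma_t, P = S T and N = S (V +
    T^2) *)

Section FlowAlgebra.
Context {R : realType} (n : nat).
Local Notation M := 'M[R[i]]_n.

Lemma mx_double_inj (A B : M) : A + A = B + B -> A = B.
Proof.
move=> /matrixP AB; apply/matrixP => i j; have := AB i j; rewrite !mxE -!mulr2n => /eqP.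
by rewrite eqrMn2r => /eqP.
Qed.

Variables (S T X V : M).
Hypotheses (SS : S *m S = - 1%:M) (ST : S *m T = - (T *m S)) (SV : S *m V = - (V *m S)).
Hypothesis VE : V = S *m X + (T *m T + T *m T).

Let STS : S *m T *m S = T.
Proof. by rewrite ST mulNmx -mulmxA SS mulmxN opprK mulmx1. Qed.

Let SVS : S *m V *m S = V.
Proof. by rewrite SV mulNmx -mulmxA SS mulmxN opprK mulmx1. Qed.

Let STTS : S *m (T *m T) *m S = - (T *m T).
Proof. by rewrite mulmxA ST mulNmx -(mulmxA T S) ST mulmxN opprK -!mulmxA SS !mulmxN mulmx1. Qed.

Lemma flow_NP : (S *m (V + T *m T)) *m (S *m T) = (V - T *m T) *m T.
Proof. by rewrite mulmxA mulmxDr mulmxDl SVS STTS. Qed.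

Lemma flow_PN : (S *m T) *m (S *m (V + T *m T)) = T *m (V + T *m T).
Proof. by rewrite mulmxA STS. Qed.

(** Zero curvature P_t = N_x + [N, P] with the derivatives substituted: S_t = 2 V and T_t = V_x on
    the left, S_x = 2 T on the right. It reduces to S^2 = -1, the anticommutation of S with T and V,
    and V = S X + 2 T^2. *)
Lemma flow_flat (Vx : M) :
  (V + V) *m T + S *m Vx =
  (T + T) *m (V + T *m T) + S *m (Vx + (X *m T + T *m X)) +
  ((S *m (V + T *m T)) *m (S *m T) - (S *m T) *m (S *m (V + T *m T))).
Proof.
rewrite flow_NP flow_PN VE.
have TSX : T *m (S *m X) = - (S *m T *m X) by rewrite ST mulNmx opprK mulmxA.
rewrite !(mulmxDl, mulmxDr, mulNmx, mulmxN, mulmxBl, mulmxBr) TSX !mulmxA.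
by mx_abel.
Qed.

Lemma flow_P_skew : adj S = - S -> adj T = - T -> adj (S *m T) = - (S *m T).
Proof. by move=> aS aT; rewrite adjM aS aT mulNmx mulmxN opprK ST opprK. Qed.

Lemma flow_N_skew : adj S = - S -> adj T = - T -> adj V = - V ->
  adj (S *m (V + T *m T)) = - (S *m (V + T *m T)).
Proof.
move=> aS aT aV; have aTT : adj (T *m T) = T *m T by rewrite adjM aT mulNmx mulmxN opprK.
have STT : T *m T *m S = S *m (T *m T) by rewrite [RHS]mulmxA ST mulNmx -(mulmxA T S) ST mulmxN opprK mulmxA.
by rewrite adjM adjD aTT aS aV mulmxN mulmxDl mulNmx STT mulmxDr SV.
Qed.

Lemma flow_P_sqr : (S *m T) *m (S *m T) = T *m T.
Proof. by rewrite mulmxA STS. Qed.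

(** N_x in the form S (D V - 2 P^3), where D V = V_x + [V, P] is what conjugation by the frame turns
    into u_xx. Conjugated, it reads u_t = s (u_xx - 2 u^3). *)
Lemma flow_pde (Vx : M) :
  (T + T) *m (V + T *m T) + S *m (Vx + (X *m T + T *m X)) =
  S *m ((Vx + (V *m (S *m T) - (S *m T) *m V)) -
    ((S *m T) *m (S *m T) *m (S *m T) + (S *m T) *m (S *m T) *m (S *m T))).
Proof.
have SX : S *m X = V - (T *m T + T *m T) by rewrite VE addrK.
have SXT : S *m (X *m T) = V *m T - (T *m T *m T + T *m T *m T).
  by rewrite mulmxA SX mulmxBl mulmxDl.
have STX : S *m (T *m X) = - (T *m V) + (T *m T *m T + T *m T *m T).
  by rewrite mulmxA ST mulNmx -(mulmxA T S) SX mulmxBr mulmxDr !mulmxA opprB addrC.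
have SVP : S *m (V *m (S *m T)) = V *m T by rewrite !mulmxA SVS.
have SPV : S *m (S *m T *m V) = - (T *m V) by rewrite !mulmxA SS !mulNmx mul1mx.
have SPPP : S *m ((S *m T) *m (S *m T) *m (S *m T)) = - (T *m T *m T).
  by rewrite flow_P_sqr !mulmxA -(mulmxA S T) STTS mulNmx.
rewrite mulmxBr !mulmxDr SXT STX mulmxN SVP SPV SPPP !(mulmxDl, mulmxDr) !mulmxA.
by mx_abel.
Qed.

(** On matrices anticommuting with A, left multiplication by S inverts the bracket with A; thus S T
    and S V generate the rotations gamma_x and gamma_t. *)
Lemma flow_bracket_gam (A W : M) : S = A + A -> A *m W = - (W *m A) ->
  (S *m W) *m A - A *m (S *m W) = W.
Proof.
move=> SA AW; have WA : W *m A = - (A *m W) by rewrite AW opprK.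
have AS : A *m S = S *m A by rewrite SA mulmxDl mulmxDr.
have e : S *m W *m A = - (S *m A *m W) by rewrite -mulmxA WA mulmxN mulmxA.
by rewrite e mulmxA AS -opprD -mulmxDl -mulmxDr -SA SS mulNmx mul1mx opprK.
Qed.

End FlowAlgebra.

(** * The flow in a moving frame: zero curvature, the equation for u, decay, and the limit of the
    frame *)

Section Flow.
Context {R : realType} (n : nat).
Local Notation M := 'M[R[i]]_n.
Variables gam T X Y Z : R -> R -> M.
Hypotheses (dgam : forall x t, is_mderive (fun y => gam y t) x (T x t))
  (dT : forall x t, is_mderive (fun y => T y t) x (X x t))
  (dX : forall x t, is_mderive (fun y => X y t) x (Y x t))
  (dY : forall x t, is_mderive (fun y => Y y t) x (Z x t)).
Hypotheses (cgam : mjcontinuous gam) (cT : mjcontinuous T) (cX : mjcontinuous X)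
  (cY : mjcontinuous Y) (cZ : mjcontinuous Z).
Hypothesis gam_t : forall x t, is_mderive (gam x) t (comm (gam x t) (X x t)).
Hypotheses (gam_skew : forall x t, adj (gam x t) = - gam x t)
  (gam_sqr : forall x t, (gam x t + gam x t) *m (gam x t + gam x t) = - 1%:M).

(** In the names that follow a final x or t marks a derivative; [flowV] is gamma_t and [flowB] is
    the x-derivative of T^2. Everything is written through gamma and its x-derivatives T, X, Y,
    Z. *)
Definition flowS x t : M := gam x t + gam x t.
Definition flowV x t : M := flowS x t *m X x t + (T x t *m T x t + T x t *m T x t).
Definition flowB x t : M := X x t *m T x t + T x t *m X x t.
Definition flowVx x t : M := ((T x t + T x t) *m X x t + flowS x t *m Y x t) + (flowB x t + flowB x t).
Definition flowBx x t : M := (Y x t *m T x t + X x t *m X x t) + (X x t *m X x t + T x t *m Y x t).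
Definition flowVxx x t : M :=
  (((X x t + X x t) *m X x t + (T x t + T x t) *m Y x t) + ((T x t + T x t) *m Y x t + flowS x t *m Z x t)) +
  (flowBx x t + flowBx x t).
Definition flowW x t : M := flowV x t + T x t *m T x t.
Definition flowP x t : M := flowS x t *m T x t.
Definition flowN x t : M := flowS x t *m flowW x t.
Definition flowNx x t : M := (T x t + T x t) *m flowW x t + flowS x t *m (flowVx x t + flowB x t).
Definition flowNxx x t : M :=
  ((X x t + X x t) *m flowW x t + (T x t + T x t) *m (flowVx x t + flowB x t)) +
  ((T x t + T x t) *m (flowVx x t + flowB x t) + flowS x t *m (flowVxx x t + flowBx x t)).
Definition flowPt x t : M := (flowV x t + flowV x t) *m T x t + flowS x t *m flowVx x t.

Let dS x t : is_mderive (fun y => flowS y t) x (T x t + T x t).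
Proof. exact: is_mderiveD. Qed.

Let dB x t : is_mderive (fun y => flowB y t) x (flowBx x t).
Proof. by apply: is_mderiveD; exact: is_mderiveM. Qed.

Let dTT x t : is_mderive (fun y => T y t *m T y t) x (flowB x t).
Proof. exact: is_mderiveM. Qed.

Let dV x t : is_mderive (fun y => flowV y t) x (flowVx x t).
Proof. by apply: is_mderiveD; [exact: is_mderiveM|exact: is_mderiveD]. Qed.

Let dVx x t : is_mderive (fun y => flowVx y t) x (flowVxx x t).
Proof.
apply: is_mderiveD; last exact: is_mderiveD.
by apply: is_mderiveD; [apply: is_mderiveM => //; exact: is_mderiveD|exact: is_mderiveM].
Qed.

Let dW x t : is_mderive (fun y => flowW y t) x (flowVx x t + flowB x t).
Proof. exact: is_mderiveD. Qed.

Lemma flow_dP x t : is_mderive (fun y => flowP y t) x (flowV x t).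
Proof.
have -> : flowV x t = (T x t + T x t) *m T x t + flowS x t *m X x t.
  by rewrite /flowV [LHS]addrC -mulmxDl.
exact: is_mderiveM.
Qed.

Lemma flow_dV x t : is_mderive (fun y => flowV y t) x (flowVx x t).
Proof. exact: dV. Qed.

Lemma flow_dN x t : is_mderive (fun y => flowN y t) x (flowNx x t).
Proof. exact: is_mderiveM. Qed.

Lemma flow_dNx x t : is_mderive (fun y => flowNx y t) x (flowNxx x t).
Proof.
apply: is_mderiveD; apply: is_mderiveM => //; exact: is_mderiveD.
Qed.

Let cS : mjcontinuous flowS. Proof. exact: mjcontinuousD. Qed.
Let cB : mjcontinuous flowB.
Proof. by apply: mjcontinuousD; exact: mjcontinuousM. Qed.
Let cBx : mjcontinuous flowBx.
Proof. by apply: mjcontinuousD; apply: mjcontinuousD; exact: mjcontinuousM. Qed.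
Let cTT2 : mjcontinuous (fun x t => T x t + T x t). Proof. exact: mjcontinuousD. Qed.
Let cXX2 : mjcontinuous (fun x t => X x t + X x t). Proof. exact: mjcontinuousD. Qed.
Lemma flow_cV : mjcontinuous flowV.
Proof. by apply: mjcontinuousD; [exact: mjcontinuousM|apply: mjcontinuousD; exact: mjcontinuousM]. Qed.
Lemma flow_cVx : mjcontinuous flowVx.
Proof.
by apply: mjcontinuousD; [apply: mjcontinuousD; exact: mjcontinuousM|exact: mjcontinuousD].
Qed.
Let cVxx : mjcontinuous flowVxx.
Proof.
apply: mjcontinuousD; last exact: mjcontinuousD.
by apply: mjcontinuousD; apply: mjcontinuousD; exact: mjcontinuousM.
Qed.
Let cW : mjcontinuous flowW.
Proof. by apply: mjcontinuousD; [exact: flow_cV|exact: mjcontinuousM]. Qed.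
Let cVB : mjcontinuous (fun x t => flowVx x t + flowB x t).
Proof. by apply: mjcontinuousD; [exact: flow_cVx|]. Qed.
Lemma flow_cP : mjcontinuous flowP. Proof. exact: mjcontinuousM. Qed.
Lemma flow_cN : mjcontinuous flowN. Proof. exact: mjcontinuousM. Qed.
Lemma flow_cNx : mjcontinuous flowNx. Proof. by apply: mjcontinuousD; exact: mjcontinuousM. Qed.
Lemma flow_cNxx : mjcontinuous flowNxx.
Proof.
have cVB' : mjcontinuous (fun x t => flowVxx x t + flowBx x t) by exact: mjcontinuousD.
by apply: mjcontinuousD; apply: mjcontinuousD; exact: mjcontinuousM.
Qed.
Lemma flow_cPt : mjcontinuous flowPt.
Proof.
apply: mjcontinuousD; last by apply: mjcontinuousM => //; exact: flow_cVx.
by apply: mjcontinuousM => //; apply: mjcontinuousD; exact: flow_cV.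
Qed.

Let sqr_derive (f : R -> M) y d : (forall y, f y *m f y = - 1%:M) ->
  is_mderive f y d -> d *m f y + f y *m d = 0.
Proof.
move=> ff df; have d1 := is_mderiveM df df.
apply: (is_mderive_unique d1); apply: (@eq_is_mderive _ _ _ (fun=> - 1%:M)) => //.
exact: is_mderive_cst.
Qed.

Let anti (A B : M) : (B + B) *m A + A *m (B + B) = 0 -> A *m B = - (B *m A).
Proof.
rewrite mulmxDl mulmxDr => h; apply: mx_double_inj; apply/eqP; rewrite -opprD -addr_eq0.
by rewrite addrC h.
Qed.

Lemma flow_ST x t : flowS x t *m T x t = - (T x t *m flowS x t).
Proof. exact: (anti (sqr_derive (fun y => gam_sqr y t) (dS x t))). Qed.

(** Differentiating T S + S T = 0 in x gives X S + S X + 4 T^2 = 0, which turns [gamma, X] = (S X -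
    X S) / 2 into S X + 2 T^2. The identity is proved doubled, to avoid the division by 2. *)
Lemma flow_gam_t x t : is_mderive (gam x) t (flowV x t).
Proof.
rewrite (_ : flowV x t = comm (gam x t) (X x t)) //.
have d y : is_mderive (fun y => T y t *m flowS y t + flowS y t *m T y t) y
   ((X y t *m flowS y t + T y t *m (T y t + T y t)) + ((T y t + T y t) *m T y t + flowS y t *m X y t)).
  by apply: is_mderiveD; exact: is_mderiveM.
have h : X x t *m flowS x t + T x t *m (T x t + T x t) + ((T x t + T x t) *m T x t + flowS x t *m X x t) = 0.
  apply: (is_mderive_unique (d x)); apply: (@eq_is_mderive _ _ _ (fun=> 0)); last exact: is_mderive_cst.
  by move=> y; rewrite flow_ST subrr.
apply: mx_double_inj; rewrite /flowV /comm.
transitivity (flowS x t *m X x t + (T x t *m T x t + T x t *m T x t) + (flowS x t *m X x t + (T x t *m T x t + T x t *m T x t)) -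
  (X x t *m flowS x t + T x t *m (T x t + T x t) + ((T x t + T x t) *m T x t + flowS x t *m X x t))).
  by rewrite h subr0.
by rewrite /flowS !(mulmxDl, mulmxDr); mx_abel.
Qed.

Lemma flow_SV x t : flowS x t *m flowV x t = - (flowV x t *m flowS x t).
Proof.
exact: (anti (sqr_derive (gam_sqr x) (is_mderiveD (flow_gam_t x t) (flow_gam_t x t)))).
Qed.

Lemma flow_T_skew x t : adj (T x t) = - T x t.
Proof.
apply: (is_mderive_unique (is_mderive_adj (dgam x t))).
apply: (@eq_is_mderive _ _ _ (fun y => - gam y t)); first by move=> y; rewrite gam_skew.
exact: is_mderiveN.
Qed.

Lemma flow_V_skew x t : adj (flowV x t) = - flowV x t.
Proof.
apply: (is_mderive_unique (is_mderive_adj (flow_gam_t x t))).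
apply: (@eq_is_mderive _ _ _ (fun s => - gam x s)); first by move=> y; rewrite gam_skew.
by apply: is_mderiveN; exact: flow_gam_t.
Qed.

Lemma flow_S_skew x t : adj (flowS x t) = - flowS x t.
Proof. by rewrite /flowS adjD gam_skew opprD. Qed.

Lemma mclairaut (f fx ft ftx : R -> R -> M) :
  (forall x t, is_mderive (fun y => f y t) x (fx x t)) ->
  (forall x t, is_mderive (f x) t (ft x t)) ->
  (forall x t, is_mderive (fun y => ft y t) x (ftx x t)) -> mjcontinuous ftx ->
  forall x t, is_mderive (fx x) t (ftx x t).
Proof.
move=> h1 h2 h3 c x t i j; split.
  exact: (clairaut (fun x t => (h1 x t i j).1) (fun x t => (h2 x t i j).1) (fun x t => (h3 x t i j).1) (c i j).1).
exact: (clairaut (fun x t => (h1 x t i j).2) (fun x t => (h2 x t i j).2) (fun x t => (h3 x t i j).2) (c i j).2).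
Qed.

Lemma flow_T_t x t : is_mderive (T x) t (flowVx x t).
Proof. exact: (mclairaut dgam flow_gam_t flow_dV flow_cVx). Qed.

Lemma flow_P_t x t : is_mderive (flowP x) t (flowPt x t).
Proof.
apply: is_mderiveM; last exact: flow_T_t.
by apply: is_mderiveD; exact: flow_gam_t.
Qed.

Lemma flow_zero_curvature x t :
  flowPt x t = flowNx x t + (flowN x t *m flowP x t - flowP x t *m flowN x t).
Proof. by apply: flow_flat; [exact: gam_sqr|exact: flow_ST|exact: flow_SV|]. Qed.

Lemma flow_P_adj x t : adj (flowP x t) = - flowP x t.
Proof.
by apply: flow_P_skew; [exact: flow_ST|exact: flow_S_skew|exact: flow_T_skew].
Qed.

Lemma flow_N_adj x t : adj (flowN x t) = - flowN x t.
Proof.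
apply: flow_N_skew; [exact: flow_ST|exact: flow_SV|exact: flow_S_skew|exact: flow_T_skew|exact: flow_V_skew].
Qed.

Section Frame.
Variables (a : M) (G : R -> R -> M).
Hypotheses (uG : forall x t, unitary (G x t)) (cG : mjcontinuous G)
  (G_x : forall x t, is_mderive (fun y => G y t) x (flowP x t *m G x t))
  (G_t : forall x t, is_mderive (G x) t (flowN x t *m G x t)).
Hypothesis gamE : forall x t, gam x t = G x t *m a *m adj (G x t).

Let s : M := a + a.

Definition conjG (F : R -> R -> M) x t : M := adj (G x t) *m F x t *m G x t.

Let GG x t : adj (G x t) *m G x t = 1%:M. Proof. exact: unitaryV. Qed.
Let GG' x t : G x t *m adj (G x t) = 1%:M. Proof. exact: uG. Qed.

Lemma conjGM F F' x t : conjG (fun x t => F x t *m F' x t) x t = conjG F x t *m conjG F' x t.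
Proof. by rewrite /conjG !mulmxA -(mulmxA _ (G x t) (adj _)) GG' mulmx1. Qed.

Lemma conjGD F F' x t : conjG (fun x t => F x t + F' x t) x t = conjG F x t + conjG F' x t.
Proof. by rewrite /conjG mulmxDr mulmxDl. Qed.

Lemma conjGN F x t : conjG (fun x t => - F x t) x t = - conjG F x t.
Proof. by rewrite /conjG mulmxN mulNmx. Qed.

Lemma conjG_S x t : conjG flowS x t = s.
Proof.
rewrite /conjG /flowS gamE -mulmxDl -mulmxDr -/s !mulmxA GG mul1mx.
by rewrite -mulmxA GG mulmx1.
Qed.

Lemma mjcontinuous_conjG F : mjcontinuous F -> mjcontinuous (conjG F).
Proof.
by move=> cF; apply: mjcontinuousM => //; apply: mjcontinuousM => //; exact: mjcontinuous_adj.
Qed.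

Lemma conjG_adj F x t : adj (F x t) = - F x t -> adj (conjG F x t) = - conjG F x t.
Proof. by move=> aF; rewrite /conjG !adjM adjK aF mulNmx mulmxN mulmxA. Qed.

(** P being skew, the adjoint of G has derivative - adj(G) P, so conjugation turns d/dx into the
    covariant derivative F_x + [F, P]. *)
Lemma conjG_x F F' x t : is_mderive (fun y => F y t) x (F' x t) ->
  is_mderive (fun y => conjG F y t) x
    (conjG (fun x t => F' x t + (F x t *m flowP x t - flowP x t *m F x t)) x t).
Proof.
move=> dF; have dGa := is_mderive_adj (G_x x t).
have := is_mderiveM (is_mderiveM dGa dF) (G_x x t).
rewrite adjM flow_P_adj mulmxN mulNmx.
set d := (X in is_mderive _ _ X -> _); suff -> : d = conjG (fun x t => F' x t + (F x t *m flowP x t - flowP x t *m F x t)) x t by [].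
rewrite /d /conjG; move: (adj (G x t)) => g; move: (G x t) (F x t) (F' x t) (flowP x t) => g' f f' p.
by rewrite !(mulmxDl, mulmxDr, mulNmx, mulmxN, mulmxA); mx_abel.
Qed.

Lemma conjG_t F F' x t : is_mderive (F x) t (F' x t) ->
  is_mderive (fun r => conjG F x r) t
    (conjG (fun x t => F' x t + (F x t *m flowN x t - flowN x t *m F x t)) x t).
Proof.
move=> dF; have dGa := is_mderive_adj (G_t x t).
have := is_mderiveM (is_mderiveM dGa dF) (G_t x t).
rewrite adjM flow_N_adj mulmxN mulNmx.
set d := (X in is_mderive _ _ X -> _); suff -> : d = conjG (fun x t => F' x t + (F x t *m flowN x t - flowN x t *m F x t)) x t by [].
rewrite /d /conjG; move: (adj (G x t)) => g; move: (G x t) (F x t) (F' x t) (flowN x t) => g' f f' p.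
by rewrite !(mulmxDl, mulmxDr, mulNmx, mulmxN, mulmxA); mx_abel.
Qed.

(** This is adj(G) G_x, followed by its derivatives. As [P, P] = 0, u_x is the conjugate of P_x =
    gamma_t; by zero curvature, u_t is the conjugate of N_x. *)
Definition fu := conjG flowP.
Definition fux := conjG flowV.
Definition fuxx := conjG (fun x t => flowVx x t + (flowV x t *m flowP x t - flowP x t *m flowV x t)).
Definition fut := conjG flowNx.
Definition futx := conjG (fun x t => flowNxx x t + (flowNx x t *m flowP x t - flowP x t *m flowNx x t)).

Lemma fu_x x t : is_mderive (fun y => fu y t) x (fux x t).
Proof.
have := conjG_x (flow_dP x t); rewrite (_ : conjG _ x t = fux x t)//.
by rewrite /fux /conjG subrr addr0.
Qed.

Lemma fux_x x t : is_mderive (fun y => fux y t) x (fuxx x t).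
Proof. exact: conjG_x (flow_dV x t). Qed.

Lemma fu_t x t : is_mderive (fu x) t (fut x t).
Proof.
have := conjG_t (flow_P_t x t); rewrite (_ : conjG _ x t = fut x t)//.
by rewrite /fut /conjG flow_zero_curvature -(opprB (flowN x t *m flowP x t)) addrK.
Qed.

Lemma fut_x x t : is_mderive (fun y => fut y t) x (futx x t).
Proof. exact: conjG_x (flow_dNx x t). Qed.

Lemma cfu : mjcontinuous fu. Proof. exact: mjcontinuous_conjG flow_cP. Qed.
Lemma cfux : mjcontinuous fux. Proof. exact: mjcontinuous_conjG flow_cV. Qed.
Lemma cfuxx : mjcontinuous fuxx.
Proof.
apply: mjcontinuous_conjG; apply: mjcontinuousD; first exact: flow_cVx.
by apply: mjcontinuousB; apply: mjcontinuousM; (exact: flow_cV || exact: flow_cP).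
Qed.
Lemma cfut : mjcontinuous fut. Proof. exact: mjcontinuous_conjG flow_cNx. Qed.
Lemma cfutx : mjcontinuous futx.
Proof.
apply: mjcontinuous_conjG; apply: mjcontinuousD; first exact: flow_cNxx.
by apply: mjcontinuousB; apply: mjcontinuousM; (exact: flow_cNx || exact: flow_cP).
Qed.

Lemma fux_t x t : is_mderive (fux x) t (futx x t).
Proof. exact: (mclairaut fu_x fu_t fut_x cfutx). Qed.

Lemma fu_skew x t : adj (fu x t) = - fu x t.
Proof. by apply: conjG_adj; exact: flow_P_adj. Qed.

Let SP x t : flowS x t *m flowP x t = - (flowP x t *m flowS x t).
Proof. by rewrite /flowP -(mulmxA (flowS x t) (T x t)) -mulmxN -flow_ST. Qed.

Lemma s_fu x t : s *m fu x t = - (fu x t *m s).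
Proof.
rewrite -(conjG_S x t) -!conjGM -conjGN /conjG; congr (_ *m _ *m _); exact: SP.
Qed.

Lemma s_skew : adj s = - s.
Proof. by rewrite -(conjG_S 0 0); apply: conjG_adj; exact: flow_S_skew. Qed.

Lemma s_sqr : s *m s = - 1%:M.
Proof. by rewrite -(conjG_S 0 0) -conjGM /conjG gam_sqr mulmxN mulNmx mulmx1 GG. Qed.

Let NxE x t : flowNx x t = flowS x t *m ((flowVx x t + (flowV x t *m flowP x t - flowP x t *m flowV x t)) -
  (flowP x t *m flowP x t *m flowP x t + flowP x t *m flowP x t *m flowP x t)).
Proof. exact: (flow_pde (gam_sqr x t) (flow_ST x t) (flow_SV x t) (erefl _)). Qed.

Lemma fu_pde x t : fut x t = s *m (fuxx x t -
  (fu x t *m fu x t *m fu x t + fu x t *m fu x t *m fu x t)).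
Proof.
rewrite -(conjG_S x t) /fu -!conjGM -conjGD -conjGN /fuxx -conjGD -conjGM /fut /conjG.
by congr (_ *m _ *m _); exact: NxE.
Qed.

Definition fQ x t : M := s *m (fux x t + fu x t *m fu x t).

Lemma fQE x t : fQ x t = conjG flowN x t.
Proof.
rewrite /fQ -(conjG_S x t) /fu -conjGM -conjGD -conjGM /conjG; congr (_ *m _ *m _).
have SS : flowS x t *m flowS x t = - 1%:M by exact: gam_sqr.
by rewrite /flowN /flowW (flow_P_sqr SS (flow_ST x t)).
Qed.

(** Q is the conjugate of N, and the conjugate of N_x + [N, P] is u_t - [u, Q]: the MNLS equation
    read backwards. *)
Lemma fQ_x x t : is_mderive (fun y => fQ y t) x (fut x t - (fu x t *m fQ x t - fQ x t *m fu x t)).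
Proof.
apply: (@eq_is_mderive _ _ _ (fun y => conjG flowN y t)); first by move=> y; rewrite fQE.
have := conjG_x (flow_dN x t).
set d := (X in is_mderive _ _ X -> _); suff -> : d = fut x t - (fu x t *m fQ x t - fQ x t *m fu x t) by [].
rewrite /d !fQE /fu -!conjGM -conjGN -conjGD -conjGN /fut -conjGD /conjG.
by rewrite opprB.
Qed.

(** The constant may depend on t in any way, which is all that a Schwartz condition at fixed t
    provides. The rate is the derivative of atan. *)
Definition decaying (F : R -> R -> M) := forall t, exists2 B, 0 <= B & forall x, mnorm (F x t) <= B * (1 + x ^+ 2)^-1.
Definition xbounded (F : R -> R -> M) := forall t, exists2 B, 0 <= B & forall x, mnorm (F x t) <= B.

Let inv_le1 (x : R) : 0 < (1 + x ^+ 2)^-1 <= 1.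
Proof.
have h : 0 < 1 + x ^+ 2 by rewrite ltr_pwDl// sqr_ge0.
by rewrite invr_gt0 h invf_le1// lerDl sqr_ge0.
Qed.

Lemma decaying_bounded F : decaying F -> xbounded F.
Proof.
move=> dF t; have [B B0 HB] := dF t; exists B => // x; apply: le_trans (HB x) _.
by have /andP[h1 h2] := inv_le1 x; rewrite ler_piMr.
Qed.

Lemma decayingD F F' : decaying F -> decaying F' -> decaying (fun x t => F x t + F' x t).
Proof.
move=> dF dF' t; have [B B0 HB] := dF t; have [B' B'0 HB'] := dF' t.
exists (B + B'); first exact: addr_ge0.
by move=> x; apply: le_trans (mnormD _ _) _; rewrite mulrDl lerD.
Qed.

Lemma decayingMl F F' : xbounded F -> decaying F' -> decaying (fun x t => F x t *m F' x t).
Proof.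
move=> dF dF' t; have [B B0 HB] := dF t; have [B' B'0 HB'] := dF' t.
exists (B * B'); first exact: mulr_ge0.
by move=> x; rewrite -mulrA; apply: mnormM_le.
Qed.

Lemma mnorm_G x t : mnorm (G x t) <= 4 * (n * n)%:R ^+ 2 * n%:R + 1.
Proof. exact: mnorm_unitary_le. Qed.

Hypotheses (decT : decaying T) (decX : decaying X) (decY : decaying Y).

Let bS : xbounded flowS.
Proof.
move=> t; pose gb : R := 4 * (n * n)%:R ^+ 2 * n%:R + 1.
have gb0 : 0 <= gb by apply: le_trans (mnorm_G 0 0); exact: mnorm_ge0.
exists (gb * mnorm s * gb); first by rewrite !mulr_ge0// mnorm_ge0.
move=> x; have -> : flowS x t = G x t *m s *m adj (G x t).
  by rewrite /flowS gamE -mulmxDl -mulmxDr.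
apply: mnormM_le; last by rewrite mnorm_adj; exact: mnorm_G.
by apply: mnormM_le => //; exact: mnorm_G.
Qed.

Lemma decaying_P : decaying flowP.
Proof. exact: decayingMl. Qed.

Let decTT F : decaying F -> decaying (fun x t => F x t + F x t).
Proof. by move=> dF; exact: decayingD. Qed.

Lemma decaying_V : decaying flowV.
Proof.
apply: decayingD; first exact: decayingMl.
by apply: decTT; apply: decayingMl => //; exact: decaying_bounded.
Qed.

Let decB : decaying flowB.
Proof. by apply: decayingD; apply: decayingMl => //; exact: decaying_bounded. Qed.

Let decVx : decaying flowVx.
Proof.
apply: decayingD; last exact: decTT.
apply: decayingD; last exact: decayingMl.
by apply: decayingMl => //; apply: decaying_bounded; exact: decTT.
Qed.

Lemma decaying_Nx : decaying flowNx.
Proof.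
apply: decayingD; last by apply: decayingMl => //; exact: decayingD.
apply: decayingMl; first by apply: decaying_bounded; exact: decTT.
by apply: decayingD; [exact: decaying_V|apply: decayingMl => //; exact: decaying_bounded].
Qed.

Let ip_le (F : M) B (x : R) : 0 <= B -> mnorm F <= B * (1 + x ^+ 2)^-1 -> ip F F <= B ^+ 2 * (1 + x ^+ 2)^-1.
Proof.
move=> B0 h; apply: le_trans (ip_self_le_mnorm F) _.
have /andP[i0 i1] := inv_le1 x.
apply: le_trans (_ : (B * (1 + x ^+ 2)^-1) ^+ 2 <= _).
  by rewrite ler_pXn2r ?nnegrE ?mnorm_ge0// mulr_ge0// ltW.
by rewrite exprMn ler_wpM2l ?sqr_ge0// expr2 ler_piMr// ltW.
Qed.

Lemma decaying_density F t : mjcontinuous F -> decaying F ->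
  exists K, density_le K (fun x => ip (conjG F x t) (conjG F x t)).
Proof.
move=> cF dF; have [B B0 HB] := dF t; exists (B ^+ 2 * pi) => b1 b2 b12.
apply: intg_inv_sqr_le => //; last exact: sqr_ge0.
  by apply: (@jcontinuous_x _ _ t (jcontinuous_ip (mjcontinuous_conjG cF) (mjcontinuous_conjG cF))).
by move=> x; rewrite ip_conj//; exact: ip_le.
Qed.

Lemma fu_H1_fin t : exists K, H1 fu fux K t.
Proof.
have [K1 h1] := @decaying_density flowP t flow_cP decaying_P.
have [K2 h2] := @decaying_density flowV t flow_cV decaying_V.
have p1 := density_le_ge0 h1; have p2 := density_le_ge0 h2.
exists (K1 + K2); split.
  by apply: density_le_mono h1; rewrite lerDl.
by apply: density_le_mono h2; rewrite lerDr.
Qed.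

Lemma fu_H2_fin t : exists K, H2 fut K t.
Proof. exact: decaying_density flow_cNx decaying_Nx. Qed.

Lemma fu_vanish t e : 0 < e -> exists A, forall x, x < A -> ip (fu x t) (fu x t) <= e.
Proof.
move=> e0; have [B B0 HB] := decaying_P t.
have Q0 : 0 <= B ^+ 2 / e by rewrite divr_ge0 ?sqr_ge0// ltW.
exists (- (B ^+ 2 / e + 1)) => x hx; rewrite ip_conj//; apply: le_trans (ip_le B0 (HB x)) _.
have h : 0 < 1 + x ^+ 2 by rewrite ltr_pwDl// sqr_ge0.
rewrite ler_pdivrMr// mulrC -ler_pdivrMr//.
have : 0 <= (- x - 1) * (- x) by rewrite mulr_ge0//; lra.
by rewrite expr2; lra.
Qed.

Lemma fu_H1_bounded t1 t2 : exists K, forall t, t1 <= t <= t2 -> H1 fu fux K t.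
Proof.
exact: (H1_locally_bounded s_skew s_sqr fu_skew s_fu fu_x fux_x fu_t fux_t fut_x cfu cfux cfuxx cfut cfutx
  fu_pde fu_H1_fin fu_H2_fin fu_vanish).
Qed.

(** G is unitary, so G_x = P G inherits the integrable bound of P. *)
Lemma frame_limit t : exists c, mlim_minf (fun x => G x t) c.
Proof.
have [B B0 HB] := decaying_P t.
pose gb : R := 4 * (n * n)%:R ^+ 2 * n%:R + 1.
have bd x : mnorm (flowP x t *m G x t) <= B * gb * (1 + x ^+ 2)^-1.
  by rewrite mulrAC; apply: mnormM_le => //; exact: mnorm_G.
have re (ij : 'I_n * 'I_n) : exists l : R, reE (fun x => G x t) ij.1 ij.2 x @[x --> -oo] --> l.
  apply: (@integrable_derive_cvg_ninfty _ _ _ (B * gb) (fun x => (G_x x t ij.1 ij.2).1)) => x.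
  by apply: le_trans (bd x); apply: le_trans (mnorm_entry _ ij.1 ij.2); rewrite lerDl.
have im (ij : 'I_n * 'I_n) : exists l : R, imE (fun x => G x t) ij.1 ij.2 x @[x --> -oo] --> l.
  apply: (@integrable_derive_cvg_ninfty _ _ _ (B * gb) (fun x => (G_x x t ij.1 ij.2).2)) => x.
  by apply: le_trans (bd x); apply: le_trans (mnorm_entry _ ij.1 ij.2); rewrite lerDr.
have [lr Hr] := choice re; have [li Hi] := choice im.
exists (\matrix_(i, j) (@complex.Complex R (lr (i, j)) (li (i, j)))) => i j.
by rewrite mxE; split; [exact: (Hr (i, j))|exact: (Hi (i, j))].
Qed.

(* Averaging over the long window [-2L, -L] makes the L^2 bounds on u and u_x sufficient. *)
Let average_const (f ft : R -> R -> R) (kap K1 t1 t2 l1 l2 : R) : 0 <= kap -> 0 <= K1 -> t1 <= t2 ->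
  jcontinuous f -> jcontinuous ft -> (forall x t : R, is_derive t 1 (f x) (ft x t)) ->
  (forall d, 0 < d -> forall L t, 0 < L -> t1 <= t <= t2 ->
     `|intg (- 2 * L) (- L) (fun x => ft x t)| <= kap * (d * L + d^-1 * K1 + K1)) ->
  f x t1 @[x --> -oo] --> l1 -> f x t2 @[x --> -oo] --> l2 -> l1 = l2.
Proof.
move=> kap0 K10 t12 cf cft df bd lim1 lim2.
have T0 : 0 <= t2 - t1 by lra.
have avg t l e : 0 < e -> f x t @[x --> -oo] --> l ->
    exists A, forall L, 0 < L -> A < L -> `|intg (- 2 * L) (- L) (fun x => f x t) - L * l| <= e * L.
  move=> e0 h; have [A HA] := (cvg_ninfty_epsP _ _).1 h e e0; exists (- A) => L L0 AL.
  have cx := @jcontinuous_x _ _ t cf.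
  have -> : intg (- 2 * L) (- L) (fun x => f x t) - L * l =
      intg (- 2 * L) (- L) (fun x => 1 * f x t + (-1) * l).
    rewrite (@intg_linear _ (fun x => f x t) (fun=> l)); [|exact: cx|exact: cst_continuous].
    by rewrite intg_cst; ring.
  apply: le_trans (@intg_norm_le _ _ (fun=> e) _ _ _ _ _ _) _; first by lra.
  - by apply: (@continuous_lin _ (fun x => f x t) (fun=> l)); [exact: cx|exact: cst_continuous].
  - exact: cst_continuous.
  - by move=> x /andP[_ hx]; rewrite mul1r mulN1r; apply: HA; lra.
  - by rewrite intg_cst; apply: le_of_eq; ring.
apply/eqP; rewrite -subr_eq0 -normr_le0; apply/ler_addgt0Pr => e e0; rewrite add0r.
have e4 : 0 < e / 4 by lra.
pose Tk := (t2 - t1) * kap.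
have Tk0 : 0 <= Tk by rewrite mulr_ge0.
have [d [d0 hd]] : exists d, 0 < d /\ Tk * d <= e / 4.
  by exists (e / 4 / (Tk + 1)); split; [rewrite divr_gt0//; lra|apply: mul_divD1_le => //; exact: ltW].
have [A1 HA1] := avg t1 l1 (e / 4) e4 lim1.
have [A2 HA2] := avg t2 l2 (e / 4) e4 lim2.
pose Q := Tk * (d^-1 * K1 + K1).
have Q0 : 0 <= Q by rewrite /Q mulr_ge0// addr_ge0// mulr_ge0// invr_ge0 ltW.
(* Four errors of e / 4 per unit length: the two means, the part of the t-variation linear in L
   through [d], and [Q], which L outgrows. *)
pose L := `|A1| + `|A2| + 1 + Q / (e / 4).
have n1 := normr_ge0 A1; have n2 := normr_ge0 A2.
have m1 := ler_norm A1; have m2 := ler_norm A2.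
have q0 : 0 <= Q / (e / 4) by rewrite divr_ge0// ltW.
have L0 : 0 < L by rewrite /L; lra.
have QL : Q <= e / 4 * L by rewrite mulrC -ler_pdivrMr// /L; lra.
have h1 := HA1 L L0 ltac:(rewrite /L; lra); have h2 := HA2 L L0 ltac:(rewrite /L; lra).
have LL : - 2 * L <= - L by lra.
have dA (t : R) := is_derive_param_intg t LL df cf cft.
have m0 : 0 <= kap * (d * L + d^-1 * K1 + K1).
  by rewrite mulr_ge0// !addr_ge0// mulr_ge0// ?invr_ge0 ltW.
have t1i : t1 <= t1 <= t2 by rewrite lexx.
have t2i : t1 <= t2 <= t2 by rewrite lexx t12.
have c1 := is_derive_change dA m0 (fun t ht => bd d d0 L t L0 ht) t1i t2i.
have c2 := is_derive_change dA m0 (fun t ht => bd d d0 L t L0 ht) t2i t1i.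
have E1 : kap * (d * L + d^-1 * K1 + K1) * (t2 - t1) = Tk * d * L + Q by rewrite /Q /Tk; ring.
have hdL : Tk * d * L <= e / 4 * L by rewrite ler_wpM2r// ltW.
rewrite E1 in c1 c2.
move: h1 h2 c1 c2; move: (intg _ _ (fun x => f x t1)) (intg _ _ (fun x => f x t2)) => I1 I2.
rewrite !ler_norml => /andP[a1 a2] /andP[b1 b2] c1 c2.
by apply/andP; split; rewrite -(ler_pM2l L0); lra.
Qed.

(** G_t = N G = G Q is bounded by |u_x| + |u|^2 up to constants. With |u_x| <= d + |u_x|^2 / d its
    integral over [-2L, -L] is, up to constants, at most d L plus a quantity independent of L and of
    t in [t1, t2]; dividing by L and letting d tend to 0 leaves nothing. *)
Lemma frame_limit_const t1 t2 c1 c2 : t1 <= t2 ->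
  mlim_minf (fun x => G x t1) c1 -> mlim_minf (fun x => G x t2) c2 -> c1 = c2.
Proof.
move=> t12 l1 l2; have [K HK] := fu_H1_bounded t1 t2.
have K0 : 0 <= K by apply: density_le_ge0 (HK t1 _).1; rewrite lexx.
have [gb gb0 gle] : exists2 gb, 0 <= gb & forall x t, mnorm (G x t) <= gb.
  eexists; last exact: mnorm_G.
  by apply: le_trans (mnorm_G 0 0); exact: mnorm_ge0.
have [D D0 HD] : exists2 D, 0 <= D & forall A : M, mnorm A ^+ 2 <= D * ip A A.
  by eexists; last exact: mnorm_sqr_le_ip; exact: sqr_ge0.
have [kap kap0 kapE] : exists2 kap, 0 <= kap & gb * mnorm s = kap.
  by eexists; last reflexivity; apply: mulr_ge0 => //; exact: mnorm_ge0.
have NG x t : flowN x t *m G x t = G x t *m fQ x t.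
  by rewrite fQE /conjG !mulmxA GG' mul1mx.
(* The factors 1 only give the sum the nested shape that [intg_linear] expects. *)
pose r d x t := (kap * (D * d^-1)) * ip (fux x t) (fux x t) + 1 * ((kap * D) * ip (fu x t) (fu x t) + 1 * (kap * d)).
have pt d x t : 0 < d -> mnorm (flowN x t *m G x t) <= r d x t.
  move=> d0; rewrite NG; have di : 0 < d^-1 by rewrite invr_gt0.
  have h1 := HD (fux x t); have h2 := HD (fu x t).
  have h3 := le_sqr_div (mnorm (fux x t)) d0.
  have h4 : mnorm (fux x t + fu x t *m fu x t) <= d + d^-1 * (D * ip (fux x t) (fux x t)) + D * ip (fu x t) (fu x t).
    apply: le_trans (mnormD _ _) _; apply: lerD.
      exact: le_trans h3 (lerD (lexx _) (ler_wpM2l (ltW di) h1)).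
    by apply: le_trans (mnormM _ _) _; rewrite -expr2.
  apply: le_trans (_ : gb * (mnorm s * (d + d^-1 * (D * ip (fux x t) (fux x t)) + D * ip (fu x t) (fu x t))) <= _).
    by apply: mnormM_le; [exact: gle|exact: mnormM_le].
  rewrite mulrA kapE /r; move: (ip (fux x t) _) (ip (fu x t) _) => p q.
  by apply: le_of_eq; clear; ring.
have cux t := @jcontinuous_x _ _ t (jcontinuous_ip cfux cfux).
have cuu t := @jcontinuous_x _ _ t (jcontinuous_ip cfu cfu).
have ccst (z : R) : continuous (fun _ : R => z) by exact: cst_continuous.
have cr2 d t : continuous (fun x => (kap * D) * ip (fu x t) (fu x t) + 1 * (kap * d)).
  exact: (@continuous_lin _ _ _ (kap * D) 1 (cuu t) (ccst (kap * d))).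
have cr d t : continuous (fun x => r d x t).
  exact: (@continuous_lin _ _ _ (kap * (D * d^-1)) 1 (cux t) (cr2 d t)).
have rint d L t : 0 < d -> 0 < L -> t1 <= t <= t2 ->
    intg (- 2 * L) (- L) (fun x => r d x t) <= kap * (d * L + d^-1 * (D * K) + D * K).
  move=> d0 L0 /HK[k1 k2]; have LL : - 2 * L <= - L by lra.
  have E1 := intg_linear (kap * (D * d^-1)) 1 (- 2 * L) (- L) (cux t) (cr2 d t).
  have E2 := intg_linear (kap * D) 1 (- 2 * L) (- L) (cuu t) (ccst (kap * d)).
  apply: le_trans (le_of_eq E1) _; rewrite E2 intg_cst.
  have di0 : 0 <= d^-1 by rewrite invr_ge0 ltW.
  have p1 := ler_wpM2l (mulr_ge0 kap0 (mulr_ge0 D0 di0)) (k2 _ _ LL).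
  have p2 := ler_wpM2l (mulr_ge0 kap0 D0) (k1 _ _ LL).
  rewrite !mul1r (_ : - L - - 2 * L = L); last by ring.
  apply: le_trans (lerD p1 (lerD p2 (lexx _))) _.
  by apply: le_of_eq; ring.
have cNG : mjcontinuous (fun x t => flowN x t *m G x t) by apply: mjcontinuousM => //; exact: flow_cN.
apply/matrixP => i j; apply: complex_ext.
  apply: (@average_const (fun x t => complex.Re (G x t i j)) (fun x t => complex.Re ((flowN x t *m G x t) i j)) kap (D * K) t1 t2) => //.
  - by rewrite mulr_ge0.
  - exact: (cG i j).1.
  - exact: (cNG i j).1.
  - by move=> x t; exact: (G_t x t i j).1.
  - move=> d d0 L t L0 ht; apply: le_trans (rint d L t d0 L0 ht).
    apply: intg_norm_le => //; [lra|exact: (@jcontinuous_x _ _ t (cNG i j).1)|].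
    by move=> x _; apply: le_trans (pt d x t d0); apply: le_trans (mnorm_entry _ i j); rewrite lerDl.
  - exact: (l1 i j).1.
  - exact: (l2 i j).1.
apply: (@average_const (fun x t => complex.Im (G x t i j)) (fun x t => complex.Im ((flowN x t *m G x t) i j)) kap (D * K) t1 t2) => //.
- by rewrite mulr_ge0.
- exact: (cG i j).2.
- exact: (cNG i j).2.
- by move=> x t; exact: (G_t x t i j).2.
- move=> d d0 L t L0 ht; apply: le_trans (rint d L t d0 L0 ht).
  apply: intg_norm_le => //; [lra|exact: (@jcontinuous_x _ _ t (cNG i j).2)|].
  by move=> x _; apply: le_trans (pt d x t d0); apply: le_trans (mnorm_entry _ i j); rewrite lerDr.
- exact: (l1 i j).2.
- exact: (l2 i j).2.
Qed.

End Frame.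

End Flow.

(** * The development map: Schwartz decay, Q_2 in terms of u, uniqueness of the frame *)

Section DevelopmentMap.
Context {R : realType}.
Local Notation C := (R[i]).

Lemma reE_mderiven p q n (f : R -> 'M[C]_(p, q)) i j : reE (mderiven n f) i j = derive1n n (reE f i j).
Proof.
elim: n => [//|n IH]; rewrite derive1nS -IH; apply/funext => x.
by rewrite /reE /mderiven iterS mxE.
Qed.

Lemma imE_mderiven p q n (f : R -> 'M[C]_(p, q)) i j : imE (mderiven n f) i j = derive1n n (imE f i j).
Proof.
elim: n => [//|n IH]; rewrite derive1nS -IH; apply/funext => x.
by rewrite /imE /mderiven iterS mxE.
Qed.

Section Smooth.
Variables (n : nat) (gam : R -> R -> 'M[C]_n).
Hypothesis smooth_gam : msmooth2 gam.

Lemma msmooth2_x p x t :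
  is_mderive (fun y => mderiven p (gam^~ t) y) x (mderiven p.+1 (gam^~ t) x).
Proof.
apply: mderivable_is_mderive => i j; have [h1 h2] := smooth_gam i j.
rewrite reE_mderiven imE_mderiven; split.
  exact: ((h1 p 0).1 x t).1.
exact: ((h2 p 0).1 x t).1.
Qed.

Lemma msmooth2_continuous p : mjcontinuous (fun x t => mderiven p (gam^~ t) x).
Proof.
move=> i j; have [h1 h2] := smooth_gam i j; split.
  rewrite (_ : (fun x t => _) = pdn p 0 (fun x t => complex.Re (gam x t i j))); first exact: (h1 p 0).2.
  apply/funext => x; apply/funext => t.
  exact: (congr1 (fun f => f x) (reE_mderiven p (gam^~ t) i j)).
rewrite (_ : (fun x t => _) = pdn p 0 (fun x t => complex.Im (gam x t i j))); first exact: (h2 p 0).2.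
apply/funext => x; apply/funext => t.
exact: (congr1 (fun f => f x) (imE_mderiven p (gam^~ t) i j)).
Qed.

Lemma msmooth2_t x t : mderivable (gam x) t.
Proof.
move=> i j; have [h1 h2] := smooth_gam i j; split.
  exact: ((h1 0 0).1 x t).2.
exact: ((h2 0 0).1 x t).2.
Qed.

End Smooth.

(** The Schwartz bounds with weights 1 and x^2 add up to one with weight 1 + x^2. *)
Lemma mschwartz_decay n (f : R -> 'M[C]_n) s : mschwartz f ->
  exists2 B, 0 <= B & forall x, mnorm (mderiven s f x) <= B * (1 + x ^+ 2)^-1.
Proof.
move=> [_ h]; have [B0 h0] := h 0 s; have [B2 h2] := h 2 s.
exists (2 * (n * n)%:R * (`|B0| + `|B2|)); first by rewrite !mulr_ge0// addr_ge0.
move=> x; rewrite -[leRHS]mulrA; apply: mnorm_le_entries => i j.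
have p : 0 < 1 + x ^+ 2 by rewrite ltr_pwDl// sqr_ge0.
have [a1 b1] := h0 x i j; have [a2 b2] := h2 x i j.
rewrite !ler_pdivlMr//; move: a1 b1 a2 b2; rewrite expr0 !mul1r real_normK ?num_real//.
have := ler_norm B0; have := ler_norm B2; rewrite /reE /imE.
split; lra.
Qed.

Lemma is_mderive_mxsub p q p' q' (h : 'I_p' -> 'I_p) (l : 'I_q' -> 'I_q) (f : R -> 'M[C]_(p, q)) x d :
  is_mderive f x d -> is_mderive (fun y => mxsub h l (f y)) x (mxsub h l d).
Proof.
move=> df i j; have [h1 h2] := df (h i) (l j); rewrite mxE.
rewrite (_ : reE _ i j = reE f (h i) (l j)); last by apply/funext => y; rewrite /reE mxE.
by rewrite (_ : imE _ i j = imE f (h i) (l j)); last by apply/funext => y; rewrite /imE mxE.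
Qed.

Lemma is_mderive_submx p1 p2 q1 q2 (f : R -> 'M[C]_(p1 + p2, q1 + q2)) x d : is_mderive f x d ->
  [/\ is_mderive (fun y => ulsubmx (f y)) x (ulsubmx d),
      is_mderive (fun y => ursubmx (f y)) x (ursubmx d),
      is_mderive (fun y => dlsubmx (f y)) x (dlsubmx d)
    & is_mderive (fun y => drsubmx (f y)) x (drsubmx d)].
Proof.
move=> df; rewrite ulsubmxEsub ursubmxEsub dlsubmxEsub drsubmxEsub.
split; apply: eq_is_mderive (is_mderive_mxsub _ _ df) => y.
- by rewrite ulsubmxEsub.
- by rewrite ursubmxEsub.
- by rewrite dlsubmxEsub.
- by rewrite drsubmxEsub.
Qed.

(** Put w = adj(g) g_x. Then gamma_x is the conjugate of [w, b], and 2 b [w, b] = w since w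
    anticommutes with b and 4 b^2 = -1; so 2 gamma gamma_x g = g_x. The frame obeys a linear
    equation whose coefficient involves gamma alone. *)
Lemma normal_frame_derive n (b : 'M[C]_n) (gam g : R -> 'M[C]_n) x d :
  (b + b) *m (b + b) = - 1%:M -> (forall y, unitary (g y)) -> (forall y, gam y = g y *m b *m adj (g y)) ->
  mderivable g x -> adj (adj (g x) *m mderive g x) = - (adj (g x) *m mderive g x) ->
  (b + b) *m (adj (g x) *m mderive g x) = - (adj (g x) *m mderive g x *m (b + b)) ->
  is_mderive gam x d -> is_mderive g x ((gam x + gam x) *m d *m g x).
Proof.
move=> bb ug gE dg; set w := _ *m mderive g x => wsk sw dgam.
have dgx := mderivable_is_mderive dg.
have dgE : mderive g x = g x *m w by rewrite /w mulmxA ug mul1mx.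
have bw : b *m w = - (w *m b).
  by apply: mx_double_inj; rewrite -mulmxDl sw -opprD -mulmxDr.
have h := flow_bracket_gam bb erefl bw.
have bs : b *m (b + b) = (b + b) *m b by rewrite mulmxDl mulmxDr.
have SE : gam x + gam x = g x *m (b + b) *m adj (g x) by rewrite gE -mulmxDl -mulmxDr.
have dE : d = g x *m (w *m b - b *m w) *m adj (g x).
  apply: (is_mderive_unique dgam).
  apply: (@eq_is_mderive _ _ _ (fun y => g y *m b *m adj (g y))) => //.
  have := is_mderiveM (is_mderiveMr b dgx) (is_mderive_adj dgx).
  by rewrite dgE adjM wsk mulNmx mulmxN mulmxBr mulmxBl !mulmxA.
suff -> : (gam x + gam x) *m d *m g x = mderive g x by [].
move: (b + b) bs h SE => s bs h SE.
rewrite SE dE dgE -!mulmxA unitaryV// mulmx1 (mulmxA (adj _)) unitaryV// mul1mx; congr (_ *m _).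
by rewrite -[RHS]h mulmxBr !mulmxA bs.
Qed.

Section Development.
Variables (k m : nat).
Local Notation M := 'M[C]_(k + m).
Local Notation a := (@base_a R k m).
Local Notation s := (@cstruct R k m).

(** The diagonal blocks of Q_2 come from s u^2, since u^2 has diagonal blocks -q q^* and -q^* q; the
    off-diagonal ones come from s u_x. *)
Lemma Q2_perp (u : R -> M) x d : (forall y, in_perp (u y)) -> is_mderive u x d ->
  Q2 u x = s *m (d + u x *m u x).
Proof.
move=> pu du; have [d1 d2 d3 d4] := is_mderive_submx du.
have uE y : u y = block_mx 0 (ursubmx (u y)) (- adj (ursubmx (u y))) 0.
  by have [q ->] := pu y; rewrite block_mxKur.
have z1 : ulsubmx d = 0.
  apply: (is_mderive_unique d1); apply: (@eq_is_mderive _ _ _ (fun=> 0)); last exact: is_mderive_cst.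
  by move=> y; rewrite uE block_mxKul.
have z4 : drsubmx d = 0.
  apply: (is_mderive_unique d4); apply: (@eq_is_mderive _ _ _ (fun=> 0)); last exact: is_mderive_cst.
  by move=> y; rewrite uE block_mxKdr.
have da := is_mderive_adj d2.
have z3 : dlsubmx d = - adj (ursubmx d).
  apply: (is_mderive_unique d3); apply: (@eq_is_mderive _ _ _ _ _ _ _ _ (is_mderiveN da)).
  by move=> y; rewrite [in RHS]uE block_mxKdl.
rewrite -[d]submxK z1 z3 z4 /Q2 (is_mderiveE d2) (is_mderiveE da) [in RHS]uE.
move: (ursubmx d) (ursubmx (u x)) => q' q.
rewrite cstructE !(mulmx_block, add_block_mx).
rewrite !(mulmx0, mul0mx, addr0, add0r, mulNmx, mulmxN, opprK, mul_scalar_mx, scalerN, scaleNr).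
by [].
Qed.

Lemma dev_derive (gam g : R -> M) x d : is_dev gam g -> is_mderive gam x d ->
  is_mderive g x ((gam x + gam x) *m d *m g x).
Proof.
move=> [ug [gE [_ [dg pg]]]].
have /in_perpP := pg x; rewrite unitary_invmx// => -[wsk sw].
apply: (normal_frame_derive (ss k m) ug _ (dg x) wsk sw) => y.
by rewrite gE unitary_invmx.
Qed.

(** Both solve the same skew equation, so adj(h) g is constant, and it tends to 1 at -oo. *)
Lemma frame_unique n (P g h : R -> 'M[C]_n) : (forall x, adj (P x) = - P x) ->
  (forall x, unitary (h x)) ->
  (forall x, is_mderive g x (P x *m g x)) -> (forall x, is_mderive h x (P x *m h x)) ->
  mlim_minf g 1%:M -> mlim_minf h 1%:M -> g = h.
Proof.
move=> skP uh dg dh lg lh.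
have d0 x : is_mderive (fun y => adj (h y) *m g y) x 0.
  have := is_mderiveM (is_mderive_adj (dh x)) (dg x).
  by rewrite adjM skP mulmxN mulNmx mulmxA addNr.
have l1 := mlim_minfM (mlim_minf_adj lh) lg; rewrite adj1 mulmx1 in l1.
apply/funext => x; have e : adj (h x) *m g x = 1%:M.
  apply: mlim_minf_unique l1; apply: mlim_minf_ext (mlim_minf_cst _) => y.
  exact: (is_mderive0_cst d0).
by rewrite -[g x]mul1mx -(uh x) -mulmxA e mulmx1.
Qed.

(** [Phi] picks its frame by choice; uniqueness allows its value to be computed with any frame at
    hand, such as the one of a flat connection. *)
Lemma Phi_dev (gam g T : R -> M) x : (forall y, Defs.in_orbit (gam y)) ->
  (forall y, is_mderive gam y (T y)) ->
  (forall y, adj ((gam y + gam y) *m T y) = - ((gam y + gam y) *m T y)) ->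
  is_dev gam g -> Phi gam x = adj (g x) *m ((gam x + gam x) *m T x) *m g x.
Proof.
move=> og dgam skP dg; rewrite /Phi; case: pselect => [H|]; last by case; exists g.
case: (cid H) => g' /= dg'.
have d1 y := dev_derive dg (dgam y); have d2 y := dev_derive dg' (dgam y).
have -> : g' = g.
  by apply: (frame_unique skP _ d2 d1); [case: dg|case: dg' => _ [_ []]|case: dg => _ [_ []]].
by rewrite unitary_invmx ?(is_mderiveE (d1 x)) ?mulmxA//; case: dg.
Qed.

End Development.
End DevelopmentMap.

(** * The flat frame normalised at minus infinity *)

Section NormalFrame.
Context {R : realType} (n : nat).
Local Notation M := 'M[R[i]]_n.
Variables gam T X Y Z : R -> R -> M.
Hypotheses (dgam : forall x t, is_mderive (fun y => gam y t) x (T x t))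
  (dT : forall x t, is_mderive (fun y => T y t) x (X x t))
  (dX : forall x t, is_mderive (fun y => X y t) x (Y x t))
  (dY : forall x t, is_mderive (fun y => Y y t) x (Z x t)).
Hypotheses (cgam : mjcontinuous gam) (cT : mjcontinuous T) (cX : mjcontinuous X)
  (cY : mjcontinuous Y) (cZ : mjcontinuous Z).
Hypothesis gam_t : forall x t, is_mderive (gam x) t (comm (gam x t) (X x t)).
Hypotheses (gam_skew : forall x t, adj (gam x t) = - gam x t)
  (gam_sqr : forall x t, (gam x t + gam x t) *m (gam x t + gam x t) = - 1%:M).

Let anti (A B : M) : (A + A) *m B = - (B *m (A + A)) -> A *m B = - (B *m A).
Proof. by move=> h; apply: mx_double_inj; rewrite -mulmxDl h mulmxDr opprD. Qed.

Let P_bracket x t : flowP gam T x t *m gam x t - gam x t *m flowP gam T x t = T x t.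
Proof.
apply: (flow_bracket_gam (gam_sqr x t)) => //; apply: anti.
exact: (flow_ST dgam gam_sqr).
Qed.

(** S T^2 commutes with gamma, so only the part S V of N contributes. *)
Let N_bracket x t : flowN gam T X x t *m gam x t - gam x t *m flowN gam T X x t = flowV gam T X x t.
Proof.
have h : flowS gam x t *m flowV gam T X x t *m gam x t - gam x t *m (flowS gam x t *m flowV gam T X x t) = flowV gam T X x t.
  apply: (flow_bracket_gam (gam_sqr x t)) => //; apply: anti.
  exact: (flow_SV dgam dT gam_t gam_sqr).
have gT : gam x t *m T x t = - (T x t *m gam x t).
  by apply: anti; exact: (flow_ST dgam gam_sqr).
have gS : gam x t *m flowS gam x t = flowS gam x t *m gam x t by rewrite /flowS mulmxDl mulmxDr.
have e : flowS gam x t *m (T x t *m T x t) *m gam x t = gam x t *m (flowS gam x t *m (T x t *m T x t)).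
  rewrite [RHS]mulmxA gS -!mulmxA; congr (_ *m _).
  by rewrite !mulmxA gT mulNmx -(mulmxA _ (gam x t)) gT mulmxN opprK mulmxA.
rewrite -[RHS]h /flowN /flowW.
move: (flowS gam x t) (flowV gam T X x t) e => S V e.
by rewrite mulmxDr mulmxDl mulmxDr e opprD addrACA subrr addr0.
Qed.

(** gamma_x = [P, gamma] and gamma_t = [N, gamma]: gamma is parallel for the connection. *)
Lemma conj_gam_cst (G : R -> R -> M) :
  (forall x t, is_mderive (fun y => G y t) x (flowP gam T x t *m G x t)) ->
  (forall x t, is_mderive (G x) t (flowN gam T X x t *m G x t)) ->
  forall x t, conjG G gam x t = conjG G gam 0 0.
Proof.
move=> G_x G_t x t.
have dx y r : is_mderive (fun y => conjG G gam y r) y 0.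
  have := conjG_x dgam gam_skew gam_sqr G_x (dgam y r).
  by rewrite /conjG -opprB P_bracket subrr mulmx0 mul0mx.
have dt y r : is_mderive (fun r => conjG G gam y r) r 0.
  have := conjG_t dgam dT gam_t gam_skew gam_sqr G_t (flow_gam_t dgam dT gam_t gam_sqr y r).
  by rewrite /conjG -opprB N_bracket subrr mulmx0 mul0mx.
transitivity (conjG G gam 0 t); first exact: (is_mderive0_cst (dx ^~ t)).
exact: (is_mderive0_cst (dt 0)).
Qed.

Variable b : M.
Hypotheses (gam_00 : exists2 g, unitary g & gam 0 0 = g *m b *m adj g)
  (gam_ninfty : forall t, mlim_minf (gam^~ t) b).
Hypotheses (decT : decaying T) (decX : decaying X) (decY : decaying Y).

(** The limit c of the flat frame at -oo is unitary, independent of t, and commutes with b because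
    gamma tends to b; the frame sought is G times the adjoint of c. It still solves the t-equation
    precisely because c is constant. *)
Lemma normal_frame : exists G : R -> R -> M,
  [/\ forall x t, unitary (G x t),
      forall x t, is_mderive (fun y => G y t) x (flowP gam T x t *m G x t),
      forall x t, is_mderive (G x) t (flowN gam T X x t *m G x t),
      forall x t, gam x t = G x t *m b *m adj (G x t)
    & forall t, mlim_minf (G^~ t) 1%:M].
Proof.
have [g0 ug0 g0E] := gam_00.
have [G [G0 uG G_x G_t cG]] := flat_frame (flow_cP cgam cT) (flow_cN cgam cT cX)
  (flow_cPt cgam cT cX cY) (flow_P_adj dgam gam_skew gam_sqr)
  (flow_N_adj dgam dT gam_t gam_skew gam_sqr) (flow_dN dgam dT dX)
  (flow_P_t dgam dT dX cgam cT cX cY gam_t gam_sqr)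
  (flow_zero_curvature Y dgam dT gam_t gam_sqr) ug0.
have gamE x t : gam x t = G x t *m b *m adj (G x t).
  have <- : conjG G gam x t = b.
    by rewrite (conj_gam_cst G_x G_t) /conjG G0 g0E !mulmxA unitaryV// mul1mx -mulmxA unitaryV// mulmx1.
  by rewrite /conjG !mulmxA uG mul1mx -mulmxA uG mulmx1.
have lim := frame_limit uG G_x gamE decT.
have lim_const := @frame_limit_const _ _ _ _ _ _ _ dgam dT dX dY cgam cT cX cY cZ
  gam_t gam_skew gam_sqr _ _ uG cG G_x G_t gamE decT decX decY.
have [c c0] := lim 0.
have cl t : mlim_minf (G^~ t) c.
  have [c' h'] := lim t; have [t0|t0] := lerP 0 t.
    by rewrite (lim_const _ _ _ _ t0 c0 h').
  by rewrite -(lim_const _ _ _ _ (ltW t0) h' c0).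
have uc : unitary c.
  apply: (mlim_minf_unique _ (mlim_minf_cst 1%:M)).
  by apply: mlim_minf_ext (mlim_minfM c0 (mlim_minf_adj c0)) => x; exact: uG.
have cb : c *m b *m adj c = b.
  apply: (mlim_minf_unique _ (gam_ninfty 0)).
  apply: mlim_minf_ext (mlim_minfM (mlim_minfM c0 (mlim_minf_cst b)) (mlim_minf_adj c0)) => x.
  by rewrite gamE.
have bc : adj c *m b *m c = b.
  by rewrite -[in LHS]cb !mulmxA unitaryV// mul1mx -mulmxA unitaryV// mulmx1.
exists (fun x t => G x t *m adj c); split.
- by move=> x t; apply: unitaryM => //; exact: unitary_adj.
- by move=> x t; rewrite mulmxA; exact: is_mderiveMr.
- by move=> x t; rewrite mulmxA; exact: is_mderiveMr.
- move=> x t; rewrite adjM adjK gamE !mulmxA -[in LHS]bc; congr (_ *m _).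
  by rewrite !mulmxA.
- move=> t; rewrite -uc; exact: (mlim_minfM (cl t) (mlim_minf_cst _)).
Qed.

End NormalFrame.

(** * From the flow of gamma to the equation for Phi(gamma) *)

Section Final.
Context {R : realType} (k m : nat).
Local Notation M := 'M[R[i]]_(k + m).
Variable gam : R -> R -> M.
Hypotheses (smooth_gam : msmooth2 gam) (gam_Ca : forall t, in_Ca (gam^~ t)).
Hypothesis gnls : forall x t, mderive (gam x) t = comm (gam x t) (mderive (mderive (gam^~ t)) x).

Let g p x t := mderiven p (gam^~ t) x.

Lemma Phi_mnls x t : let u := fun x t => Phi (gam^~ t) x in
    mderivable (u x) t /\ mderivable (Q2 (u^~ t)) x /\
    mderive (u x) t = mderive (Q2 (u^~ t)) x + comm (u x t) (Q2 (u^~ t) x).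
Proof.
have orb y r : Defs.in_orbit (gam y r) by have [h _] := gam_Ca r; exact: h.
have dg p y r : is_mderive (fun y => g p y r) y (g p.+1 y r) by exact: msmooth2_x.
have cg p : mjcontinuous (g p) by exact: msmooth2_continuous.
have gam_t y r : is_mderive (gam y) r (comm (gam y r) (g 2 y r)).
  by rewrite -[comm _ _]gnls; apply: mderivable_is_mderive; exact: msmooth2_t.
have gam_skew y r : adj (gam y r) = - gam y r by apply: orbit_skew.
have gam_sqr y r : (gam y r + gam y r) *m (gam y r + gam y r) = - 1%:M by apply: orbit_sqr.
(* The index starts at 1 because gamma tends to a and only its derivatives decay. *)
have dec p : decaying (g p.+1).
  move=> r; have [_ [_ [_ sch]]] := gam_Ca r; have [B B0 HB] := mschwartz_decay p sch.
  by exists B => // y; rewrite /g /mderiven iterSr; exact: HB.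
have [G [uG G_x G_t gamE limG]] := normal_frame (dg 0) (dg 1) (dg 2) (dg 3) (cg 0) (cg 1) (cg 2) (cg 3) (cg 4)
  gam_t gam_skew gam_sqr (orbitP (orb 0 0)) (fun r => (gam_Ca r).2.2.1) (dec 0) (dec 1) (dec 2).
have P_adj y r := flow_P_adj (dg 0) gam_skew gam_sqr y r.
have u_x y r := fu_x (dg 0) (dg 1) gam_skew gam_sqr G_x y r.
have u_t y r := fu_t (dg 0) (dg 1) (dg 2) (cg 0) (cg 1) (cg 2) (cg 3) gam_t gam_skew gam_sqr G_t y r.
have Q_x y r := fQ_x (dg 0) (dg 1) (dg 2) gam_skew gam_sqr uG G_x gamE y r.
have perp y r : in_perp (fu gam (g 1) G y r).
  apply/in_perpP; split; first exact: (fu_skew (dg 0) gam_skew gam_sqr).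
  exact: (s_fu (dg 0) gam_sqr uG gamE).
have dev r : is_dev (gam^~ r) (G^~ r).
  split; first by move=> y; exact: uG.
  split; first by move=> y; rewrite unitary_invmx.
  split; first exact: limG.
  split=> y; first exact: is_mderive_mderivable (G_x y r).
  by rewrite unitary_invmx// (is_mderiveE (G_x y r)) mulmxA; exact: perp.
have uE y r : Phi (gam^~ r) y = fu gam (g 1) G y r.
  by apply: (Phi_dev y (orb ^~ r) (dg 0 ^~ r) (P_adj ^~ r) (dev r)).
have QE y : Q2 (fun y => fu gam (g 1) G y t) y = fQ gam (g 1) (g 2) (base_a k m) G y t.
  exact: (Q2_perp (perp ^~ t) (u_x y t)).
move=> u; have -> : u = fu gam (g 1) G by apply/funext => y; apply/funext => r; exact: uE.
rewrite QE (funext QE) (is_mderiveE (u_t x t)) (is_mderiveE (Q_x x t)).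
split; first exact: is_mderive_mderivable (u_t x t).
split; first exact: is_mderive_mderivable (Q_x x t).
by rewrite subrK.
Qed.

End Final.

Local Close Scope classical_set_scope.
Unset Implicit Arguments. Set Strict Implicit.

(** [mderive] and [Phi] are total with default values. Differentiability of u in t and of Q_2 in x
    is therefore part of the conclusion, which makes the equation one between genuine derivatives;
    that [Phi] takes its first branch is settled by exhibiting a frame. *)
Theorem theorem3p10 (R : realType) (k m : nat) (gam : R -> R -> 'M[R[i]]_(k + m)) :
  msmooth2 gam ->
  (forall t, in_Ca (fun x => gam x t)) ->
  (forall x t, mderive (fun s => gam x s) t =
               comm (gam x t) (mderive (mderive (fun y => gam y t)) x)) ->
  let u := fun x t => Phi (fun y => gam y t) x in
  forall x t,
    mderivable (fun s => u x s) t /\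
    mderivable (Q2 (fun y => u y t)) x /\
    mderive (fun s => u x s) t =
      mderive (Q2 (fun y => u y t)) x + comm (u x t) (Q2 (fun y => u y t) x).
Proof.
by move=> smooth_gam gam_Ca gnls u x t; exact: Phi_mnls.
Qed.
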